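(* There exists an absolute constant $C>0$ (independent of $L,\sigma,\delta,\mathrm{A}$ and $F^1$) such that the following holds. Let $L\ge 1$, $\sigma>0$ and $\delta>0$ be such that $L/\delta\in\mathbb{N}$. Let $\mathrm{A}\ge 0$, let $F^1\colon\mathbb{C}\to\mathbb{C}$ be a deterministic entire function with $|F^1(z)|\le \mathrm{A}\,e^{\frac12|z|^2}$ for all $z\in\mathbb{C}$, let $F^0$ be the zero-mean (circularly symmetric) Gaussian entire function with $\mathbb{E}\{F^0(z)\overline{F^0(w)}\}=e^{z\bar w}$ for all $z,w\in\mathbb{C}$, and let $F=F^1+\sigma F^0$. Let a realization of $F$ be observed on the grid $\Lambda_{L+2\delta}$, and let $\mathrm{Z}$ be the output of the AMN algorithm (described in the context) applied to these samples with parameters $L$ and $\delta$. Then, with probability at least $$1-C\,L^2\exp\Big(\frac{\mathrm{A}^2}{8\sigma^2}\Big)\max\{1,\log^2(1/\delta)\}\,\delta^4,$$ there is an injective map $\Phi\colon\{F=0\}\cap\Omega_L\to\mathrm{Z}$ such that: (i) $|\Phi(\zeta)-\zeta|_\infty\le 2\delta$ for every $\zeta\in\{F=0\}\cap\Omega_L$; and (ii) for each $\lambda\in\mathrm{Z}\cap\Omega_{L-2\delta}$ there exists $\zeta\in\{F=0\}\cap\Omega_L$ such that $\lambda=\Phi(\zeta)$.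
   Context: Notation. For $z=x+iy\in\mathbb{C}$, $|z|_\infty=\max\{|x|,|y|\}$, and $|z|$ is the usual absolute value. For real $M$, $\Omega_M=\{x+iy: |x|,|y|\le M\}$. The grid with spacing $\delta$ is $\Lambda=\{\delta k+i\delta j: k,j\in\mathbb{Z}\}$, and $\Lambda_M=\Lambda\cap\Omega_M$. The zero set of $F$ is denoted $\{F=0\}$. Gaussian entire function: $F^0$ is a random function that is almost surely entire and such that, for all $z_1,\dots,z_n\in\mathbb{C}$, $(F^0(z_1),\dots,F^0(z_n))$ is a circularly symmetric complex normal vector with mean zero and covariance matrix $[e^{z_k\overline{z_\ell}}]_{k,\ell}$. Equivalently, $F^0(z)=\sum_{n\ge0}\frac{\xi_n}{\sqrt{n!}}z^n$ with $(\xi_n)_{n\ge 0}$ independent standard complex normal variables (mean zero, $\mathbb{E}|\xi_n|^2=1$). AMN (adaptive minimal grid neighbors) algorithm. Input: $L\ge1$, $\delta>0$, and samples of a function $F\colon\mathbb{C}\to\mathbb{C}$ on $\Lambda_{L+2\delta}$. Selection step: for each $\lambda\in\Lambda_L$ define the comparison margin $$\eta_\lambda=e^{-\frac12|\lambda|^2}\max\big\{|F(\lambda)|,\ \tfrac34\,\big|e^{-\delta\bar\lambda}F(\lambda+\delta)-F(\lambda)\big|\big\}.$$ The point $\lambda\in\Lambda_L$ is selected if $$e^{-\frac12|\mu|^2}|F(\mu)|\ \ge\ e^{-\frac12|\lambda|^2}|F(\lambda)|+\eta_\lambda\qquad\text{for all }\mu\in\Lambda\text{ with }|\lambda-\mu|_\infty=2\delta.$$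 Let $\mathrm{Z}_1\subseteq\Lambda_L$ be the set of all selected points. Sieving step: by means of any clustering procedure, choose a subset $\mathrm{Z}\subseteq\mathrm{Z}_1$ that is $5\delta$-separated, i.e. $|\lambda-\mu|_\infty\ge5\delta$ for all distinct $\lambda,\mu\in\mathrm{Z}$, and that is maximal with this property, i.e. no proper superset of $\mathrm{Z}$ contained in $\mathrm{Z}_1$ is $5\delta$-separated. Output: the set $\mathrm{Z}$. (The particular procedure used to choose $\mathrm{Z}$ in the sieving step is arbitrary.) *)

(* Defs.v *)
From HB Require Import structures.
From mathcomp Require Export all_boot all_order all_algebra.
From mathcomp Require Export complex.
From mathcomp Require Export all_classical all_reals all_analysis.
From mathcomp Require Import lra.

Set Implicit Arguments.
Unset Strict Implicit.
Unset Printing Implicit Defensive.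

Export Order.TTheory GRing.Theory Num.Theory.
Export numFieldNormedType.Exports.
Export ComplexField.Normc.

Local Open Scope classical_set_scope.
Local Open Scope ring_scope.
Local Open Scope complex_scope.

(* The projections Re and Im below are those of real_closed's complex (R[i] to
   R); normc : R[i] -> R is the R-valued modulus, whereas `|z| is R[i]-valued. *)

Section ComplexPlane.
Context {R : realType}.
Implicit Types (z : R[i]) (F : R[i] -> R[i]) (M delta : R).

Definition cexp z : R[i] :=
  (expR (complex.Re z) * cos (complex.Im z))
  +i* (expR (complex.Re z) * sin (complex.Im z)).

Definition normoo z : R := Num.max `|complex.Re z| `|complex.Im z|.

Definition Omega M : set R[i] :=
  [set z | `|complex.Re z| <= M /\ `|complex.Im z| <= M].

Definition grid delta : set R[i] :=
  [set z | exists k j : int, z = (delta * k%:~R) +i* (delta * j%:~R)].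

Definition zero_set F : set R[i] := [set z | F z = 0].

(* Scalars and increments range over R[i], so this is complex
   differentiability; R[i]^o is R[i] as a normed space over itself. *)
Definition entire F : Prop :=
  forall z, derivable (F : R[i]^o -> R[i]^o) z 1.

End ComplexPlane.

Section AMN.
Context {R : realType}.
Variables (L delta : R) (F : R[i] -> R[i]).
Implicit Types Z : set R[i].

Definition weight (z : R[i]) : R := expR (- (normc z ^+ 2 / 2)).

Definition margin (l : R[i]) : R :=
  weight l * Num.max (normc (F l))
    (3 / 4 * normc (cexp (- (delta%:C * conjc l)) * F (l + delta%:C) - F l)).

Definition amn_selected : set R[i] :=
  [set l | (grid delta `&` Omega L) l /\
    forall m, grid delta m -> normoo (l - m) = 2 * delta ->
      weight m * normc (F m) >= weight l * normc (F l) + margin l].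

Definition separated (r : R) Z : Prop :=
  forall l m, Z l -> Z m -> l <> m -> r <= normoo (l - m).

(* The sieving procedure is arbitrary, so the output is specified by a
   predicate; it depends on F only through the selected points, hence through
   the samples on the grid (see amn_selected_samples). *)
Definition amn_output Z : Prop :=
  [/\ Z `<=` amn_selected,
      separated (5 * delta) Z
    & forall Z', Z `<` Z' -> Z' `<=` amn_selected ->
        ~ separated (5 * delta) Z'].

End AMN.

Lemma amn_selected_samples (R : realType) (L delta : R) (F G : R[i] -> R[i]) :
    0 < delta ->
    {in grid delta `&` Omega (L + 2 * delta), F =1 G} ->
  amn_selected L delta F = amn_selected L delta G.
Proof.
move=> d0 FG.
suff H F' G' : {in grid delta `&` Omega (L + 2 * delta), F' =1 G'} ->
    amn_selected L delta F' `<=` amn_selected L delta G'.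
  by apply/seteqP; split; apply: H => // z /FG.
move=> {}FG l [[gl [lx ly]] sl]; split=> // m gm lm.
have -> : weight m * normc (G' m) = weight m * normc (F' m).
  rewrite FG// inE; split=> //; move: lx ly lm.
  case: l {gl sl} m {gm} => [a b] [a' b'] /=; rewrite /normoo /= => lx ly lm.
  have := lexx (2 * delta); rewrite -{1}lm ge_max => /andP[h1 h2].
  move: lx ly h1 h2; rewrite /Omega/= !ler_norml.
  by move=> /andP[? ?] /andP[? ?] /andP[? ?] /andP[? ?]; split; apply/andP; split; lra.
have <- : F' l = G' l by apply: FG; rewrite inE; split=> //; split; lra.
rewrite /margin; have <- : F' (l + delta%:C) = G' (l + delta%:C).
  apply: FG; rewrite inE; move: gl lx ly => [k [j ->]] /= lx ly; split.
    exists (k + 1), j; apply/eqP.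
    by rewrite eq_complex /= addr0 eqxx andbT intrD mulrDr mulr1.
  move: lx ly; rewrite /Omega/= addr0 !ler_norml.
  by move=> /andP[? ?] /andP[? ?]; split; apply/andP; split; lra.
have <- : F' l = G' l by apply: FG; rewrite inE; split=> //; split; lra.
exact: sl.
Qed.

Section Probability.
Context {R : realType} {d : measure_display} {T : measurableType d}.
Variable P : probability T R.
Local Open Scope ereal_scope.

(* Inner-probability reading: the event E itself need not be measurable. *)
Definition with_probability_at_least (p : R) (E : set T) : Prop :=
  exists B : set T, [/\ measurable B, B `<=` E & p%:E <= P B].

(* normal_prob m 0 is not the Dirac mass at m (the library sets it to the
   uniform law on [0, 1]), hence the separate degenerate case. *)
Definition is_normal (Y : T -> R) : Prop :=
  measurable_fun [set: T] Y /\
  exists m s : R, forall B : set R, measurable B ->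
    P (Y @^-1` B) = if s == 0%R then \d_m B else normal_prob m s B.

Definition cexpectation (X : T -> R[i]) : R[i] :=
  fine 'E_P[fun w => complex.Re (X w)] +i* fine 'E_P[fun w => complex.Im (X w)].

Section Vectors.
Variable n : nat.
Implicit Type X : 'I_n -> T -> R[i].

(* Joint normality of the 2n real components, via their linear combinations. *)
Definition complex_normal X : Prop :=
  forall a b : 'I_n -> R, is_normal (fun w =>
    \sum_(k < n) (a k * complex.Re (X k w) + b k * complex.Im (X k w)))%R.

Definition joint_law X : set (n.-tuple (R * R)) -> \bar R :=
  pushforward P (fun w =>
    [tuple (complex.Re (X k w), complex.Im (X k w)) | k < n]).

Definition circularly_symmetric X : Prop :=
  forall (theta : R) (B : set (n.-tuple (R * R))), measurable B ->
    joint_law (fun k w => cexp (0 +i* theta) * X k w)%R B = joint_law X B.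

Definition circular_complex_normal X (Gamma : 'M[R[i]]_n) : Prop :=
  [/\ complex_normal X,
      circularly_symmetric X,
      forall k, cexpectation (X k) = 0%R
    & forall k l, cexpectation (fun w => X k w * conjc (X l w))%R = Gamma k l].

End Vectors.

Definition gaussian_entire_function (F0 : T -> R[i] -> R[i]) : Prop :=
  {ae P, forall w, entire (F0 w)} /\
  forall (n : nat) (z : 'I_n -> R[i]),
    circular_complex_normal (fun k w => F0 w (z k))
      (\matrix_(k, l) cexp (z k * conjc (z l)))%R.

End Probability.

(* Main.v *)
Require Import Defs.
From mathcomp Require Import all_boot all_order all_algebra.
From mathcomp Require Import complex.
From mathcomp Require Import all_classical all_reals all_analysis.
From mathcomp Require Import measurable_realfun ring lra.

Set Implicit Arguments.
Unset Strict Implicit.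
Unset Printing Implicit Defensive.

Local Open Scope classical_set_scope.
Local Open Scope ring_scope.
Local Open Scope complex_scope.

(* Let [F_l z = e^(-|l|^2/2 - z conj l) F (l + z)] be the Fock translate of [F] at
   a grid point [l].  If [e^(-|z|^2/2) |F z| <= M] on a slightly larger square,
   Cauchy's estimates show that [F_l] is affine near the origin with slope [b],
   up to errors of order [M delta^2].  Unless both [F_l 0] and
   [F_l delta - F_l 0] are [O (M delta^2)], the comparison of [F_l 0] with the
   sixteen values at distance [2 delta] is therefore decided by the affine part: a
   zero within [delta / 2] of [l] makes [l] selected, and a selected [l] has [|b|]
   large compared with [M delta] and, by the contraction principle, a zero within
   [3 delta / 2], unique within [12 delta].  This separates the zeros, so that
   any maximal separated set of selected points matches them.
   For the Gaussian part, a dyadic chaining over the square shows that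
   [M = A + O (sigma sqrt (log (1/delta)))] outside an event of probability
   [O (L^2 delta^4)].  The variables [F_l 0] and [F_l delta - F_l 0] are
   uncorrelated with variances [1] and [e^(delta^2) - 1], so both are
   [O (M delta^2)] with probability [O ((M / sigma)^4 delta^6)]; there are
   [O (L^2 / delta^2)] grid points, and
   [(A / sigma)^4 = O (exp (A^2 / (8 sigma^2)))]. *)

(** * The complex modulus and exponential *)

(** The Gaussian law is given only through real linear combinations of values, so no joint density
    is at hand: moments and characteristic functions come from Stein's identity in one dimension,
    and the small-ball bound from integrating a trigonometric sum. The rate [delta^6] is
    [(M delta^2)^4], in units of [sigma], divided by the variance [delta^2] of the increment; the
    squared logarithm in the theorem is the fourth power of [sqrt (log (1/delta))]. The event of the
    conclusion need not be measurable, hence an exceptional set is built as a countable union of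
    measurable events at grid points and dyadic points, together with a null set off which [F0] is
    entire; continuity carries the bounds from dyadic points to the whole square. The comparison has
    little room: for a zero within [delta / 2], its left side is at most about [1.46 |b| delta] and
    its right side at least about [1.49 |b| delta]; a factor 1000 between slope and remainder makes
    the remainder negligible against this gap. *)

Section ComplexModulus.
Context {R : realType}.
Implicit Types (z w : R[i]) (x : R).

Lemma normc_ge0 z : 0 <= normc z.
Proof. by case: z => a b; exact: sqrtr_ge0. Qed.

Lemma sqr_normc2 z : normc z ^+ 2 = complex.Re z ^+ 2 + complex.Im z ^+ 2.
Proof. by case: z => a b; rewrite /= sqr_sqrtr// addr_ge0// sqr_ge0. Qed.

Lemma Re_le_normc z : `|complex.Re z| <= normc z.
Proof. by case: z => a b /=; rewrite -sqrtr_sqr ler_wsqrtr// lerDl sqr_ge0. Qed.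

Lemma Im_le_normc z : `|complex.Im z| <= normc z.
Proof. by case: z => a b /=; rewrite -sqrtr_sqr ler_wsqrtr// lerDr sqr_ge0. Qed.

Lemma normc_le_ReIm z : normc z <= `|complex.Re z| + `|complex.Im z|.
Proof.
rewrite -(@ler_pXn2r _ 2) ?nnegrE ?normc_ge0 ?addr_ge0//.
rewrite sqr_normc2 sqrrD !real_normK ?num_real//.
by have : 0 <= `|complex.Re z| * `|complex.Im z|; [rewrite mulr_ge0|lra].
Qed.

Lemma normc_real x : normc x%:C = `|x|.
Proof. by rewrite /= expr0n addr0 sqrtr_sqr. Qed.

Lemma normc_distC z w : normc (z - w) = normc (w - z).
Proof. by rewrite -normcN opprB. Qed.

Lemma le_normcB z w : normc (z - w) <= normc z + normc w.
Proof. by rewrite (le_trans (le_normcD _ _))// normcN. Qed.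

Lemma le_normc_dist z w : normc z - normc w <= normc (z - w).
Proof. by rewrite lerBlDr (le_trans _ (le_normcD _ _))// subrK. Qed.

Lemma normc_le_sqr z x : 0 <= x -> normc z ^+ 2 <= x ^+ 2 -> normc z <= x.
Proof. by move=> x0; rewrite ler_pXn2r// nnegrE normc_ge0. Qed.

Lemma normoo_le_normc z : normoo z <= normc z.
Proof. by rewrite /normoo ge_max Re_le_normc Im_le_normc. Qed.

Lemma ReD z w : complex.Re (z + w) = complex.Re z + complex.Re w.
Proof. by case: z w => a b []. Qed.

Lemma ImD z w : complex.Im (z + w) = complex.Im z + complex.Im w.
Proof. by case: z w => a b []. Qed.

Lemma ReB z w : complex.Re (z - w) = complex.Re z - complex.Re w.
Proof. by case: z w => a b []. Qed.

Lemma ImB z w : complex.Im (z - w) = complex.Im z - complex.Im w.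
Proof. by case: z w => a b []. Qed.

Lemma ReM z w : complex.Re (z * w) =
  complex.Re z * complex.Re w - complex.Im z * complex.Im w.
Proof. by case: z w => a b []. Qed.

Lemma ImM z w : complex.Im (z * w) =
  complex.Re z * complex.Im w + complex.Im z * complex.Re w.
Proof. by case: z w => a b []. Qed.

Lemma complexP z w : complex.Re z = complex.Re w ->
  complex.Im z = complex.Im w -> z = w.
Proof. by case: z w => a b [c d] /= -> ->. Qed.

End ComplexModulus.

Section ComplexExponential.
Context {R : realType}.
Implicit Types (z w : R[i]) (x : R).

Lemma cexp0 : cexp 0 = 1 :> R[i].
Proof. by rewrite /cexp /= expR0 cos0 sin0 mulr0 mulr1. Qed.

Lemma cexpD z w : cexp (z + w) = cexp z * cexp w.
Proof.
case: z w => a b [c d]; rewrite /cexp /= expRD cosD sinD.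
by apply: complexP; rewrite /=; ring.
Qed.

Lemma normc_cexp z : normc (cexp z) = expR (complex.Re z).
Proof.
rewrite /cexp /= !exprMn -mulrDr cos2Dsin2 mulr1 sqrtr_sqr.
by rewrite ger0_norm ?expR_ge0.
Qed.

Lemma cexp_neq0 z : cexp z != 0.
Proof.
apply/eqP => /(congr1 (@normc R)); rewrite normc_cexp normc0 => /eqP.
by rewrite gt_eqF ?expR_gt0.
Qed.

Lemma cexpN z : cexp (- z) = (cexp z)^-1.
Proof.
by apply: (mulIf (cexp_neq0 z)); rewrite -cexpD addNr cexp0 mulVf ?cexp_neq0.
Qed.

Lemma cexp_real x : cexp x%:C = (expR x)%:C.
Proof. by rewrite /cexp /= cos0 sin0 mulr1 mulr0. Qed.

Lemma conjc_cexp z : conjc (cexp z) = cexp (conjc z).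
Proof. by case: z => a b; rewrite /cexp /= cosN sinN mulrN. Qed.

End ComplexExponential.

(** * Cauchy estimates from Goursat's theorem *)

Section ComplexDifferentiability.
Context {R : realType}.
Implicit Types (f g : R[i] -> R[i]) (u : R -> R[i]) (z w l m : R[i]) (x y : R).

(** The error is proportional to [normc h] and [h = 0] is included: no quotient is formed, so
    products and compositions need no case distinction. [rdiff] is the analogue for curves, with
    real increments. *)
Definition cdiff f z l := forall e : R, 0 < e -> exists2 d : R, 0 < d &
  forall h, normc h <= d -> normc (f (z + h) - f z - l * h) <= e * normc h.

Definition rdiff u x l := forall e : R, 0 < e -> exists2 d : R, 0 < d &
  forall h : R, `|h| <= d -> normc (u (x + h) - u x - l * h%:C) <= e * `|h|.

Lemma derivable_cdiff f z :
  derivable (f : R[i]^o -> R[i]^o) z 1 -> exists l, cdiff f z l.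
Proof.
move=> /cvg_ex [/= l /cvgrPdist_le H]; exists l => e e0.
have /H /= : (0 : R[i]) < e%:C by rewrite ltcR.
move=> /nbhs_ballP[/= d d0 Hd].
(* A positive element of [R[i]] has zero imaginary part, so the radius [d] is a real number. *)
have dR : 0 < complex.Re d by move: d0; rewrite ltcE => /andP[].
have dE : d = (complex.Re d)%:C.
  by move: d0; rewrite ltcE /= => /andP[/eqP dI _]; apply: complexP.
exists (complex.Re d / 2); first by rewrite divr_gt0.
move=> h hd; have [->|h0] := eqVneq h 0.
  by rewrite addr0 subrr mulr0 subr0 !normc0 mulr0.
have nh : 0 < normc h.
  by rewrite lt_def normc_ge0 andbT; apply: contra h0 => /eqP /eq0_normc ->.
have := Hd h; rewrite /ball /= sub0r normrN => /(_ _ h0).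
rewrite {1}dE -[`|h|]/((normc h)%:C) ltcR => /(_ (le_lt_trans hd _)).
have lt : complex.Re d / 2 < complex.Re d by lra.
move=> /(_ lt).
rewrite -[`|_|]/((normc _)%:C) lecR => He.
rewrite -ler_pdivrMr// -normcV -normcM; apply: le_trans He.
have -> : h *: (1 : R[i]^o) = h by exact: mulr1.
rewrite [_ *: _]/(_ * _) (addrC h) normc_distC.
rewrite le_eqVlt; apply/orP; left; apply/eqP; congr normc.
by rewrite mulrBl mulfK//; congr (_ - _); exact: mulrC.
Qed.

Lemma cdiff_continuous f z l : cdiff f z l ->
  forall e : R, 0 < e -> exists2 d : R, 0 < d &
    forall h, normc h <= d -> normc (f (z + h) - f z) <= e.
Proof.
move=> /(_ 1 ltr01)[d d0 H] e e0; have l0 := normc_ge0 l.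
exists (Num.min d (e / (1 + normc l))).
  by rewrite lt_min d0 divr_gt0// ltr_wpDr.
move=> h; rewrite le_min => /andP[/H H1 H2].
rewrite -[f _ - f z](subrK (l * h)) (le_trans (le_normcD _ _))// normcM.
by move: H2; rewrite ler_pdivlMr; [nra|rewrite ltr_wpDr].
Qed.

Lemma cdiff_cst c z : cdiff (fun=> c) z 0.
Proof.
move=> e e0; exists 1 => // h _; rewrite subrr mul0r subr0 normc0.
by rewrite mulr_ge0 ?normc_ge0 ?ltW.
Qed.

Lemma cdiff_id z : cdiff (fun w => w) z 1.
Proof.
move=> e e0; exists 1 => // h _; have -> : z + h - z - 1 * h = 0 by ring.
rewrite normc0.
by rewrite mulr_ge0 ?normc_ge0 ?ltW.
Qed.

Lemma cdiffD f g z l m : cdiff f z l -> cdiff g z m ->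
  cdiff (fun w => f w + g w) z (l + m).
Proof.
move=> F G e e0; have e2 : 0 < e / 2 by rewrite divr_gt0.
have [d d0 Hd] := F _ e2; have [d' d'0 Hd'] := G _ e2.
exists (Num.min d d'); first by rewrite lt_min d0.
move=> h; rewrite le_min => /andP[/Hd {}Hd /Hd' {}Hd'].
have -> : f (z + h) + g (z + h) - (f z + g z) - (l + m) * h =
  (f (z + h) - f z - l * h) + (g (z + h) - g z - m * h) by ring.
by rewrite (le_trans (le_normcD _ _))//; lra.
Qed.

Lemma cdiffM f g z l m : cdiff f z l -> cdiff g z m ->
  cdiff (fun w => f w * g w) z (l * g z + f z * m).
Proof.
move=> F G e e0.
have := normc_ge0 (f z); have := normc_ge0 (g z); have := normc_ge0 l.
set L := normc l; set A := normc (f z); set B := normc (g z) => L0 B0 A0.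
have K0 : 0 < A + B + L + 1 by lra.
(* The product error splits into four terms whose weights [1], [B], [L] and [A] add up to the
   denominator of [e']; the weight 1 comes from [d2], which keeps the increment of [g] at most 1. *)
pose e' := e / (A + B + L + 1); have e'0 : 0 < e' by rewrite divr_gt0.
have [d d0 Hd] := F _ e'0; have [d' d'0 Hd'] := G _ e'0.
have [d1 d10 Hd1] := cdiff_continuous G e'0.
have [d2 d20 Hd2] := cdiff_continuous G (@ltr01 R).
exists (Num.min d (Num.min d' (Num.min d1 d2))).
  by rewrite !lt_min d0 d'0 d10.
move=> h; rewrite !le_min.
move=> /andP[/Hd {}Hd /andP[/Hd' {}Hd' /andP[/Hd1 {}Hd1 /Hd2 {}Hd2]]].
have -> : f (z + h) * g (z + h) - f z * g z - (l * g z + f z * m) * h =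
  (f (z + h) - f z - l * h) * (g (z + h) - g z) +
  (f (z + h) - f z - l * h) * g z + l * h * (g (z + h) - g z) +
  f z * (g (z + h) - g z - m * h) by ring.
have h0 := normc_ge0 h.
rewrite !(le_trans (le_normcD _ _))// -/A.
have E : e * normc h = e' * normc h * 1 + e' * normc h * B + L * normc h * e' + A * (e' * normc h).
  by rewrite /e'; field; rewrite gt_eqF.
rewrite E; apply: lerD; last first.
  by rewrite normcM ler_wpM2l.
rewrite !(le_trans (le_normcD _ _))//; apply: lerD; last first.
  by rewrite !normcM ler_wpM2l// mulr_ge0.
rewrite !(le_trans (le_normcD _ _))//; apply: lerD; last first.
  by rewrite normcM ler_wpM2r.
by rewrite normcM ler_pM ?normc_ge0.
Qed.

Lemma cdiff_comp f g z l m : cdiff g z m -> cdiff f (g z) l ->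
  cdiff (f \o g) z (l * m).
Proof.
move=> G F e e0.
have := normc_ge0 l; have := normc_ge0 m.
set L := normc l; set M := normc m => M0 L0.
have e'0 : 0 < Num.min 1 (e / (L + M + 1)) by rewrite lt_min ltr01 divr_gt0//; lra.
set e' := Num.min _ _ in e'0.
have e'1 : e' <= 1 by rewrite ge_min lexx.
have e'2 : e' * (L + M + 1) <= e.
  by rewrite -ler_pdivlMr ?ge_min ?lexx ?orbT//; lra.
have [d d0 Hd] := F _ e'0; have [d' d'0 Hd'] := G _ e'0.
have [d1 d10 Hd1] := cdiff_continuous G d0.
exists (Num.min d' d1); first by rewrite lt_min d'0.
move=> h; rewrite le_min => /andP[/Hd' {}Hd' /Hd1 /Hd {}Hd].
move: Hd; rewrite (addrC (g z)) subrK /= => Hd.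
have -> : f (g (z + h)) - f (g z) - l * m * h =
  (f (g (z + h)) - f (g z) - l * (g (z + h) - g z)) + l * (g (z + h) - g z - m * h) by ring.
have h0 := normc_ge0 h.
have Hg : normc (g (z + h) - g z) <= (e' + M) * normc h.
  rewrite -[g (z + h) - g z](subrK (m * h)) (le_trans (le_normcD _ _))//.
  by rewrite normcM mulrDl lerD.
rewrite (le_trans (le_normcD _ _))// normcM -/L.
have : e' * normc (g (z + h) - g z) <= e' * ((e' + M) * normc h).
  by rewrite ler_wpM2l// ltW.
have : L * normc (g (z + h) - g z - m * h) <= L * (e' * normc h).
  by rewrite ler_wpM2l.
have : e' * (L + M + 1) * normc h <= e * normc h by rewrite ler_wpM2r.
have : e' * e' * normc h <= e' * normc h.
  by rewrite ler_wpM2r// ler_piMl// ltW.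
nra.
Qed.

Lemma cdiff_ext f g z l : f =1 g -> cdiff f z l -> cdiff g z l.
Proof. by move=> fg H e /H[d d0 Hd]; exists d => // h; rewrite -!fg; exact: Hd. Qed.

Lemma cdiff_line f p v x l : cdiff f (p + x%:C * v) l ->
  rdiff (fun t : R => f (p + t%:C * v)) x (l * v).
Proof.
move=> F e e0; have v0 := normc_ge0 v.
have e'0 : 0 < e / (normc v + 1) by rewrite divr_gt0//; lra.
have [d d0 Hd] := F _ e'0; exists (d / (normc v + 1)); first by rewrite divr_gt0//; lra.
move=> h; rewrite ler_pdivlMr; last by lra.
move=> hd; have := Hd (h%:C * v); rewrite normcM normc_real.
have -> : p + x%:C * v + h%:C * v = p + (x + h)%:C * v by rewrite rmorphD/=; ring.
rewrite (mulrC (h%:C)) mulrA => /(_ _)/le_trans; apply.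
  by have := normr_ge0 h; nra.
have qe : e / (normc v + 1) * (normc v + 1) = e by rewrite divfK// gt_eqF//; lra.
rewrite -[in leRHS]qe; have := mulr_ge0 (ltW e'0) (normr_ge0 h); nra.
Qed.

Lemma rdiffB u v x l m : rdiff u x l -> rdiff v x m ->
  rdiff (fun t => u t - v t) x (l - m).
Proof.
move=> F G e e0; have e2 : 0 < e / 2 by rewrite divr_gt0.
have [d d0 Hd] := F _ e2; have [d' d'0 Hd'] := G _ e2.
exists (Num.min d d'); first by rewrite lt_min d0.
move=> h; rewrite le_min => /andP[/Hd {}Hd /Hd' {}Hd'].
have -> : u (x + h) - v (x + h) - (u x - v x) - (l - m) * h%:C =
  (u (x + h) - u x - l * h%:C) - (v (x + h) - v x - m * h%:C) by ring.
by rewrite (le_trans (le_normcB _ _))//; lra.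
Qed.

Lemma rdiffZ c u x l : rdiff u x l -> rdiff (fun t => c * u t) x (c * l).
Proof.
move=> F e e0; have c0 := normc_ge0 c.
have e'0 : 0 < e / (normc c + 1) by rewrite divr_gt0//; lra.
have [d d0 Hd] := F _ e'0; exists d => // h /Hd {}Hd.
have -> : c * u (x + h) - c * u x - c * l * h%:C =
  c * (u (x + h) - u x - l * h%:C) by ring.
rewrite normcM (le_trans (ler_wpM2l _ Hd))// mulrA ler_wpM2r//.
by rewrite mulrCA ler_piMr ?ltW// ltr_pdivrMr ?mul1r; lra.
Qed.

End ComplexDifferentiability.

Section RealDerivative.
Context {R : realType}.
Implicit Types (u : R -> R) (g : R -> R[i]).

Lemma is_derive_epsdelta u (x l : R) :
  (forall e : R, 0 < e -> exists2 d : R, 0 < d & forall h : R, `|h| <= d ->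
     `|u (x + h) - u x - l * h| <= e * `|h|) <-> is_derive x 1 u l.
Proof.
have E h : h != 0 ->
    (l - h^-1 *: (u (h *: 1 + x) - u x)) * h = - (u (x + h) - u x - l * h).
  move=> h0; rewrite mulrBl [h *: 1]mulr1 (addrC h) [_ *: _]/(_ * _) mulrAC.
  by rewrite mulVf// mul1r [RHS]opprB.
split=> [H|D].
  have L : (fun h : R => h^-1 *: (u (h *: 1 + x) - u x)) @ 0^' --> l.
    apply/cvgrPdist_le => e e0; have [d d0 Hd] := H _ e0.
    apply/nbhs_ballP; exists d => //= h; rewrite /ball /= sub0r normrN => hd h0.
    rewrite -(@ler_pM2r _ `|h|) ?normr_gt0// -normrM (le_trans _ (Hd h (ltW hd)))//.
    by rewrite E// normrN.
  apply: DeriveDef; first by apply/cvg_ex; exists l.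
  exact/cvg_lim.
move=> e e0.
have L : (fun h : R => h^-1 *: (u (h *: 1 + x) - u x)) @ 0^' --> l.
  by rewrite -(@derive_val _ _ _ _ _ _ _ D); exact: (@ex_derive _ _ _ _ _ _ _ D).
move/cvgrPdist_le : L => /(_ _ e0) /nbhs_ballP[/= d d0 Hd].
exists (d / 2); first by rewrite divr_gt0.
move=> h hd; have [->|h0] := eqVneq h 0.
  by rewrite addr0 subrr mulr0 subr0 normr0 mulr0.
have := Hd h; rewrite /ball /= sub0r normrN => /(_ _ h0).
have hd' : `|h| < d by lra.
move=> /(_ hd'); rewrite -(@ler_pM2r _ `|h|) ?normr_gt0// -normrM; apply: le_trans.
by rewrite E// normrN.
Qed.

Lemma rdiff_is_derive g (x : R) l : rdiff g x l <->
  is_derive x 1 (fun t => complex.Re (g t)) (complex.Re l) /\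
  is_derive x 1 (fun t => complex.Im (g t)) (complex.Im l).
Proof.
split=> [H|[/is_derive_epsdelta H1 /is_derive_epsdelta H2]].
  split; apply/is_derive_epsdelta => e /H[d d0 Hd]; exists d => // h /Hd.
    by apply: le_trans; apply: le_trans (Re_le_normc _); rewrite !ReB ReM/= mulr0 subr0.
  by apply: le_trans; apply: le_trans (Im_le_normc _); rewrite !ImB ImM/= mulr0 add0r.
move=> e e0; have e2 : 0 < e / 2 by rewrite divr_gt0.
have [d d0 Hd] := H1 _ e2; have [d' d'0 Hd'] := H2 _ e2.
exists (Num.min d d'); first by rewrite lt_min d0.
move=> h; rewrite le_min => /andP[/Hd {}Hd /Hd' {}Hd'].
rewrite (le_trans (normc_le_ReIm _))// !ReB !ImB ReM ImM /= !mulr0 subr0 add0r.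
lra.
Qed.

(** The mean value theorem fails for complex values, so it is applied to the real and imaginary
    parts separately; this costs the factor 2. *)
Lemma rdiff_mean_value g dg (a b B : R) : a <= b ->
  (forall x, a <= x <= b -> rdiff g x (dg x)) ->
  (forall x, a <= x <= b -> normc (dg x) <= B) ->
  normc (g b - g a) <= 2 * B * (b - a).
Proof.
move=> ab D dB.
have key u du : (forall x, a <= x <= b -> is_derive x 1 u (du x)) ->
    (forall x, a <= x <= b -> `|du x| <= B) -> `|u b - u a| <= B * (b - a).
  move=> Du uB; have [||c] := @MVT_segment _ u du a b ab.
  - by move=> x; rewrite in_itv/= => /andP[ax xb]; apply: Du; rewrite !ltW.
  - apply: derivable_within_continuous => x; rewrite in_itv/= => axb.
    exact: (@ex_derive _ _ _ _ _ _ _ (Du _ axb)).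
  - rewrite in_itv/= => /uB cB ->; rewrite normrM (@ger0_norm _ (b - a)) ?subr_ge0//.
    by rewrite ler_wpM2r// subr_ge0.
rewrite (le_trans (normc_le_ReIm _))// ReB ImB.
have -> : 2 * B * (b - a) = B * (b - a) + B * (b - a) by ring.
apply: lerD.
  apply: (key (fun t => complex.Re (g t)) (fun t => complex.Re (dg t))) => x axb.
    by have /rdiff_is_derive[] := D _ axb.
  exact: le_trans (Re_le_normc _) (dB _ axb).
apply: (key (fun t => complex.Im (g t)) (fun t => complex.Im (dg t))) => x axb.
  by have /rdiff_is_derive[] := D _ axb.
exact: le_trans (Im_le_normc _) (dB _ axb).
Qed.

(** The primitive is the integral over [[a, x]], an empty interval to the left of [a]; hence the
    restriction [a < x], which is inherited by the rectangles below. *)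
Lemma real_primitive u (a : R) : continuous u ->
  exists U : R -> R, forall x, a < x -> is_derive x 1 U (u x).
Proof.
move=> cu; exists (fun x => \int[lebesgue_measure]_(t in `[a, x]) u t) => x ax.
have xu : x < x + 1 by rewrite ltrDl.
have [|d e] := @continuous_FTC1_closed _ u a x (x + 1) xu _ ax (cu x).
  by apply: continuous_compact_integrable; [exact: segment_compact|exact: continuous_subspaceT].
by apply: DeriveDef; [exact: d|rewrite -e derive1E].
Qed.

Lemma complex_primitive g (a : R) :
  (forall x e : R, 0 < e -> exists2 d : R, 0 < d &
     forall h : R, `|h| <= d -> normc (g (x + h) - g x) <= e) ->
  exists G : R -> R[i], forall x, a < x -> rdiff G x (g x).
Proof.
move=> cg.
have key (p : R[i] -> R) : (forall z w, p (z - w) = p z - p w) ->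
    (forall z, `|p z| <= normc z) -> continuous (fun t => p (g t)).
  move=> pB pn x; apply/cvgrPdist_le => e /(cg x)[d d0 Hd].
  apply/nbhs_ballP; exists d => //= y; rewrite /ball /= => xy.
  have := Hd (y - x); rewrite (addrC x) subrK distrC => /(_ (ltW xy)).
  by apply: le_trans; rewrite distrC -pB.
have [U HU] := real_primitive a (key (@complex.Re R) (@ReB R) (@Re_le_normc R)).
have [V HV] := real_primitive a (key (@complex.Im R) (@ImB R) (@Im_le_normc R)).
exists (fun x => U x +i* V x) => x ax; apply/rdiff_is_derive => /=.
by split; [exact: HU|exact: HV].
Qed.

End RealDerivative.

(** * Goursat's theorem on rectangles *)

Section Goursat.
Context {R : realType}.

(** The intervals [[x n, x n + w / 2 ^ n]] are nested, and the supremum of their left ends lies in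
    all of them. The same fact later supplies completeness in the fixed point argument. *)
Lemma nested_intervals (x : nat -> R) (w : R) : 0 <= w ->
  (forall n, x n <= x n.+1 <= x n + w / 2 ^+ n.+1) ->
  exists p, forall n, x n <= p <= x n + w / 2 ^+ n.
Proof.
move=> w0 H.
have E n : w / 2 ^+ n = w / 2 ^+ n.+1 + w / 2 ^+ n.+1.
  by rewrite exprS; field; rewrite expf_neq0.
have mono m k : x m <= x (k + m)%N.
  elim: k => [|k IH] //; rewrite addSn (le_trans IH)//.
  by have /andP[] := H (k + m)%N.
have anti m k : x (k + m)%N + w / 2 ^+ (k + m) <= x m + w / 2 ^+ m.
  elim: k => [|k IH] //; rewrite addSn (le_trans _ IH)//.
  by rewrite (E (k + m)%N) addrA lerD2r; have /andP[] := H (k + m)%N.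
have ub m n : x n <= x m + w / 2 ^+ m.
  have wn k : 0 <= w / 2 ^+ k by rewrite divr_ge0// exprn_ge0.
  have [mn|/ltnW nm] := leqP m n.
    rewrite -(subnK mn) (le_trans _ (anti m (n - m)%N))// lerDl; exact: wn.
  rewrite -(subnK nm) in anti * => //.
  by rewrite (le_trans (mono n (m - n)%N))// lerDl.
exists (sup (range x)) => n; apply/andP; split.
  apply: ub_le_sup; last by exists n.
  by exists (x 0 + w / 2 ^+ 0) => _ [k _ <-].
apply: ge_sup; first by exists (x 0), 0%N.
by move=> _ [k _ <-].
Qed.

Variables (f : R[i] -> R[i]) (a a' : R) (H V : R -> R -> R[i]).
Hypothesis df : forall z, exists l, cdiff f z l.
Hypothesis dH : forall c x, a < x -> rdiff (H c) x (f (x +i* c)).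
Hypothesis dV : forall c y, a' < y -> rdiff (V c) y ('i * f (c +i* y)).

(** The counterclockwise contour integral of [f], written with primitives [H c] along horizontals
    and [V c] along verticals, so that additivity under subdivision is a ring identity. *)
Definition rectangle_integral x0 x1 y0 y1 :=
  (H y0 x1 - H y0 x0) - (H y1 x1 - H y1 x0)
  + (V x1 y1 - V x1 y0) - (V x0 y1 - V x0 y0).

Local Notation bd := rectangle_integral.

(** The affine approximation has the antiderivative [Q], whose increments cancel around the
    boundary. The mean value inequality for the difference costs [2 * E] per unit length on each of
    the four sides. *)
Lemma rectangle_integral_affine_le p l E x0 x1 y0 y1 :
  a < x0 -> a' < y0 -> x0 <= x1 -> y0 <= y1 ->
  (forall x y, x0 <= x <= x1 -> y0 <= y <= y1 ->
     normc (f (x +i* y) - f p - l * (x +i* y - p)) <= E) ->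
  normc (bd x0 x1 y0 y1) <= 4 * E * ((x1 - x0) + (y1 - y0)).
Proof.
move=> ax0 ay0 x01 y01 fE.
pose Q z := f p * z + l / 2 * ((z - p) * (z - p)).
have dQ z : cdiff Q z (f p + l * (z - p)).
  have d1 : cdiff (fun w => w - p) z (1 + 0).
    exact: cdiffD (cdiff_id z) (cdiff_cst (- p) z).
  have := cdiffD (cdiffM (cdiff_cst (f p) z) (cdiff_id z))
                 (cdiffM (cdiff_cst (l / 2) z) (cdiffM d1 d1)).
  by rewrite (_ : _ + _ = f p + l * (z - p))//; field.
have dQh c x : rdiff (fun t => Q (t +i* c)) x (f p + l * (x +i* c - p)).
  have E1 t : t +i* c = (0 +i* c) + t%:C * 1.
    by apply: complexP; rewrite /= ?mulr1 ?mulr0 ?subr0 ?add0r ?addr0 ?mul0r.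
  have := @cdiff_line _ Q (0 +i* c) 1 x (f p + l * (x +i* c - p)).
  rewrite -E1 mulr1 => /(_ (dQ _)).
  by congr (rdiff _ _ _); apply/funext => t; rewrite -E1.
have dQv c y : rdiff (fun t => Q (c +i* t)) y ('i * (f p + l * (c +i* y - p))).
  have E1 t : c +i* t = c%:C + t%:C * 'i.
    by apply: complexP; rewrite /= ?mulr1 ?mulr0 ?mul0r ?subr0 ?add0r ?addr0.
  have := @cdiff_line _ Q c%:C 'i y (f p + l * (c +i* y - p)).
  rewrite -E1 (mulrC _ 'i) => /(_ (dQ _)).
  by congr (rdiff _ _ _); apply/funext => t; rewrite -E1.
have hor c : y0 <= c <= y1 ->
    normc ((H c x1 - Q (x1 +i* c)) - (H c x0 - Q (x0 +i* c))) <= 2 * E * (x1 - x0).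
  move=> cy; apply: (@rdiff_mean_value _ (fun t => H c t - Q (t +i* c))
    (fun x => f (x +i* c) - (f p + l * (x +i* c - p)))) => // x /andP[xl xr].
    by apply: rdiffB => //; apply: dH; exact: lt_le_trans xl.
  by rewrite opprD addrA fE// xl.
have ver c : x0 <= c <= x1 ->
    normc ((V c y1 - Q (c +i* y1)) - (V c y0 - Q (c +i* y0))) <= 2 * E * (y1 - y0).
  move=> cx; apply: (@rdiff_mean_value _ (fun t => V c t - Q (c +i* t))
    (fun y => 'i * f (c +i* y) - 'i * (f p + l * (c +i* y - p)))) => // y /andP[yl yr].
    by apply: rdiffB => //; apply: dV; exact: lt_le_trans yl.
  rewrite -mulrBr normcM opprD addrA (_ : normc 'i = 1) ?mul1r ?fE ?yl//.
  by rewrite /= expr0n expr1n add0r sqrtr1.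
have := hor y0; have := hor y1; have := ver x0; have := ver x1.
rewrite !lexx x01 y01 => /(_ isT) h1 /(_ isT) h2 /(_ isT) h3 /(_ isT) h4.
rewrite /bd.
set A1 := (X in normc X) in h1; set A2 := (X in normc X) in h2.
set A3 := (X in normc X) in h3; set A4 := (X in normc X) in h4.
rewrite [X in normc X](_ : _ = A4 - A3 + A1 - A2); last first.
  by rewrite /A1 /A2 /A3 /A4; ring.
rewrite (le_trans (le_normcB _ _))//.
have := le_normcD (A4 - A3) A1; have := le_normcB A4 A3; lra.
Qed.

(** Quadrisection: a nonzero integral of modulus [N] leaves at least [N / 4 ^ n] on some rectangle
    of generation [n], while differentiability at the common point bounds it by
    [4 * e * S ^ 2 / 4 ^ n], with [S] half the perimeter. *)
Lemma Goursat_rectangle x0 x1 y0 y1 :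
  a < x0 -> a' < y0 -> x0 <= x1 -> y0 <= y1 -> bd x0 x1 y0 y1 = 0.
Proof.
move=> ax0 ay0 x01 y01; apply: eq0_normc; apply/eqP.
rewrite eq_le normc_ge0 andbT leNgt; apply/negP.
set N := normc _ => N0.
pose w := x1 - x0; pose h := y1 - y0.
have w0 : 0 <= w by rewrite subr_ge0.
have h0 : 0 <= h by rewrite subr_ge0.
pose big n (q : R * R) := N / 4 ^+ n <=
  normc (bd q.1 (q.1 + w / 2 ^+ n) q.2 (q.2 + h / 2 ^+ n)).
have Eh r n : r / 2 ^+ n = r / 2 ^+ n.+1 + r / 2 ^+ n.+1 :> R.
  by rewrite exprS; field; rewrite expf_neq0.
have /choice[step Hstep] : forall nq : nat * (R * R), exists q' : R * R,
    big nq.1 nq.2 ->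
    [/\ nq.2.1 <= q'.1 <= nq.2.1 + w / 2 ^+ nq.1.+1,
        nq.2.2 <= q'.2 <= nq.2.2 + h / 2 ^+ nq.1.+1 & big nq.1.+1 q'].
  move=> [n [x y]] /=.
  (* Off the rectangles satisfying [big] the value is arbitrary; the sequence [s] never meets this
     case. *)
  have [B|nB] := pselect (big n (x, y)); last by exists (0, 0).
  set w' := w / 2 ^+ n.+1; set h' := h / 2 ^+ n.+1.
  have w'0 : 0 <= w' by rewrite divr_ge0// exprn_ge0.
  have h'0 : 0 <= h' by rewrite divr_ge0// exprn_ge0.
  apply: contrapT => C.
  have small q : x <= q.1 <= x + w' -> y <= q.2 <= y + h' ->
      normc (bd q.1 (q.1 + w') q.2 (q.2 + h')) < N / 4 ^+ n.+1.
    move=> q1 q2; rewrite ltNge; apply/negP => bq; apply: C.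
    by exists q => _; split.
  have := small (x, y); have := small (x + w', y).
  have := small (x, y + h'); have := small (x + w', y + h').
  rewrite /= !lexx !lerDl w'0 h'0 => /(_ isT isT) s1 /(_ isT isT) s2.
  move=> /(_ isT isT) s3 /(_ isT isT) s4.
  have := B; rewrite /big /= !(Eh _ n) -/w' -/h' !addrA.
  move: s1 s2 s3 s4.
  set b1 := bd _ _ _ _; set b2 := bd _ _ _ _; set b3 := bd _ _ _ _.
  set b4 := bd _ _ _ _ => s1 s2 s3 s4.
  rewrite [X in normc X](_ : _ = b1 + b2 + b3 + b4); last first.
    by rewrite /b1 /b2 /b3 /b4 /bd; ring.
  rewrite (_ : N / 4 ^+ n = 4 * (N / 4 ^+ n.+1)); last first.
    by rewrite exprS; field; rewrite expf_neq0.
  have := le_normcD (b1 + b2 + b3) b4; have := le_normcD (b1 + b2) b3.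
  have := le_normcD b1 b2; lra.
pose fix s n := if n is n'.+1 then step (n', s n') else (x0, y0).
have Hs n : big n (s n).
  elim: n => [|n IH]; last by have [] := Hstep (n, s n) IH.
  by rewrite /big /= !expr0 !divr1 /w /h ![_ + (_ - _)]addrC !subrK.
have [px Hpx] : exists p, forall n, (s n).1 <= p <= (s n).1 + w / 2 ^+ n.
  by apply: nested_intervals => // n; have [] := Hstep (n, s n) (Hs n).
have [py Hpy] : exists p, forall n, (s n).2 <= p <= (s n).2 + h / 2 ^+ n.
  by apply: nested_intervals => // n; have [] := Hstep (n, s n) (Hs n).
have sx n : a < (s n).1.
  elim: n => [|n IH] //; have [/andP[+ _] _ _] := Hstep (n, s n) (Hs n).
  exact: lt_le_trans.
have sy n : a' < (s n).2.
  elim: n => [|n IH] //; have [_ /andP[+ _] _] := Hstep (n, s n) (Hs n).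
  exact: lt_le_trans.
have [l dl] := df (px +i* py).
pose S := w + h.
have S0 : 0 <= S by rewrite addr_ge0.
(* With this [e] the factor [4 * e * S ^ 2] is below [N]; the [+ 1] covers a degenerate rectangle
   with [S = 0]. *)
have e0 : 0 < N / (8 * (S + 1) ^+ 2).
  by rewrite divr_gt0// mulr_gt0// exprn_gt0//; lra.
set e := N / _ in e0.
have [d d0 Hd] := dl _ e0.
have [n Hn] : exists n, S / 2 ^+ n <= d.
  exists (Num.truncn (S / d)).+1.
  rewrite ler_pdivrMr ?exprn_gt0// mulrC -ler_pdivrMr//.
  apply: ltW; apply: lt_trans (truncnS_gt _) _.
  by rewrite -natrX ltr_nat ltn_expl.
have := Hs n; rewrite /big.
have := @rectangle_integral_affine_le (px +i* py) l (e * (S / 2 ^+ n))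
  (s n).1 ((s n).1 + w / 2 ^+ n) (s n).2 ((s n).2 + h / 2 ^+ n) (sx n) (sy n).
have wn : 0 <= w / 2 ^+ n by rewrite divr_ge0// exprn_ge0.
have hn : 0 <= h / 2 ^+ n by rewrite divr_ge0// exprn_ge0.
have SE : w / 2 ^+ n + h / 2 ^+ n = S / 2 ^+ n by rewrite -mulrDl.
rewrite !lerDl wn hn => /(_ isT isT).
have L x y : (s n).1 <= x <= (s n).1 + w / 2 ^+ n ->
    (s n).2 <= y <= (s n).2 + h / 2 ^+ n ->
    normc (f (x +i* y) - f (px +i* py) - l * (x +i* y - (px +i* py)))
      <= e * (S / 2 ^+ n).
  move=> xb yb.
  have hz : normc (x +i* y - (px +i* py)) <= S / 2 ^+ n.
    rewrite (le_trans (normc_le_ReIm _))// -SE; apply: lerD => /=.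
      by have := Hpx n; move: xb; rewrite ler_norml => /andP[? ?] /andP[? ?]; apply/andP; split; lra.
    by have := Hpy n; move: yb; rewrite ler_norml => /andP[? ?] /andP[? ?]; apply/andP; split; lra.
  have := Hd (x +i* y - (px +i* py)) (le_trans hz Hn).
  rewrite (addrC (px +i* py)) subrK => /le_trans; apply.
  by rewrite ler_wpM2l// ltW.
move=> /(_ L).
have cancel (u v : R) : u + v - u = v by ring.
rewrite !cancel SE => H1 /le_trans /(_ H1).
have -> : 4 * (e * (S / 2 ^+ n)) * (S / 2 ^+ n) = (4 * e * S ^+ 2) / 4 ^+ n.
  by rewrite (_ : 4 = 2 ^+ 2) -?exprM 1?mulnC ?exprM; [field; rewrite expf_neq0|ring].
rewrite ler_pM2r ?invr_gt0 ?exprn_gt0// /e leNgt => /negP; apply.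
rewrite (_ : _ * _ = N * (4 * S ^+ 2 / (8 * (S + 1) ^+ 2))); last first.
  by field; rewrite gt_eqF//; lra.
rewrite gtr_pMr// ltr_pdivrMr; last by rewrite mulr_gt0// exprn_gt0//; lra.
by nra.
Qed.

End Goursat.

(** * Cauchy's estimate and the second-order remainder *)

Section CauchyEstimate.
Context {R : realType}.
Implicit Types (f : R[i] -> R[i]) (z w l : R[i]).

(** By [cexpD] only the derivative at 0 is at stake; there the real and imaginary parts decouple up
    to the product [a * b], which is of second order. *)
Lemma cdiff_cexp z : cdiff cexp z (cexp z).
Proof.
suff C0 : cdiff (@cexp R) 0 1.
  move=> e e0; have e'0 : 0 < e / normc (cexp z).
    by rewrite divr_gt0// normc_cexp expR_gt0.
  have [d d0 Hd] := C0 _ e'0; exists d => // h /Hd.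
  rewrite add0r cexp0 mul1r cexpD => H.
  have -> : cexp z * cexp h - cexp z - cexp z * h = cexp z * (cexp h - 1 - h) by ring.
  rewrite normcM (le_trans (ler_wpM2l (normc_ge0 _) H))//.
  by rewrite mulrA mulrCA divff ?mulr1// normc_cexp gt_eqF ?expR_gt0.
move=> e e0; have e3 : 0 < e / 8 by rewrite divr_gt0.
have /is_derive_epsdelta/(_ _ e3)[d1 d10 H1] := @is_derive_expR R 0.
have /is_derive_epsdelta/(_ _ e3)[d2 d20 H2] := @is_derive_cos R 0.
have /is_derive_epsdelta/(_ _ e3)[d3 d30 H3] := @is_derive_sin R 0.
exists (Num.min (Num.min 1 (e / 8)) (Num.min d1 (Num.min d2 d3))).
  by rewrite !lt_min ltr01 e3 d10 d20.
case=> a b; rewrite !le_min => /andP[/andP[n1 n2] /andP[n3 /andP[n4 n5]]].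
have ha : `|a| <= normc (a +i* b) := Re_le_normc (a +i* b).
have hb : `|b| <= normc (a +i* b) := Im_le_normc (a +i* b).
move: n1 n2 n3 n4 n5 ha hb; set N := normc (a +i* b) => n1 n2 n3 n4 n5 ha hb.
have := H1 a (le_trans ha n3); have := H2 b (le_trans hb n4).
have := H3 b (le_trans hb n5).
rewrite !add0r expR0 cos0 sin0 oppr0 mul0r !subr0 addr0 !mul1r => S C E.
have cE : cexp (a +i* b) = (expR a)%:C * (cos b +i* sin b).
  by apply: complexP; rewrite /cexp/=; ring.
rewrite cexp0 cE.
have -> : (expR a)%:C * (cos b +i* sin b) - 1 - (a +i* b) =
  (expR a - 1 - a)%:C * (cos b +i* sin b) +
  ((1 + a)%:C * ((cos b - 1) +i* (sin b - b)) + (0 +i* (a * b))).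
  by apply: complexP; rewrite /=; ring.
have u1 : normc (cos b +i* sin b) = 1 by rewrite /= cos2Dsin2 sqrtr1.
have a1 : `|1 + a| <= 2.
  by rewrite (le_trans (ler_normD _ _))// normr1; lra.
have a2 : normc ((cos b - 1) +i* (sin b - b)) <= 2 * (e / 8) * `|b|.
  by rewrite (le_trans (normc_le_ReIm _))//=; lra.
have a3 : normc (0 +i* (a * b)) <= `|a| * `|b|.
  by rewrite /= expr0n add0r sqrtr_sqr normrM.
rewrite (le_trans (le_normcD _ _))// normcM u1 mulr1 normc_real.
have := le_normcD ((1 + a)%:C * ((cos b - 1) +i* (sin b - b))) (0 +i* (a * b)).
rewrite normcM normc_real.
have N0 : 0 <= N := normc_ge0 _.
have : `|1 + a| * normc ((cos b - 1) +i* (sin b - b)) <= 2 * (2 * (e / 8) * `|b|).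
  by rewrite ler_pM ?normc_ge0.
have : `|a| * `|b| <= (e / 8) * N by rewrite ler_pM// (le_trans ha).
have : (e / 8) * `|a| <= (e / 8) * N by rewrite ler_wpM2l// ltW.
have : (e / 8) * `|b| <= (e / 8) * N by rewrite ler_wpM2l// ltW.
have := mulr_ge0 (ltW e0) N0; lra.
Qed.

Lemma line_continuous f (p v : R[i]) : (forall z, exists l, cdiff f z l) ->
  forall x e : R, 0 < e -> exists2 d : R, 0 < d &
    forall h : R, `|h| <= d -> normc (f (p + (x + h)%:C * v) - f (p + x%:C * v)) <= e.
Proof.
move=> df x e e0; have [l /cdiff_continuous/(_ _ e0)[d d0 Hd]] := df (p + x%:C * v).
have v0 := normc_ge0 v.
exists (d / (normc v + 1)); first by rewrite divr_gt0//; lra.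
move=> h; rewrite ler_pdivlMr; last by lra.
move=> hd; have := Hd (h%:C * v).
rewrite -addrA -mulrDl -rmorphD/=; apply.
by rewrite normcM normc_real; have := normr_ge0 h; nra.
Qed.

(* Goursat's theorem is applied to [s |-> (f (w + e^s) - f w) e^-s] on
   [[x0, ln r] x [0, 2 pi]]: the horizontal sides cancel by periodicity, and the
   left side tends to [2 pi i l] as [x0 -> -oo]. *)
Lemma Cauchy_estimate f w l (r B : R) : (forall z, exists l, cdiff f z l) ->
  0 < r -> (forall z, normc (z - w) <= r -> normc (f z) <= B) ->
  cdiff f w l -> normc l <= 4 * B / r.
Proof.
move=> df r0 fB dl.
have B0 : 0 <= B by apply: le_trans (normc_ge0 (f w)) (fB w _); rewrite subrr normc0 ltW.
apply/ler_addgt0Pr => e e0.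
have e2 : 0 < e / 4 by rewrite divr_gt0.
have [d d0 Hd] := dl _ e2.
pose g s := (f (w + cexp s) - f w) * cexp (- s).
have dg s : exists m, cdiff g s m.
  have [m1 dm1] := df (w + cexp s).
  have D1 : cdiff (fun t => w + cexp t) s (0 + cexp s).
    exact: cdiffD (cdiff_cst _ _) (cdiff_cexp s).
  have D2 := cdiffD (cdiff_comp D1 dm1) (cdiff_cst (- f w) s).
  have D3 : cdiff (fun t => - 1 * t) s (0 * s + - 1 * 1).
    exact: cdiffM (cdiff_cst _ _) (cdiff_id s).
  have D4 := cdiff_comp D3 (cdiff_cexp _).
  have := cdiffM D2 D4.
  set m := (X in cdiff _ _ X) => D; exists m; apply: cdiff_ext D => t /=.
  by rewrite mulN1r.
pose X := ln r.
(* On the vertical line through [x0] the points [cexp s] have modulus at most [d], so [g] is within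
   [e / 4] of [l] there. *)
pose x0 := Num.min (ln d) X.
pose a := x0 - 1.
have hx (c x : R) : (0 +i* c) + x%:C * 1 = x +i* c.
  by apply: complexP; rewrite /= ?mulr1 ?mulr0 ?subr0 ?add0r ?addr0 ?mul0r.
have vx (c y : R) : c%:C + y%:C * 'i = c +i* y.
  by apply: complexP; rewrite /= ?mulr1 ?mulr0 ?mul0r ?subr0 ?add0r ?addr0.
have /choice[H dH] : forall c : R, exists H : R -> R[i], forall x, a < x ->
    rdiff H x (g (x +i* c)).
  move=> c; apply: complex_primitive => x e' /(line_continuous (0 +i* c) 1 dg x)[d' d'0 Hd'].
  by exists d' => // h /Hd'; rewrite !hx.
have /choice[V dV] : forall c : R, exists V : R -> R[i], forall y, -1 < y ->
    rdiff V y ('i * g (c +i* y)).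
  move=> c; have [V dV] : exists V : R -> R[i], forall y, -1 < y ->
      rdiff V y (g (c +i* y)).
    apply: complex_primitive => x e' /(line_continuous c%:C 'i dg x)[d' d'0 Hd'].
    by exists d' => // h /Hd'; rewrite !vx.
  by exists (fun y => 'i * V y) => y y1; apply: rdiffZ; exact: dV.
have p0 := @pi_gt0 R.
have x0X : x0 <= X by rewrite ge_min lexx orbT.
have ax0 : a < x0 by rewrite /a; lra.
have G := @Goursat_rectangle R g a (-1) H V dg dH dV x0 X 0 (pi *+ 2) ax0.
move: G; rewrite ltrN10 mulr2n => /(_ isT x0X).
have pp : 0 <= pi + pi :> R by lra.
move=> /(_ pp); rewrite /rectangle_integral => G.
have per x y : g (x +i* (y + (pi + pi))) = g (x +i* y).
  have cper u v : cexp (u +i* (v + (pi + pi))) = cexp (u +i* v) :> R[i].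
    by rewrite /cexp /= -mulr2n cosD2pi sinD2pi.
  rewrite /g cper !cexpN cper //.
have horiz : (H 0 X - H 0 x0) - (H (pi + pi) X - H (pi + pi) x0) = 0.
  apply: eq0_normc; apply/eqP; rewrite eq_le normc_ge0 andbT.
  have := @rdiff_mean_value _ (fun t => H 0 t - H (pi + pi) t)
    (fun t => g (t +i* 0) - g (t +i* (pi + pi))) x0 X 0 x0X.
  rewrite mulr0 mul0r [X in normc X](_ : _ =
    H 0 X - H 0 x0 - (H (pi + pi) X - H (pi + pi) x0)); last by ring.
  apply => x /andP[xl xr].
    by apply: rdiffB; apply: dH; exact: lt_le_trans xl.
  by rewrite -[pi + pi]add0r per subrr normc0.
have ni : normc 'i = 1 :> R by rewrite /= expr0n expr1n add0r sqrtr1.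
(* One factor 2 comes from subtracting [f w], the other from the mean value inequality; together
   they give the 4 of the statement. *)
have right : normc (V X (pi + pi) - V X 0) <= 2 * (2 * B / r) * (pi + pi - 0).
  apply: (@rdiff_mean_value _ _ (fun y => 'i * g (X +i* y))) => // y /andP[y0 y1].
    by apply: dV; lra.
  rewrite normcM ni mul1r /g normcM normc_cexp /= expRN lnK ?posrE//.
  rewrite ler_wpM2r ?invr_ge0 ?(ltW r0)// (le_trans (le_normcB _ _))//.
  have -> : 2 * B = B + B by ring.
  apply: lerD; apply: fB; last by rewrite subrr normc0 ltW.
  by rewrite addrC addKr normc_cexp /= lnK.
have left : normc ((V x0 (pi + pi) - l * 'i * (pi + pi)%:C) - (V x0 0 - l * 'i * 0%:C))
    <= 2 * (e / 4) * (pi + pi - 0).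
  apply: (@rdiff_mean_value _ (fun y => V x0 y - l * 'i * y%:C)
    (fun y => 'i * g (x0 +i* y) - l * 'i)) => // y /andP[y0 y1].
    apply: rdiffB; first by apply: dV; lra.
    move=> e' e'0; exists 1 => // h _; rewrite [X in normc X](_ : _ = 0).
      by rewrite normc0 mulr_ge0// ltW.
    by rewrite rmorphD/=; ring.
  rewrite (mulrC l) -mulrBr normcM ni mul1r /g cexpN.
  have ch : normc (cexp (x0 +i* y)) <= d.
    by rewrite normc_cexp /= -ler_ln ?posrE ?expR_gt0// expRK /x0 ge_min lexx.
  have := Hd _ ch.
  rewrite -ler_pdivrMr ?normc_cexp ?expR_gt0// -normc_cexp -normcV -normcM.
  by apply: le_trans; rewrite [in leRHS]mulrBl mulfK ?cexp_neq0.
move: G right left; rewrite horiz add0r => /eqP; rewrite subr_eq0 => /eqP ->.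
rewrite mulr0 !subr0 => right left.
have : normc (l * 'i * (pi + pi)%:C) <= 2 * (2 * B / r) * (pi + pi) + 2 * (e / 4) * (pi + pi).
  rewrite -[l * 'i * _](subrK (V x0 (pi + pi) - V x0 0)).
  rewrite addrC (le_trans (le_normcD _ _))// lerD//.
  rewrite normc_distC; apply: le_trans left.
  by rewrite le_eqVlt; apply/orP; left; apply/eqP; congr normc; ring.
rewrite !normcM ni mulr1 normc_real ger0_norm//.
rewrite -mulrDl ler_pM2r; last by lra.
move=> /le_trans; apply.
by rewrite !mulrA; lra.
Qed.

(** No second derivative is formed: [D h - D 0] is the derivative at 0 of [f (y + h) - f y], which
    the mean value inequality bounds by [32 * B * normc h], so a second Cauchy estimate on a disc of
    radius [1 / 4] gives [512 * B * normc h]. The slope [b] is [D 0], and one more mean value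
    inequality doubles 512. *)
Lemma second_order_remainder : exists2 K : R, 0 < K & forall f (B : R),
  (forall z, exists l, cdiff f z l) ->
  (forall z, normc z <= 1 -> normc (f z) <= B) ->
  exists b, forall (rho : R) z w, rho <= 1 / 4 -> normc z <= rho -> normc w <= rho ->
    normc (f z - f w - b * (z - w)) <= K * B * rho * normc (z - w).
Proof.
exists 1024; first by rewrite ltr0n.
move=> f B df fB; have /choice[D dD] := df.
have B0 : 0 <= B by apply: le_trans (normc_ge0 (f 0)) (fB 0 _); rewrite normc0.
have D1 z : normc z <= 3 / 4 -> normc (D z) <= 16 * B.
  move=> z1; rewrite [leRHS](_ : _ = 4 * B / (1 / 4)); last by field.
  apply: (Cauchy_estimate df _ _ (dD z)) => // y yz; apply: fB.
  by rewrite -[y](subrK z) (le_trans (le_normcD _ _))//; lra.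
have seg (r : R) z w (t : R) : normc z <= r -> normc w <= r -> 0 <= t <= 1 ->
    normc (w + t%:C * (z - w)) <= r.
  move=> zr wr /andP[t0 t1].
  have -> : w + t%:C * (z - w) = t%:C * z + (1 - t)%:C * w by rewrite rmorphB/=; ring.
  rewrite (le_trans (le_normcD _ _))// !normcM !normc_real !ger0_norm//; last by lra.
  by nra.
have mv g dg (C r : R) z w : (forall z, cdiff g z (dg z)) ->
    (forall z, normc z <= r -> normc (dg z) <= C) ->
    normc z <= r -> normc w <= r -> normc (g z - g w) <= 2 * C * normc (z - w).
  move=> gd gC zr wr.
  have := @rdiff_mean_value _ (fun t : R => g (w + t%:C * (z - w)))
    (fun t => dg (w + t%:C * (z - w)) * (z - w)) 0 1 (C * normc (z - w)) ler01.
  have -> : w + 1%:C * (z - w) = z by rewrite rmorph1; ring.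
  have -> : w + 0%:C * (z - w) = w by rewrite rmorph0; ring.
  rewrite subr0 mulr1 !mulrA; apply.
    by move=> t _; apply: cdiff_line.
  by move=> t t01; rewrite normcM ler_wpM2r ?normc_ge0// gC// seg.
have D2 h : normc h <= 1 / 4 -> normc (D h - D 0) <= 512 * B * normc h.
  move=> h1; pose g y := f (y + h) + (- 1) * f y.
  have dg y : cdiff g y (D (y + h) * (1 + 0) + (0 * f y + (- 1) * D y)).
    apply: cdiffD; last exact: cdiffM (cdiff_cst _ _) (dD y).
    exact: (cdiff_comp (cdiffD (cdiff_id y) (cdiff_cst h y)) (dD _)).
  have := @Cauchy_estimate g 0 _ (1 / 4) (32 * B * normc h) _ _ _ (dg 0).
  rewrite add0r mul0r addr0 mulr1 mulN1r add0r.
  rewrite [X in _ <= X](_ : _ = 512 * B * normc h); last by field.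
  apply => //; first by move=> z; eexists; exact: dg.
  move=> z; rewrite subr0 => z1; rewrite /g mulN1r.
  have := @mv f D (16 * B) (3 / 4) (z + h) z dD D1.
  rewrite [z + h - z]addrC addKr [2 * _]mulrA (_ : 2 * 16 = 32); last by ring.
  by apply; [rewrite (le_trans (le_normcD _ _))//; lra|lra].
exists (D 0) => rho z w r4 zr wr.
pose g y := f y + (- D 0) * y.
have dg y : cdiff g y (D y + (0 * y + (- D 0) * 1)).
  by apply: cdiffD => //; exact: cdiffM (cdiff_cst _ _) (cdiff_id y).
have := @mv g _ (512 * B * rho) rho z w dg.
rewrite [g z - g w](_ : _ = f z - f w - D 0 * (z - w)); last by rewrite /g; ring.
rewrite [X in _ <= X * _](_ : _ = 1024 * B * rho); last by ring.
apply=> // y yr; rewrite mul0r add0r mulr1 (le_trans (D2 _ _))//.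
  exact: le_trans r4.
have B5 : 0 <= 512 * B by rewrite mulr_ge0 ?ler0n.
exact: ler_wpM2l.
Qed.

End CauchyEstimate.

(** * Normal laws *)

Section NormalIntegral.
Context {R : realType}.
Local Notation mu := (@lebesgue_measure R).
Local Open Scope ereal_scope.

(** Change of variables holds for the Radon-Nikodym derivative of [normal_prob m s]; that derivative
    agrees almost everywhere with [normal_pdf m s], both having the same integral over every
    measurable set. *)
Lemma ge0_integral_normal_prob (m s : R) (f : R -> \bar R) :
  measurable_fun [set: R] f -> (forall x, 0 <= f x) ->
  \int[normal_prob m s]_x f x = \int[mu]_x (f x * (normal_pdf m s x)%:E).
Proof.
move=> mf f0; pose nu := normal_prob m s : {finite_measure set (measurableTypeR R) -> \bar R}.
have dom : nu `<< mu by exact: normal_prob_dominates.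
rewrite -(@Radon_Nikodym_SigmaFinite.change_of_variables _ _ _ nu mu dom f)//.
have mrn : measurable_fun [set: R] (Radon_Nikodym_SigmaFinite.f nu mu).
  exact: (measurable_int mu (Radon_Nikodym_SigmaFinite.f_integrable dom)).
have mp : measurable_fun [set: R] (fun x => (normal_pdf m s x)%:E).
  by apply/measurable_EFinP; exact: measurable_normal_pdf.
apply: ge0_ae_eq_integral => //.
- exact: emeasurable_funM.
- exact: emeasurable_funM.
- by move=> x _; rewrite mule_ge0// Radon_Nikodym_SigmaFinite.f_ge0.
- by move=> x _; rewrite mule_ge0// lee_fin normal_pdf_ge0.
apply: ae_eqe_mul2l; apply: integral_ae_eq => //.
  exact: Radon_Nikodym_SigmaFinite.f_integrable.
by move=> E _ mE; rewrite -Radon_Nikodym_SigmaFinite.f_integral.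
Qed.

Definition has_normal_law d (T : measurableType d) (P : probability T R)
    (Y : T -> R) (m s : R) :=
  measurable_fun [set: T] Y /\ forall B, measurable B ->
    P (Y @^-1` B) = if s == 0%R then \d_m B else normal_prob m s B.

Section Law.
Context d (T : measurableType d) (P : probability T R).
Variables (Y : T -> R) (m s : R).
Hypotheses (s0 : s != 0%R) (lawY : has_normal_law P Y m s).

Lemma ge0_integral_normal_law (g : R -> R) :
  measurable_fun [set: R] g -> (forall x, (0 <= g x)%R) ->
  \int[P]_w (g (Y w))%:E = \int[mu]_x (g x * normal_pdf m s x)%:E.
Proof.
move=> mg g0; have [mY PY] := lawY.
have mEg : measurable_fun [set: R] (fun x => (g x)%:E) by exact/measurable_EFinP.
have mY' : measurable_fun [set: T] (Y : T -> measurableTypeR R).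
  by move=> mT B mB; exact: mY.
pose X : {RV P >-> measurableTypeR R} := MeasurableFun.Pack (MeasurableFun.Class
  (isMeasurableFun.Build _ _ _ _ (Y : T -> measurableTypeR R) mY')).
transitivity (\int[distribution P X]_x (g x)%:E).
  by rewrite ge0_integral_distribution// => x; rewrite lee_fin.
transitivity (\int[normal_prob m s]_x (g x)%:E).
  apply: eq_measure_integral => A mA _.
  by have := PY A mA; rewrite (negbTE s0).
by rewrite ge0_integral_normal_prob// => x; rewrite lee_fin.
Qed.

Lemma integral_normal_law (g : R -> R) :
  measurable_fun [set: R] g ->
  mu.-integrable [set: R] (fun x => (g x * normal_pdf m s x)%:E) ->
  P.-integrable [set: T] (fun w => (g (Y w))%:E) /\
  (\int[P]_w (g (Y w)) = \int[mu]_x (g x * normal_pdf m s x))%R.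
Proof.
move=> mg ig; have [mY _] := lawY.
have mEg : measurable_fun [set: R] (fun x => (g x)%:E) by exact/measurable_EFinP.
have iP : P.-integrable [set: T] (fun w => (g (Y w))%:E).
  apply/integrableP; split.
    by apply/measurable_EFinP; exact: measurableT_comp.
  have -> : \int[P]_w `|(g (Y w))%:E| =
      \int[mu]_x (`|g x| * normal_pdf m s x)%:E.
    rewrite -ge0_integral_normal_law//.
    exact: measurableT_comp.
  move/integrableP : ig => [_]; congr (_ < _); apply: eq_integral => x _.
  by rewrite /= normrM (@ger0_norm _ (normal_pdf _ _ _))// normal_pdf_ge0.
split=> //; rewrite /Rintegral; congr fine.
rewrite [LHS]integralE [RHS]integralE.
have p0 x : (0 <= normal_pdf m s x)%R by exact: normal_pdf_ge0.
have maxM (x y : R) : (0 <= y)%R -> (Num.max (x * y) 0 = Num.max x 0 * y)%R.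
  by move=> y0; rewrite maxr_pMl// mul0r.
congr (_ - _).
  transitivity (\int[P]_w (Num.max (g (Y w)) 0)%:E).
    by apply: eq_integral => w _; rewrite funeposE EFin_max.
  rewrite (@ge0_integral_normal_law (fun x => Num.max (g x) 0)%R).
  - by apply: eq_integral => x _; rewrite funeposE -EFin_max maxM.
  - exact: measurable_maxr.
  - by move=> x; rewrite le_max lexx orbT.
transitivity (\int[P]_w (Num.max (- g (Y w)) 0)%:E).
  by apply: eq_integral => w _; rewrite funenegE EFin_max.
rewrite (@ge0_integral_normal_law (fun x => Num.max (- g x) 0)%R).
- by apply: eq_integral => x _; rewrite funenegE -EFinN -EFin_max -mulNr maxM.
- by apply: measurable_maxr => //; exact: measurable_funN.
- by move=> x; rewrite le_max lexx orbT.
Qed.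
End Law.
End NormalIntegral.

Section NormalMoments.
Context {R : realType}.
Local Notation mu := (@lebesgue_measure R).

(** The fundamental theorem on [[m - n.+1, m + n.+1]] leaves boundary terms of size [K / n.+1];
    dominated convergence passes to the whole line. *)
Lemma integral_derivative_eq0 (f G : R -> R) (m K : R) : continuous f ->
  mu.-integrable [set: R] (EFin \o f) ->
  (forall x : R, is_derive x 1 G (f x)) ->
  (forall n : nat, `|G (m + n.+1%:R)| <= K / n.+1%:R) ->
  (forall n : nat, `|G (m - n.+1%:R)| <= K / n.+1%:R) ->
  \int[mu]_x f x = 0.
Proof.
move=> cf intf dG G1 G2.
pose A n := `[m - n.+1%:R, m + n.+1%:R]%classic.
have mf : measurable_fun [set: R] f by exact: continuous_measurable_fun.
have IA n : (\int[mu]_(x in A n) (f x)%:E = (G (m + n.+1%:R) - G (m - n.+1%:R))%:E)%E.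
  rewrite /A; apply: continuous_FTC2.
  - by rewrite ltrBlDr -addrA ltrDl -natrD ltr0n.
  - exact: continuous_subspaceT.
  - have cG : continuous G.
      move=> x; apply/differentiable_continuous/derivable1_diffP.
      exact: (@ex_derive _ _ _ _ _ _ _ (dG x)).
    split.
    + by move=> x _; exact: (@ex_derive _ _ _ _ _ _ _ (dG x)).
    + by apply: cvg_at_right_filter; exact: cG.
    + by apply: cvg_at_left_filter; exact: cG.
  - by move=> x _; rewrite derive1E (@derive_val _ _ _ _ _ _ _ (dG x)).
have lim1 : (\int[mu]_(x in A n) (f x)%:E @[n --> \oo] --> \int[mu]_x (f x)%:E)%E.
  have [] := @dominated_convergence _ _ R mu setT measurableT
    (fun n => (EFin \o f) \_ (A n)) (EFin \o f) (fun x => `|(f x)%:E|)%E.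
  - move=> n; apply/(measurable_restrictT _ _).1; first exact: measurable_itv.
    exact/measurable_funTS/measurable_EFinP.
  - exact/measurable_EFinP.
  - apply: aeW => x _; apply: cvg_near_cst.
    exists (Num.truncn `|x - m|).+1 => // n /= nx.
    rewrite patchE ifT// inE /A /= in_itv/= -ler_distlC distrC.
    apply: ltW; apply: lt_le_trans (truncnS_gt _) _.
    by rewrite ler_nat ltnW.
  - exact: integrable_abse.
  - apply: aeW => x n _; rewrite patchE; case: ifP => //= _.
    by rewrite normr0 lee_fin normr_ge0.
  - move=> _ _; rewrite (_ : (fun n => \int[mu]_(x in A n) (f x)%:E)%E =
      (fun n => \int[mu]_x ((EFin \o f) \_ (A n)) x)%E)//.
    by apply/funext => n; rewrite [LHS]integral_mkcond.
have lim2 : (\int[mu]_(x in A n) (f x)%:E @[n --> \oo] --> 0%E)%E.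
  under eq_fun do rewrite IA.
  apply: cvg_EFin; first exact: nearW.
  apply: (@squeeze_cvgr _ _ _ _ (fun n => - (2 * K) * n.+1%:R^-1) (fun n => (2 * K) * n.+1%:R^-1)).
  - apply: nearW => n /=; rewrite mulNr -ler_norml (le_trans (ler_normB _ _))//.
    by rewrite -mulrA mulrDl !mul1r lerD.
  - by rewrite -[X in _ --> X](mulr0 (- (2 * K))); apply: cvgMr; exact: cvg_harmonic.
  - by rewrite -[X in _ --> X](mulr0 (2 * K)); apply: cvgMr; exact: cvg_harmonic.
by rewrite /Rintegral (cvg_unique _ lim1 lim2).
Qed.

End NormalMoments.

(** * Stein's identity for the normal density *)

Section NormalStein.
Context {R : realType}.
Local Notation mu := (@lebesgue_measure R).
Variables (m s : R).
Hypothesis s0 : s != 0.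
Local Notation p := (normal_pdf m s).
Local Notation p2 := (normal_pdf m (2 * s)).

Lemma is_derive_normal_pdf (x : R) : is_derive x 1 p (- (x - m) / s ^+ 2 * p x).
Proof.
rewrite normal_pdfE// /normal_fun.
have d1 : is_derive x 1 (fun y : R => y - m) 1.
  by apply: is_derive_eq; rewrite subr0.
have d2 : is_derive x 1 (fun y : R => (y - m) ^+ 2 * (- (s ^+ 2 *+ 2)^-1))
    (- (x - m) / s ^+ 2).
  by apply: is_derive_eq; rewrite /GRing.scale /= -(mulr_natl (s ^+ 2)) mulr2n; field.
have d3 : is_derive x 1 (fun y : R => expR ((y - m) ^+ 2 * (- (s ^+ 2 *+ 2)^-1)))
    (expR ((x - m) ^+ 2 * (- (s ^+ 2 *+ 2)^-1)) * (- (x - m) / s ^+ 2)).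
  exact: is_derive1_comp.
have E y : - (y - m) ^+ 2 / (s ^+ 2 *+ 2) = (y - m) ^+ 2 * (- (s ^+ 2 *+ 2)^-1).
  by rewrite mulrN mulNr.
rewrite (_ : (fun y => _) = (fun y => normal_peak s *
    expR ((y - m) ^+ 2 * (- (s ^+ 2 *+ 2)^-1)))); last first.
  by apply/funext => y; rewrite E.
by rewrite E mulrCA [_ / _ * _]mulrC; exact: is_deriveZ.
Qed.

(** The exponent [1 / 2] splits as [3 / 8 + 1 / 8], the second part being that of deviation [2 * s].
    The spare Gaussian factor absorbs polynomials and yields tail bounds, so every estimate reduces
    to the total mass 1 of [p2]. *)
Lemma normal_pdf_double_std (x : R) :
  p x = 2 * expR (- (3 / 8) * ((x - m) ^+ 2 / s ^+ 2)) * p2 x.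
Proof.
have s20 : 2 * s != 0 by rewrite mulf_neq0.
rewrite !normal_pdfE// /normal_fun /normal_peak.
have -> : ((2 * s) ^+ 2 * pi *+ 2) = 2 ^+ 2 * (s ^+ 2 * pi *+ 2) by rewrite exprMn -mulrA mulrnAr.
rewrite sqrtrM ?sqr_ge0// sqrtr_sqr ger0_norm// (invfM 2).
have -> : - (x - m) ^+ 2 / (s ^+ 2 *+ 2) = - (3 / 8) * ((x - m) ^+ 2 / s ^+ 2) +
   (- (x - m) ^+ 2 / ((2 * s) ^+ 2 *+ 2)).
  by rewrite -(mulr_natl (s ^+ 2)) -(mulr_natl ((2 * s) ^+ 2)); field.
have gen (q a b : R) : q * (a * b) = 2 * a * (2^-1 * q * b) by field.
by rewrite expRD; exact: gen.
Qed.

Lemma normal_pdf_moment_le (x : R) :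
  (1 + (x - m) ^+ 2) * p x <= (2 + 8 * s ^+ 2) * p2 x.
Proof.
have s2 : 0 < s ^+ 2 by rewrite exprn_even_gt0.
rewrite normal_pdf_double_std mulrA ler_wpM2r ?normal_pdf_ge0//.
set v := (x - m) ^+ 2 / s ^+ 2.
have -> : (x - m) ^+ 2 = s ^+ 2 * v by rewrite /v; field.
have v0 : 0 <= v by rewrite divr_ge0 ?sqr_ge0// ltW.
rewrite -(@ler_pM2r _ (expR (3 / 8 * v))) ?expR_gt0//.
rewrite -[X in X <= _]mulrA -[X in _ * X <= _]mulrA -expRD.
rewrite (_ : _ + 3 / 8 * v = 0) ?expR0; last by ring.
have := expR_ge1Dx (3 / 8 * v); set e := expR _ => ev.
have : s ^+ 2 * (1 + 3 / 8 * v) <= s ^+ 2 * e by rewrite ler_wpM2l// ltW.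
have := mulr_ge0 (ltW s2) v0; nra.
Qed.

Lemma integrable_normal_pdfM (g : R -> R) (K : R) : measurable_fun [set: R] g ->
  (forall x, `|g x| <= K * (1 + (x - m) ^+ 2)) ->
  mu.-integrable [set: R] (fun x => (g x * p x)%:E).
Proof.
move=> mg gK.
have i2 : mu.-integrable [set: R] (fun x => (K * (2 + 8 * s ^+ 2) * p2 x)%:E).
  under eq_fun do rewrite EFinM.
  by apply: integrableZl => //; exact: integrable_normal_pdf.
apply: le_integrable i2 => //.
  by apply/measurable_EFinP/measurable_funM => //; exact: measurable_normal_pdf.
move=> x _ /=; rewrite lee_fin normrM (@ger0_norm _ (p x)) ?normal_pdf_ge0//.
apply: le_trans (ler_norm _).
rewrite -mulrA (le_trans (ler_wpM2r (normal_pdf_ge0 _ _ _) (gK x)))// -mulrA.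
rewrite ler_wpM2l ?normal_pdf_moment_le//.
have := le_trans (normr_ge0 _) (gK x); rewrite pmulr_lge0//.
by rewrite ltr_pwDl// sqr_ge0.
Qed.

(** Integration by parts: the derivative of [g * p] is [dg * p - g * (x - m) * p / s ^ 2], and
    [g * p] vanishes at infinity. Mean, variance and characteristic function are all read off from
    this identity. *)
Lemma normal_Stein (g dg : R -> R) (K : R) :
  (forall x : R, is_derive x 1 g (dg x)) -> continuous dg ->
  (forall x, `|g x| <= K * (1 + `|x - m|)) -> (forall x, `|dg x| <= K) ->
  \int[mu]_x (g x * (x - m) * p x) = s ^+ 2 * \int[mu]_x (dg x * p x).
Proof.
move=> dgg cdg gK dgK.
have s2 : 0 < s ^+ 2 by rewrite exprn_even_gt0.
have K0 : 0 <= K by exact: le_trans (normr_ge0 _) (dgK m).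
have cg : continuous g.
  move=> x; apply/differentiable_continuous/derivable1_diffP.
  exact: (@ex_derive _ _ _ _ _ _ _ (dgg x)).
have cxm : continuous (fun x : R => x - m).
  by move=> x; apply: (@continuousB _ R^o); [exact: cvg_id|exact: cvg_cst].
have i1 : mu.-integrable [set: R] (fun x => (g x * (x - m) * p x)%:E).
  apply: (@integrable_normal_pdfM _ (2 * K)).
    by apply: measurable_funM; exact: continuous_measurable_fun.
  move=> x; rewrite normrM (le_trans (ler_wpM2r (normr_ge0 _) (gK x)))//.
  rewrite -[X in _ <= _ * (1 + X)]real_normK ?num_real//.
  set a := `|x - m|; have : 0 <= (a - 1) ^+ 2 by rewrite sqr_ge0.
  have a0 : 0 <= a := normr_ge0 _.
  rewrite -mulrA (mulrC 2) -mulrA ler_wpM2l//; nra.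
have i2 : mu.-integrable [set: R] (fun x => (dg x * p x)%:E).
  apply: (@integrable_normal_pdfM _ K); first exact: continuous_measurable_fun.
  by move=> x; rewrite (le_trans (dgK x))// ler_peMr// lerDl sqr_ge0.
have i3 : mu.-integrable [set: R] (fun x => (s ^- 2 * (g x * (x - m) * p x))%:E).
  by under eq_fun do rewrite EFinM; exact: integrableZl.
have int0 : \int[mu]_x (dg x * p x - s ^- 2 * (g x * (x - m) * p x)) = 0.
  pose K' := 2 * K * (2 + 8 * s ^+ 2) * (normal_peak (2 * s) * (8 * s ^+ 2)).
  (* At distance [n.+1] from [m] the polynomial bound on [g] is absorbed by passing from [p] to
     [p2], and [expR u >= u] makes [p2] of order [1 / n.+1]. *)
  have bd n y : (y - m) ^+ 2 = n.+1%:R ^+ 2 :> R -> `|g y * p y| <= K' / n.+1%:R.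
    move=> yn; have n0 : 0 < n.+1%:R :> R by rewrite ltr0n.
    rewrite normrM (@ger0_norm _ (p y)) ?normal_pdf_ge0//.
    have g1 : `|g y| <= 2 * K * (1 + (y - m) ^+ 2).
      rewrite (le_trans (gK y))// -[X in _ <= _ * (1 + X)]real_normK ?num_real//.
      set a := `|y - m|; have : 0 <= (a - 1) ^+ 2 by rewrite sqr_ge0.
      have a0 : 0 <= a := normr_ge0 _.
      by rewrite (mulrC 2) -mulrA ler_wpM2l//; nra.
    have K2 : 0 <= 2 * K by rewrite mulr_ge0.
    have S8 : 0 < 8 * s ^+ 2 by rewrite mulr_gt0.
    have e1 : n.+1%:R / (8 * s ^+ 2) <= expR (n.+1%:R ^+ 2 / ((2 * s) ^+ 2 *+ 2)).
      apply: le_trans (expR_ge1Dx _).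
      have -> : n.+1%:R ^+ 2 / ((2 * s) ^+ 2 *+ 2) = n.+1%:R ^+ 2 / (8 * s ^+ 2).
        by rewrite -mulr_natl; field.
      rewrite addrC ler_wpDr// ler_pM2r ?invr_gt0//.
      by rewrite expr2 ler_peMl// ?ler1n ?ler0n.
    have p2y : p2 y <= normal_peak (2 * s) * (8 * s ^+ 2 / n.+1%:R).
      rewrite normal_pdfE ?mulf_neq0// ler_wpM2l ?normal_peak_ge0//.
      rewrite /normal_fun mulNr yn expRN -[leRHS]invrK.
      by rewrite lef_pV2 ?posrE ?expR_gt0 ?invr_gt0 ?divr_gt0// invf_div.
    have -> : K' / n.+1%:R =
        2 * K * ((2 + 8 * s ^+ 2) * (normal_peak (2 * s) * (8 * s ^+ 2 / n.+1%:R))).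
      by rewrite /K'; ring.
    apply: le_trans (ler_wpM2r (normal_pdf_ge0 _ _ _) g1) _.
    rewrite -(mulrA (2 * K)) ler_wpM2l//.
    apply: le_trans (normal_pdf_moment_le y) _.
    by rewrite ler_wpM2l// addr_ge0// ltW.
  apply: (@integral_derivative_eq0 _ _ (fun x => g x * p x) m K').
  - have cp : continuous p by exact: continuous_normal_pdf.
    have c1 : continuous (fun x => dg x * p x).
      by move=> x; exact: cvgM (cdg x) (cp x).
    have c2 : continuous (fun x => g x * (x - m)).
      by move=> x; exact: cvgM (cg x) (cxm x).
    have c3 : continuous (fun x => g x * (x - m) * p x).
      by move=> x; exact: cvgM (c2 x) (cp x).
    move=> x; exact: cvgB (c1 x) (cvgMr (c3 x)).
  - by have := integrableB measurableT i2 i3; apply: eq_integrable.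
  - move=> x; have dp := is_derive_normal_pdf x.
    apply: (is_derive_eq (is_deriveM (dgg x) dp)).
    by rewrite /GRing.scale /=; field.
  - by move=> n; apply: bd; rewrite addrC addKr.
  - by move=> n; apply: bd; rewrite [X in X ^+ 2](_ : _ = - n.+1%:R) ?sqrrN//; ring.
move: int0; rewrite RintegralB// RintegralZl//.
by move/eqP; rewrite subr_eq0 => /eqP ->; field.
Qed.

End NormalStein.

(** * Moments and characteristic function of the normal density *)

Section NormalCharacteristic.
Context {R : realType}.
Local Notation mu := (@lebesgue_measure R).
Variables (m s : R).
Hypothesis s0 : s != 0.
Local Notation p := (normal_pdf m s).

Let cxm : continuous (fun x : R => x - m).
Proof. by move=> x; apply: (@continuousB _ R^o); [exact: cvg_id|exact: cvg_cst]. Qed.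

Lemma Rintegral_normal_pdf : \int[mu]_x p x = 1.
Proof. by rewrite /Rintegral integral_normal_pdf. Qed.

Lemma Rintegral_normal_center : \int[mu]_x ((x - m) * p x) = 0.
Proof.
have := @normal_Stein R m s s0 (cst 1) (cst 0) 1.
rewrite /= (_ : \int[mu]_x (0 * p x) = 0) ?mulr0; last first.
  by under eq_Rintegral do rewrite mul0r; rewrite /Rintegral integral0.
under [in X in _ -> X]eq_Rintegral do rewrite -[_ - _]mul1r.
apply.
- by move=> x; exact: cvg_cst.
- by move=> x; rewrite normr1 mul1r lerDl.
- by move=> x; rewrite normr0.
Qed.

Lemma Rintegral_normal_variance : \int[mu]_x ((x - m) ^+ 2 * p x) = s ^+ 2.
Proof.
have := @normal_Stein R m s s0 (fun x => x - m) (cst 1) 1.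
rewrite /= (_ : \int[mu]_x (1 * p x) = 1) ?mulr1; last first.
  by under eq_Rintegral do rewrite mul1r; rewrite Rintegral_normal_pdf.
apply.
- by move=> x; apply: is_derive_eq; rewrite subr0.
- by move=> x; exact: cvg_cst.
- by move=> x; rewrite mul1r lerDr.
- by move=> x; rewrite normr1.
Qed.

(** With [F t] the integral for the phase [t * (x - m) + c], differentiation under the integral and
    Stein's identity give [F' = - s ^ 2 * t * F]. Hence [expR (s ^ 2 / 2 * t ^ 2) * F t] is
    constant, and it is compared at [t = 0] and [t = 1]. *)
Lemma Rintegral_normal_cos (c : R) :
  \int[mu]_x (cos (x - m + c) * p x) = cos c * expR (- (s ^+ 2 / 2)).
Proof.
pose f (t x : R) := cos (t * (x - m) + c) * p x.
pose F t := \int[mu]_x f t x.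
have ca t : continuous (fun x : R => t * (x - m) + c).
  move=> x; apply/differentiable_continuous/derivable1_diffP.
  have D : is_derive x 1 (fun x : R => t * (x - m) + c) t.
    by apply: is_derive_eq; rewrite /GRing.scale /=; ring.
  exact: (@ex_derive _ _ _ _ _ _ _ D).
have csin t : continuous (fun x => sin (t * (x - m) + c)).
  by move=> x; apply: continuous_comp; [exact: ca|exact: continuous_sin].
have ccos t : continuous (fun x => cos (t * (x - m) + c)).
  by move=> x; apply: continuous_comp; [exact: ca|exact: continuous_cos].
have df (t x : R) : is_derive t 1 (f^~ x) (- (sin (t * (x - m) + c) * (x - m) * p x)).
  have d1 : is_derive t 1 (fun t : R => t * (x - m) + c) (x - m).
    by apply: is_derive_eq; rewrite /GRing.scale /= mulr0 mulr1 add0r addr0.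
  have d2 : is_derive t 1 (fun t : R => cos (t * (x - m) + c))
     (- sin (t * (x - m) + c) * (x - m)) by exact: is_derive1_comp.
  apply: (is_derive_eq (is_deriveM d2 (is_derive_cst (p x) t 1))).
  by rewrite /GRing.scale /=; ring.
have dE t x : derive1 (f^~ x) t = - (sin (t * (x - m) + c) * (x - m) * p x).
  by rewrite derive1E (@derive_val _ _ _ _ _ _ _ (df t x)).
have abs1 (x : R) : `|x| <= 1 + x ^+ 2.
  rewrite -[x ^+ 2]real_normK ?num_real//; set a := `|x|.
  have : 0 <= (a - 1) ^+ 2 by rewrite sqr_ge0.
  by have : 0 <= a := normr_ge0 _; nra.
have intf t : mu.-integrable [set: R] (EFin \o f t).
  apply: (@integrable_normal_pdfM R m s s0 (fun x => cos (t * (x - m) + c)) 1).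
    exact: continuous_measurable_fun.
  by move=> x; rewrite mul1r (le_trans (cos_max _))// lerDl sqr_ge0.
pose G x := `|x - m| * p x.
have intG : mu.-integrable [set: R] (EFin \o G).
  apply: (@integrable_normal_pdfM R m s s0 (fun x => `|x - m|) 1).
    apply: measurableT_comp => //; exact: continuous_measurable_fun.
  by move=> x; rewrite mul1r normr_id abs1.
have G0 x : 0 <= G x by rewrite mulr_ge0 ?normal_pdf_ge0.
have Gub t x : `|derive1 (f^~ x) t| <= G x.
  rewrite dE normrN !normrM /G (@ger0_norm _ (p x)) ?normal_pdf_ge0//.
  rewrite ler_wpM2r ?normal_pdf_ge0// ler_piMl//; exact: sin_max.
have stein t : \int[mu]_x (sin (t * (x - m) + c) * (x - m) * p x) = s ^+ 2 * (t * F t).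
  have T0 := normr_ge0 t.
  have H1 (x : R) : is_derive x 1 (fun x : R => sin (t * (x - m) + c))
      (t * cos (t * (x - m) + c)).
    have d1 : is_derive x 1 (fun x : R => t * (x - m) + c) t.
      by apply: is_derive_eq; rewrite /GRing.scale /=; ring.
    by rewrite mulrC; exact: is_derive1_comp.
  have H2 : continuous (fun x : R => t * cos (t * (x - m) + c)).
    by move=> x; exact: cvgM (cvg_cst t) (ccos t x).
  have H3 (x : R) : `|sin (t * (x - m) + c)| <= (1 + `|t|) * (1 + `|x - m|).
    apply: le_trans (sin_max _) _.
    by have := normr_ge0 (x - m); nra.
  have H4 (x : R) : `|t * cos (t * (x - m) + c)| <= 1 + `|t|.
    rewrite normrM; have := cos_max (t * (x - m) + c).
    by have := normr_ge0 (cos (t * (x - m) + c)); nra.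
  rewrite (normal_Stein s0 H1 H2 H3 H4).
  congr (_ * _); rewrite /F -RintegralZl//; apply: eq_Rintegral => x _.
  by rewrite /f mulrA.
have dF (t : R) : is_derive t 1 F (- (s ^+ 2 * t * F t)).
  have tI : `]t - 1, t + 1[%classic t by rewrite /= in_itv/=; apply/andP; split; lra.
  have intf' x : `]t - 1, t + 1[%classic x -> mu.-integrable [set: R] (EFin \o f x) by [].
  have derf x y : `]t - 1, t + 1[%classic x -> [set: R] y -> derivable (f ^~ y) x 1.
    by move=> _ _; exact: (@ex_derive _ _ _ _ _ _ _ (df x y)).
  have Gub' x y : `]t - 1, t + 1[%classic x -> [set: R] y -> `|partial1of2 f x y| <= G y.
    by move=> _ _; exact: Gub.
  apply: DeriveDef.
    exact: (derivable_under_integral measurableT tI intf' derf G0 intG Gub').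
  rewrite -derive1E.
  rewrite (differentiation_under_integral measurableT tI intf' derf G0 intG Gub').
  rewrite -mulrA -stein -mulN1r -RintegralZl//.
    by apply: eq_Rintegral => x _; rewrite /partial1of2 dE mulN1r.
  apply: (@integrable_normal_pdfM R m s s0 (fun x => sin (t * (x - m) + c) * (x - m)) 1).
    by apply: measurable_funM; exact: continuous_measurable_fun.
  move=> x; rewrite mul1r normrM (le_trans _ (abs1 _))// ler_piMl//; exact: sin_max.
pose h t := expR (s ^+ 2 / 2 * t ^+ 2) * F t.
have dh (t : R) : is_derive t 1 h 0.
  have d1 : is_derive t 1 (fun t : R => s ^+ 2 / 2 * t ^+ 2) (s ^+ 2 * t).
    apply: is_derive_eq; rewrite /GRing.scale /= mulr2n; by field.
  have d2 : is_derive t 1 (fun t : R => expR (s ^+ 2 / 2 * t ^+ 2))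
    (expR (s ^+ 2 / 2 * t ^+ 2) * (s ^+ 2 * t)) by exact: is_derive1_comp.
  apply: (is_derive_eq (is_deriveM d2 (dF t))).
  by rewrite /GRing.scale /=; ring.
have := is_derive_0_is_cst 1 0 dh.
rewrite /h expr1n mulr1 expr0n mulr0 expR0 mul1r.
have -> : F 0 = cos c.
  rewrite /F /f; under eq_Rintegral do rewrite mul0r add0r.
  rewrite RintegralZl//; last exact: integrable_normal_pdf.
  by rewrite Rintegral_normal_pdf mulr1.
have -> : F 1 = \int[mu]_x (cos (x - m + c) * p x).
  by apply: eq_Rintegral => x _; rewrite /f mul1r.
by move=> <-; rewrite expRN mulrC mulKf// gt_eqF ?expR_gt0.
Qed.

End NormalCharacteristic.

Section NormalVariable.
Context {R : realType} d (T : measurableType d) (P : probability T R).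
Local Notation mu := (@lebesgue_measure R).
Variables (Y : T -> R) (m s : R).
Hypothesis lawY : has_normal_law P Y m s.

Lemma degenerate_law_integral (g : R -> R) : s = 0 -> measurable_fun [set: R] g ->
  P.-integrable [set: T] (fun w => (g (Y w))%:E) /\ \int[P]_w (g (Y w)) = g m.
Proof.
move=> s0 mg; have [mY PY] := lawY.
have aeY : {ae P, forall w, g (Y w) = g m}.
  exists (Y @^-1` (~` [set m])); split.
  - by rewrite -[X in measurable X]setTI; apply: mY => //; exact: measurableC.
  - rewrite PY; last exact: measurableC.
    rewrite s0 eqxx /dirac indicE memNset// => /(_ erefl).
    by [].
  - by move=> w /= h; apply: contra_not h => ->.
have mgY : measurable_fun [set: T] (fun w => (g (Y w))%:E).
  by apply/measurable_EFinP; exact: measurableT_comp.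
have ae1 : ae_eq P setT (fun w => (g (Y w))%:E) (cst (g m)%:E).
  by apply: filterS aeY => w + _ => ->.
have fin : (\int[P]_w (cst (g m)%:E) w = (g m)%:E)%E.
  by rewrite integral_cst// [X in (_ * X)%E]probability_setT mule1.
split.
  apply/integrableP; split=> //.
  rewrite (@ae_eq_integral _ _ _ P setT (cst `|(g m)%:E|%E))//.
  - by rewrite integral_cst// [X in (_ * X)%E]probability_setT mule1 ltry.
  - exact: measurableT_comp.
  - by apply: filterS aeY => w + _ => ->.
by rewrite /Rintegral (@ae_eq_integral _ _ _ P setT (cst (g m)%:E)) ?fin//.
Qed.

Lemma normal_law_Rintegral (g : R -> R) (K : R) : measurable_fun [set: R] g ->
  (forall x, `|g x| <= K * (1 + (x - m) ^+ 2)) ->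
  P.-integrable [set: T] (fun w => (g (Y w))%:E) /\
  \int[P]_w (g (Y w)) = if s == 0 then g m else \int[mu]_x (g x * normal_pdf m s x).
Proof.
move=> mg gK; have [s0|s0] := eqVneq s 0.
  exact: degenerate_law_integral.
apply: integral_normal_law => //.
exact: (integrable_normal_pdfM s0 mg gK).
Qed.

Lemma normal_law_moments :
  [/\ P.-integrable [set: T] (EFin \o Y),
      P.-integrable [set: T] (fun w => (Y w ^+ 2)%:E),
      \int[P]_w Y w = m & \int[P]_w (Y w ^+ 2) = m ^+ 2 + s ^+ 2].
Proof.
have M0 := normr_ge0 m.
have abs1 (x : R) : `|x| <= 1 + x ^+ 2.
  rewrite -[x ^+ 2]real_normK ?num_real//; set a := `|x|.
  have : 0 <= (a - 1) ^+ 2 by rewrite sqr_ge0.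
  by have : 0 <= a := normr_ge0 _; nra.
have b1 (x : R) : `|x| <= (1 + `|m|) * (1 + (x - m) ^+ 2).
  rewrite -[x in X in X <= _](subrK m) (le_trans (ler_normD _ _))//.
  by have := abs1 (x - m); have := sqr_ge0 (x - m); nra.
have b2 (x : R) : `|x ^+ 2| <= (2 + 2 * m ^+ 2) * (1 + (x - m) ^+ 2).
  rewrite ger0_norm ?sqr_ge0//.
  have := sqr_ge0 (x - m - m); have := sqr_ge0 (x - m); have := sqr_ge0 m.
  by have := mulr_ge0 (sqr_ge0 m) (sqr_ge0 (x - m)); nra.
have [i1 e1] := @normal_law_Rintegral (fun x => x) _ (@measurable_id _ _ _) b1.
have m2 : measurable_fun [set: R] (fun x : R => x ^+ 2) by exact: measurable_funX.
have [i2 e2] := @normal_law_Rintegral (fun x => x ^+ 2) _ m2 b2.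
split=> //.
  rewrite e1; case: (eqVneq s 0) => [//|s0].
  transitivity (\int[mu]_x ((x - m) * normal_pdf m s x + m * normal_pdf m s x)).
    by apply: eq_Rintegral => x _; ring.
  rewrite RintegralD//; last 2 first.
  - apply: (integrable_normal_pdfM s0 (g := fun x => x - m) (K := 1)).
      exact: measurable_funB.
    by move=> x; rewrite mul1r abs1.
  - rewrite /comp; under eq_fun do rewrite EFinM.
    by apply: integrableZl => //; exact: integrable_normal_pdf.
  rewrite Rintegral_normal_center// RintegralZl//; last exact: integrable_normal_pdf.
  by rewrite Rintegral_normal_pdf add0r mulr1.
rewrite e2; case: (eqVneq s 0) => [->|s0]; first by rewrite expr0n addr0.
transitivity (\int[mu]_x ((x - m) ^+ 2 * normal_pdf m s x +
   (2 * m * ((x - m) * normal_pdf m s x) + m ^+ 2 * normal_pdf m s x))).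
  by apply: eq_Rintegral => x _; ring.
have j0 := @integrable_normal_pdf R m s.
have j1 : mu.-integrable [set: R] (fun x => ((x - m) * normal_pdf m s x)%:E).
  apply: (integrable_normal_pdfM s0 (g := fun x => x - m) (K := 1)).
    exact: measurable_funB.
  by move=> x; rewrite mul1r abs1.
have j2 : mu.-integrable [set: R] (fun x => ((x - m) ^+ 2 * normal_pdf m s x)%:E).
  apply: (integrable_normal_pdfM s0 (g := fun x => (x - m) ^+ 2) (K := 1)).
    by apply: measurable_funX; exact: measurable_funB.
  by move=> x; rewrite mul1r ger0_norm ?sqr_ge0// lerDr.
have k1 : mu.-integrable [set: R] (fun x => (2 * m * ((x - m) * normal_pdf m s x))%:E).
  by under eq_fun do rewrite EFinM; exact: integrableZl.
have k0 : mu.-integrable [set: R] (fun x => (m ^+ 2 * normal_pdf m s x)%:E).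
  by under eq_fun do rewrite EFinM; exact: integrableZl.
rewrite RintegralD//; last first.
  by rewrite /comp; under eq_fun do rewrite EFinD; exact: integrableD.
rewrite RintegralD// !RintegralZl// Rintegral_normal_center//.
by rewrite Rintegral_normal_variance// Rintegral_normal_pdf; ring.
Qed.

Lemma normal_law_cos (c : R) :
  P.-integrable [set: T] (fun w => (cos (Y w - m + c))%:E) /\
  \int[P]_w cos (Y w - m + c) = cos c * expR (- (s ^+ 2 / 2)).
Proof.
have mg : measurable_fun [set: R] (fun x : R => cos (x - m + c)).
  apply: continuous_measurable_fun => x.
  apply: continuous_comp; last exact: continuous_cos.
  apply/differentiable_continuous/derivable1_diffP.
  have D : is_derive x 1 (fun x : R => x - m + c) 1.
    by apply: is_derive_eq; ring.
  exact: (@ex_derive _ _ _ _ _ _ _ D).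
have bg (x : R) : `|cos (x - m + c)| <= 1 * (1 + (x - m) ^+ 2).
  by rewrite mul1r (le_trans (cos_max _))// lerDl sqr_ge0.
have [i ->] := normal_law_Rintegral mg bg.
split=> //; case: eqVneq => [->|s0]; last by rewrite Rintegral_normal_cos.
by rewrite subrr add0r expr0n mul0r oppr0 expR0 mulr1.
Qed.

(** Beyond [r] the density is a small multiple of the density of deviation [2 * s], whose mass is 1;
    the exponent [3 / 8] is weakened to [1 / 4]. *)
Lemma normal_law_tail (r : R) : m = 0 -> s != 0 -> 0 < r ->
  (P [set w | (r < `|Y w|)%R] <= (2 * expR (- (r ^+ 2 / (4 * s ^+ 2))))%:E)%E.
Proof.
move=> m0 s0 r0; have [mY PY] := lawY.
have mA : measurable [set x : R | r < `|x|].
  rewrite (_ : [set _ | _] = (fun x : R => `|x|) @^-1` `]r, +oo[%classic).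
    rewrite -[X in measurable X]setTI.
    by apply: (@measurableT_comp _ _ _ _ _ _ (fun x : R => `|x|) _ id).
  by apply/seteqP; split=> x /=; rewrite in_itv/= andbT.
have -> : [set w | r < `|Y w|] = Y @^-1` [set x : R | r < `|x|] by [].
rewrite PY// (negbTE s0) /normal_prob.
apply: (@le_trans _ _ (\int[mu]_(x in [set x : R | (r < `|x|)%R])
   (2 * expR (- (r ^+ 2 / (4 * s ^+ 2))) * normal_pdf m (2 * s) x)%:E)%E).
  apply: ge0_le_integral => //.
  - by move=> x _; rewrite lee_fin normal_pdf_ge0.
  - by apply/measurable_funTS/measurable_EFinP; exact: measurable_normal_pdf.
  - apply/measurable_funTS/measurable_EFinP; apply: measurable_funM => //.
    exact: measurable_normal_pdf.
  move=> x /= rx; rewrite lee_fin (normal_pdf_double_std _ s0).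
  rewrite ler_wpM2r ?normal_pdf_ge0// ler_wpM2l// ler_expR mulNr lerN2 m0 subr0.
  have s2 : 0 < s ^+ 2 by rewrite exprn_even_gt0.
  have rx2 : r ^+ 2 <= x ^+ 2.
    by rewrite -[x ^+ 2]real_normK ?num_real// lerXn2r ?nnegrE ?(ltW r0) ?(ltW rx).
  rewrite ler_pdivrMr ?(mulr_gt0 _ s2)// [leRHS](_ : _ = 3 / 2 * x ^+ 2); last first.
    by field.
  by have := sqr_ge0 x; lra.
rewrite [leRHS](_ : _ = \int[mu]_x
   (2 * expR (- (r ^+ 2 / (4 * s ^+ 2))) * normal_pdf m (2 * s) x)%:E)%E.
  apply: ge0_subset_integral => //.
    apply/measurable_EFinP; apply: measurable_funM => //; exact: measurable_normal_pdf.
  by move=> x _; rewrite lee_fin !mulr_ge0 ?expR_ge0 ?normal_pdf_ge0.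
under eq_integral do rewrite EFinM.
rewrite integralZl//; last exact: integrable_normal_pdf.
by rewrite integral_normal_pdf mule1.
Qed.

End NormalVariable.

(** * Local laws of the Gaussian entire function *)

Section GaussianPair.
Context {R : realType} d (T : measurableType d) (P : probability T R).
Variable F0 : T -> R[i] -> R[i].
Hypothesis F0_gauss : gaussian_entire_function P F0.
Local Notation Int f := (P.-integrable [set: T] (EFin \o f)).

Lemma integrable_product (f g : T -> R) : measurable_fun [set: T] f ->
  measurable_fun [set: T] g ->
  Int (fun w => f w ^+ 2) -> Int (fun w => g w ^+ 2) -> Int (fun w => f w * g w).
Proof.
move=> mf mg i1 i2; have i3 := integrableD measurableT i1 i2.
apply: le_integrable i3 => //.
  by apply/measurable_EFinP; exact: measurable_funM.
move=> w _ /=; rewrite lee_fin [leRHS]ger0_norm; last by rewrite addr_ge0// sqr_ge0.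
rewrite ler_norml; have := sqr_ge0 (f w - g w); have := sqr_ge0 (f w + g w).
by move=> ? ?; apply/andP; split; nra.
Qed.

Lemma expectation_Rintegral (f : T -> R) : fine 'E_P[f] = \int[P]_w f w.
Proof. by rewrite unlock. Qed.

Section Pair.
Variables (z z' : R[i]).
Let zz := fun k : 'I_2 => if k == ord0 then z else z'.
Let X := fun (k : 'I_2) w => F0 w (zz k).
Let W (a b : R[i]) w := a * F0 w z + b * F0 w z'.

Let ReW (a b : R[i]) w : complex.Re (W a b w) =
  \sum_(k < 2) ((if k == ord0 then complex.Re a else complex.Re b) * complex.Re (X k w)
   + (if k == ord0 then - complex.Im a else - complex.Im b) * complex.Im (X k w)).
Proof.
rewrite big_ord_recl big_ord1 /= /W /X /zz /= ReD !ReM; ring.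
Qed.

Let law (a b : R[i]) : exists m s, has_normal_law P (fun w => complex.Re (W a b w)) m s.
Proof.
have [_ /(_ 2%N zz)[cn _ _ _]] := F0_gauss.
have := cn (fun k => if k == ord0 then complex.Re a else complex.Re b)
  (fun k => if k == ord0 then - complex.Im a else - complex.Im b).
rewrite (_ : (fun w => \sum_(k < 2) _) = (fun w => complex.Re (W a b w))); last first.
  by apply/funext => w; rewrite ReW.
by move=> [mW [m [s H]]]; exists m, s.
Qed.

Let ReX0 w : complex.Re (W 1 0 w) = complex.Re (F0 w z).
Proof. by rewrite /W mul1r mul0r addr0. Qed.
Let ImX0 w : complex.Re (W (- 'i) 0 w) = complex.Im (F0 w z).
Proof. by rewrite /W mul0r addr0 ReM /=; ring. Qed.
Let ReX1 w : complex.Re (W 0 1 w) = complex.Re (F0 w z').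
Proof. by rewrite /W mul1r mul0r add0r. Qed.
Let ImX1 w : complex.Re (W 0 (- 'i) w) = complex.Im (F0 w z').
Proof. by rewrite /W mul0r add0r ReM /=; ring. Qed.

Let law_moments (a b : R[i]) : [/\ measurable_fun [set: T] (fun w => complex.Re (W a b w)),
  Int (fun w => complex.Re (W a b w)) & Int (fun w => complex.Re (W a b w) ^+ 2)].
Proof.
have [m [s L]] := law a b; have [mW _] := L.
by have [? ? _ _] := normal_law_moments L.
Qed.

Let component_moments : [/\ [/\ measurable_fun [set: T] (fun w => complex.Re (F0 w z)),
   Int (fun w => complex.Re (F0 w z)) & Int (fun w => complex.Re (F0 w z) ^+ 2)],
  [/\ measurable_fun [set: T] (fun w => complex.Im (F0 w z)),
   Int (fun w => complex.Im (F0 w z)) & Int (fun w => complex.Im (F0 w z) ^+ 2)],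
  [/\ measurable_fun [set: T] (fun w => complex.Re (F0 w z')),
   Int (fun w => complex.Re (F0 w z')) & Int (fun w => complex.Re (F0 w z') ^+ 2)] &
  [/\ measurable_fun [set: T] (fun w => complex.Im (F0 w z')),
   Int (fun w => complex.Im (F0 w z')) & Int (fun w => complex.Im (F0 w z') ^+ 2)]].
Proof.
have e1 : (fun w => complex.Re (F0 w z)) = (fun w => complex.Re (W 1 0 w)).
  by apply/funext => w; rewrite ReX0.
have e2 : (fun w => complex.Im (F0 w z)) = (fun w => complex.Re (W (- 'i) 0 w)).
  by apply/funext => w; rewrite ImX0.
have e3 : (fun w => complex.Re (F0 w z')) = (fun w => complex.Re (W 0 1 w)).
  by apply/funext => w; rewrite ReX1.
have e4 : (fun w => complex.Im (F0 w z')) = (fun w => complex.Re (W 0 (- 'i) w)).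
  by apply/funext => w; rewrite ImX1.
have sq (u v : T -> R) : u = v -> (fun w => u w ^+ 2) = (fun w => v w ^+ 2) by move=> ->.
rewrite (sq _ _ e1) (sq _ _ e2) (sq _ _ e3) (sq _ _ e4) e1 e2 e3 e4.
by split; exact: law_moments.
Qed.

Let mean0 (a b : R[i]) : \int[P]_w complex.Re (W a b w) = 0.
Proof.
have [_ /(_ 2%N zz)[_ _ m0 _]] := F0_gauss.
have [[_ i1 _] [_ i2 _] [_ i3 _] [_ i4 _]] := component_moments.
have := m0 ord0; have := m0 (lift ord0 ord0).
rewrite /cexpectation /zz /= !expectation_Rintegral => -[r1 q1] [r0 q0].
transitivity (\int[P]_w (complex.Re a * complex.Re (F0 w z) + (- complex.Im a * complex.Im (F0 w z)
  + (complex.Re b * complex.Re (F0 w z') + - complex.Im b * complex.Im (F0 w z'))))).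
  by apply: eq_Rintegral => w _; rewrite /W ReD !ReM; ring.
have IZ (c : R) f : Int f -> Int (fun w => c * f w).
  by move=> If; rewrite /comp; under eq_fun do rewrite EFinM; exact: integrableZl.
have ID f g : Int f -> Int g -> Int (fun w => f w + g w).
  by move=> If Ig; rewrite /comp; under eq_fun do rewrite EFinD; exact: integrableD.
have j1 := IZ (complex.Re a) _ i1; have j2 := IZ (- complex.Im a) _ i2.
have j3 := IZ (complex.Re b) _ i3; have j4 := IZ (- complex.Im b) _ i4.
have j34 := ID _ _ j3 j4; have j234 := ID _ _ j2 j34.
rewrite (RintegralD measurableT j1 j234) (RintegralD measurableT j2 j34).
rewrite (RintegralD measurableT j3 j4) !RintegralZl//.
by rewrite r0 q0 r1 q1 !mulr0 !addr0.
Qed.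

Let law0 (a b : R[i]) : exists s, [/\ has_normal_law P (fun w => complex.Re (W a b w)) 0 s &
  \int[P]_w (complex.Re (W a b w) ^+ 2) = s ^+ 2].
Proof.
have [m [s L]] := law a b; have [_ _ e1 e2] := normal_law_moments L.
move: e1; rewrite mean0 => m0; exists s; rewrite -m0 in L e2 *.
by split=> //; rewrite e2 expr0n add0r.
Qed.

(** Rotation by ['i], the angle [pi / 2] of circular symmetry, turns the real part into minus the
    imaginary part, so both have the same second moment. *)
Let circular (a b : R[i]) :
  \int[P]_w (complex.Re (W a b w) ^+ 2) = \int[P]_w (complex.Im (W a b w) ^+ 2).
Proof.
have [_ /(_ 2%N zz)[_ cs _ _]] := F0_gauss.
have [s [[mL L] e]] := law0 a b.
suff L' : has_normal_law P (fun w => complex.Re (W (a * 'i) (b * 'i) w)) 0 s.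
  have [_ _ _] := normal_law_moments L'; rewrite expr0n add0r e => <-.
  by apply: eq_Rintegral => w _; rewrite /W !ReD !ImD !ReM !ImM /=; ring.
have [mL' _ _] := law_moments (a * 'i) (b * 'i).
split=> // B mB; rewrite -L//.
pose l (t : 2.-tuple (R * R)) : R :=
  complex.Re a * (tnth t ord0).1 - complex.Im a * (tnth t ord0).2 +
  (complex.Re b * (tnth t (lift ord0 ord0)).1 - complex.Im b * (tnth t (lift ord0 ord0)).2).
have ml : measurable_fun [set: 2.-tuple (R * R)] l.
  have mt (i : 'I_2) : measurable_fun [set: 2.-tuple (R * R)] (fun t : 2.-tuple (R * R) => tnth t i).
    exact: measurable_tnth.
  apply: measurable_funD; apply: measurable_funB; apply: measurable_funM => //;
    (apply: measurableT_comp; [exact: measurable_fst|exact: mt]) ||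
    (apply: measurableT_comp; [exact: measurable_snd|exact: mt]).
have := cs (pi / 2) (l @^-1` B).
rewrite /joint_law /pushforward => /(_ _)/wrap[].
  by rewrite -[X in measurable X]setTI; exact: ml.
have -> : cexp (0 +i* (pi / 2)) = 'i :> R[i].
  by rewrite /cexp /= expR0 cos_pihalf sin_pihalf !mul1r.
set A1 := (X in P X = _ -> _); set A2 := (X in _ = P X -> _).
have -> : A1 = (fun w => complex.Re (W (a * 'i) (b * 'i) w)) @^-1` B.
  apply/funext => w; rewrite /A1 /preimage /=; congr (B _).
  by rewrite /l /= !tnth_mktuple /zz /= /W !ReD !ReM !ImM /=; ring.
have -> : A2 = (fun w => complex.Re (W a b w)) @^-1` B.
  apply/funext => w; rewrite /A2 /preimage /=; congr (B _).
  by rewrite /l /= !tnth_mktuple /zz /= /W !ReD !ReM /=; ring.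
by [].
Qed.

(** By circularity the variance of the real part is half the mean of the squared modulus. That mean
    involves only the Hermitian covariances, which the kernel provides. *)
Lemma gaussian_pair_law (a b : R[i]) : exists2 s : R,
  has_normal_law P (fun w => complex.Re (a * F0 w z + b * F0 w z')) 0 s &
  2 * s ^+ 2 = normc a ^+ 2 * expR (normc z ^+ 2) + normc b ^+ 2 * expR (normc z' ^+ 2)
    + 2 * complex.Re (a * conjc b * cexp (z * conjc z')).
Proof.
have [s [L e]] := law0 a b; exists s => //.
have [_ /(_ 2%N zz)[_ _ _ cov]] := F0_gauss.
have [[m1 _ i1] [m2 _ i2] [m3 _ i3] [m4 _ i4]] := component_moments.
have zn (u : R[i]) : u * conjc u = (normc u ^+ 2)%:C.
  by apply: complexP; rewrite sqr_normc2; case: u => x y /=; ring.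
have c00 : \int[P]_w (complex.Re (F0 w z) ^+ 2 + complex.Im (F0 w z) ^+ 2) = expR (normc z ^+ 2).
  have := cov ord0 ord0.
  rewrite mxE (_ : cexp _ = (expR (normc z ^+ 2))%:C); last by rewrite -cexp_real -zn.
  move=> /(congr1 (@complex.Re R)) /=; rewrite expectation_Rintegral => <-.
  by apply: eq_Rintegral => w _; rewrite zn /= sqr_normc2.
have c11 : \int[P]_w (complex.Re (F0 w z') ^+ 2 + complex.Im (F0 w z') ^+ 2) = expR (normc z' ^+ 2).
  have := cov (lift ord0 ord0) (lift ord0 ord0).
  rewrite mxE (_ : cexp _ = (expR (normc z' ^+ 2))%:C); last by rewrite -cexp_real -zn.
  move=> /(congr1 (@complex.Re R)) /=; rewrite expectation_Rintegral => <-.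
  by apply: eq_Rintegral => w _; rewrite zn /= sqr_normc2.
have c01 := cov ord0 (lift ord0 ord0).
have c01r : \int[P]_w (complex.Re (F0 w z) * complex.Re (F0 w z') + complex.Im (F0 w z) * complex.Im (F0 w z'))
    = complex.Re (cexp (z * conjc z')).
  move: c01; rewrite mxE (_ : cexp _ = cexp (z * conjc z'))// => /(congr1 (@complex.Re R)) <-.
  rewrite /cexpectation [RHS]/= expectation_Rintegral.
  by apply: eq_Rintegral => w _; case: (F0 w z) (F0 w z') => x y [x' y'] /=; ring.
have c01i : \int[P]_w (complex.Im (F0 w z) * complex.Re (F0 w z') - complex.Re (F0 w z) * complex.Im (F0 w z'))
    = complex.Im (cexp (z * conjc z')).
  move: c01; rewrite mxE (_ : cexp _ = cexp (z * conjc z'))// => /(congr1 (@complex.Im R)) <-.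
  rewrite /cexpectation [RHS]/= expectation_Rintegral.
  by apply: eq_Rintegral => w _; case: (F0 w z) (F0 w z') => x y [x' y'] /=; ring.
have IZ (c : R) f : Int f -> Int (fun w => c * f w).
  by move=> If; rewrite /comp; under eq_fun do rewrite EFinM; exact: integrableZl.
have ID f g : Int f -> Int g -> Int (fun w => f w + g w).
  by move=> If Ig; rewrite /comp; under eq_fun do rewrite EFinD; exact: integrableD.
have IB f g : Int f -> Int g -> Int (fun w => f w - g w).
  by move=> If Ig; rewrite /comp; under eq_fun do rewrite EFinB; exact: integrableB.
have j0 := IZ (normc a ^+ 2) _ (ID _ _ i1 i2).
have j1 := IZ (normc b ^+ 2) _ (ID _ _ i3 i4).
have j2 := IZ (2 * complex.Re (a * conjc b)) _
  (ID _ _ (integrable_product m1 m3 i1 i3) (integrable_product m2 m4 i2 i4)).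
have j3 := IZ (2 * complex.Im (a * conjc b)) _
  (IB _ _ (integrable_product m2 m3 i2 i3) (integrable_product m1 m4 i1 i4)).
have [mR _ iR] := law_moments a b.
have [mI _ iI] := law_moments (a * - 'i) (b * - 'i).
have iI' : Int (fun w => complex.Im (W a b w) ^+ 2).
  apply: eq_integrable iI => // w _ /=; congr (_ %:E); rewrite /W ReD !ReM ImD !ImM /=; ring.
have -> : 2 * s ^+ 2 = \int[P]_w (complex.Re (W a b w) ^+ 2 + complex.Im (W a b w) ^+ 2).
  by rewrite (RintegralD measurableT iR iI') -circular e; ring.
transitivity (\int[P]_w (normc a ^+ 2 * (complex.Re (F0 w z) ^+ 2 + complex.Im (F0 w z) ^+ 2) +
   (normc b ^+ 2 * (complex.Re (F0 w z') ^+ 2 + complex.Im (F0 w z') ^+ 2) +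
   (2 * complex.Re (a * conjc b) * (complex.Re (F0 w z) * complex.Re (F0 w z') + complex.Im (F0 w z) * complex.Im (F0 w z'))
   - 2 * complex.Im (a * conjc b) * (complex.Im (F0 w z) * complex.Re (F0 w z') - complex.Re (F0 w z) * complex.Im (F0 w z')))))).
  apply: eq_Rintegral => w _; rewrite /W !sqr_normc2; move: (F0 w z) (F0 w z').
  clear; move: a b => [a1 a2] [b1 b2] [x y] [x' y'] /=; ring.
have j23 := IB _ _ j2 j3; have j123 := ID _ _ j1 j23.
rewrite (RintegralD measurableT j0 j123) (RintegralD measurableT j1 j23).
rewrite (RintegralB measurableT j2 j3) !RintegralZl//.
- rewrite c00 c11 c01r c01i [X in _ = _ + 2 * X]ReM; ring.
- exact: IB (integrable_product m2 m3 i2 i3) (integrable_product m1 m4 i1 i4).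
- exact: ID (integrable_product m1 m3 i1 i3) (integrable_product m2 m4 i2 i4).
- exact: ID i3 i4.
- exact: ID i1 i2.
Qed.

End Pair.
End GaussianPair.

(** * Small-ball probabilities of Gaussian vectors *)

Section GaussianSmallBall.
Context {R : realType} d (T : measurableType d) (P : probability T R).

(** With truncated subtraction the exponent is the distance [|j - k|]; a geometric series is summed
    on each side of [j]. *)
Lemma geometric_two_sided_le (x : R) (N j : nat) : 0 <= x < 1 ->
  \sum_(k < N) x ^+ ((j - k) + (k - j)) <= 2 / (1 - x).
Proof.
move=> /andP[x0 x1]; have x10 : 0 < 1 - x by rewrite subr_gt0.
have xn n : 0 <= x ^+ n <= 1 by rewrite exprn_ge0// exprn_ile1// ltW.
rewrite ler_pdivlMr//.
have [Nj|jN] := leqP N j.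
  suff -> : (\sum_(k < N) x ^+ ((j - k) + (k - j))) * (1 - x) = x ^+ (j.+1 - N) - x ^+ j.+1.
    by have := xn (j.+1 - N)%N; have := xn j.+1; lra.
  elim: N Nj => [|N IH] Nj; first by rewrite big_ord0 mul0r subn0 subrr.
  rewrite big_ord_recr /= mulrDl IH ?(ltnW Nj)//.
  rewrite (_ : N - j = 0)%N ?addn0; last by apply/eqP; rewrite subn_eq0 ltnW.
  by rewrite subSS subSn ?(ltnW Nj)// exprS; ring.
suff H M : (\sum_(k < j.+1 + M) x ^+ ((j - k) + (k - j))) * (1 - x) =
    1 + x - x ^+ M.+1 - x ^+ j.+1.
  rewrite -(subnKC jN) H.
  by have := xn (N - j.+1).+1; have := xn j.+1; lra.
elim: M => [|M IH].
  rewrite addn0 expr1 addrK.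
  suff H M : (M <= j.+1)%N -> (\sum_(k < M) x ^+ ((j - k) + (k - j))) * (1 - x) = x ^+ (j.+1 - M) - x ^+ j.+1.
    by rewrite H// subnn expr0.
  elim: M => [|M IH] Mj; first by rewrite big_ord0 mul0r subn0 subrr.
  rewrite big_ord_recr /= mulrDl IH ?(ltnW Mj)//.
  rewrite (_ : M - j = 0)%N ?addn0; last by apply/eqP; rewrite subn_eq0.
  by rewrite subSS subSn// exprS; ring.
rewrite addnS big_ord_recr /= mulrDl IH.
rewrite (_ : j - (j.+1 + M) = 0)%N; last by apply/eqP; rewrite subn_eq0 addSn -addnS leq_addr.
rewrite add0n (_ : j.+1 + M - j = M.+1)%N ?addSnnS ?addKn//.
by rewrite (exprS x M.+1); ring.
Qed.

(** Since [u ^ 2 / 2 >= u - 1 / 2], each term is at most [2 * expR (- kappa)] raised to [|j - k|]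
    (the 2 outside the power), and [1 - expR (- kappa) >= kappa / 2] for [kappa <= 1]. *)
Lemma discrete_gaussian_sum_le (kappa : R) (N j : nat) : 0 < kappa <= 1 ->
  \sum_(k < N) expR (- ((kappa * (j%:R - k%:R)) ^+ 2 / 2)) <= 8 / kappa.
Proof.
move=> /andP[k0 k1].
have x1 : expR (- kappa) <= (1 + kappa)^-1.
  rewrite expRN lef_pV2 ?posrE ?expR_gt0 ?expR_ge1Dx//; lra.
have x01 : 0 <= expR (- kappa) < 1.
  by rewrite expR_ge0 expR_lt1 oppr_lt0.
have e2 : expR (1 / 2) <= 2 :> R.
  have := expR_ge1Dx (- (1 / 2) : R); have := expRxMexpNx_1 (1 / 2 : R).
  by have := expR_gt0 (1 / 2 : R); nra.
have term k : expR (- ((kappa * (j%:R - k%:R)) ^+ 2 / 2)) <=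
    2 * expR (- kappa) ^+ ((j - k) + (k - j)).
  rewrite -expRM_natl.
  have dist : ((j - k) + (k - j))%:R = `|j%:R - k%:R| :> R.
    have [jk|kj] := leqP j k.
      rewrite (_ : j - k = 0)%N ?add0n; last by apply/eqP; rewrite subn_eq0.
      by rewrite natrB// distrC ger0_norm// subr_ge0 ler_nat.
    rewrite (_ : k - j = 0)%N ?addn0; last by apply/eqP; rewrite subn_eq0 ltnW.
    by rewrite natrB ?(ltnW kj)// ger0_norm// subr_ge0 ler_nat ltnW.
  apply: le_trans (ler_wpM2r (expR_ge0 _) e2); rewrite -expRD ler_expR dist.
  rewrite exprMn -[(_ - _) ^+ 2]real_normK ?num_real//; set a := `|_|.
  by have := sqr_ge0 (kappa * a - 1); nra.
apply: (@le_trans _ _ (2 * (2 / (1 - expR (- kappa))))).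
  apply: le_trans (ler_wpM2l _ (@geometric_two_sided_le _ N j x01)) => //.
  by rewrite mulr_sumr; apply: ler_sum => k _.
rewrite mulrA ler_pdivrMr ?subr_gt0; last by case/andP: x01.
rewrite mulrAC ler_pdivlMr//.
have : expR (- kappa) * (1 + kappa) <= 1.
  by rewrite -[leRHS](@mulVf _ (1 + kappa)) ?ler_wpM2r// ?gt_eqF//; lra.
have : 0 <= expR (- kappa) by rewrite expR_ge0.
set y := expR (- kappa); nra.
Qed.

Lemma cos_half_le (x : R) : `|x| <= 1 / 2 -> cos (1 / 2) <= cos x.
Proof.
have p1 : 1 <= pi / 2 :> R := pihalf_ge1 R.
have -> : cos x = cos `|x|.
  by case: ger0P => _; rewrite ?cosN.
rewrite le_eqVlt => /predU1P[->//|x1]; apply: ltW.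
by rewrite ltr_cos// in_itv/=; apply/andP; split => //; lra.
Qed.

Lemma cos_half_gt0 : 0 < cos (1 / 2) :> R.
Proof.
have p1 : 1 <= pi / 2 :> R := pihalf_ge1 R.
by apply: cos_gt0_pihalf; apply/andP; split; lra.
Qed.

(* Expanding the square of the trigonometric polynomial [\sum_j expi a_j],
   which is at least [#|J| cos (1 / 2)] on the event, replaces Fourier
   inversion of the characteristic function. *)
Lemma gaussian_small_ball n (V : 'I_n.+1 -> T -> R) (sg x e : 'I_n.+1 -> R) :
  (forall i, 0 < sg i) -> (forall i, 0 < e i) ->
  (forall i, measurable_fun [set: T] (V i)) ->
  (forall u : 'I_n.+1 -> R, exists2 s : R,
     has_normal_law P (fun w => \sum_i u i * V i w) 0 s &
     s ^+ 2 = \sum_i (sg i * u i) ^+ 2) ->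
  (P [set w | forall i, (`|V i w + x i| <= e i)%R] <=
    ((16 * n.+1%:R) ^+ n.+1 / cos (1 / 2) ^+ 2 * \prod_i (e i / sg i))%:E)%E.
Proof.
move=> sg0 e0 mV law.
have n0 : 0 < n.+1%:R :> R by rewrite ltr0n.
(* [N] is so large that [sg i * tau i <= 1] below, the range in which [discrete_gaussian_sum_le]
   applies. *)
have [N N0 NB] : exists2 N : nat, (0 < N)%N & forall i, sg i / (2 * n.+1%:R * e i) <= N%:R.
  exists (\max_i (Num.truncn (sg i / (2 * n.+1%:R * e i))).+1)%N.
    by apply: leq_trans (leq_bigmax ord0).
  move=> i; apply/ltW/(lt_le_trans (truncnS_gt _)).
  by rewrite ler_nat; exact: (leq_bigmax i).
have NR : 0 < N%:R :> R by rewrite ltr0n.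
(* On the event each of the [n.+1] summands of [a j w] is at most
   [N * tau i * e i = 1 / (2 * n.+1)], so every phase is at most [1 / 2]. *)
pose tau i := (2 * n.+1%:R * N%:R * e i)^-1.
have tau0 i : 0 < tau i by rewrite invr_gt0 !mulr_gt0.
pose J := {ffun 'I_n.+1 -> 'I_N}.
pose a (j : J) w := \sum_i (j i)%:R * tau i * (V i w + x i).
pose A := [set w | forall i, `|V i w + x i| <= e i].
have mA : measurable A.
  rewrite (_ : A = \bigcap_(i in [set: 'I_n.+1]) [set w | `|V i w + x i| <= e i]); last first.
    by apply/seteqP; split=> w /= H i; [move=> _; exact: H|exact: H].
  apply: fin_bigcap_measurable => // i _.
  rewrite (_ : [set w | _] = (fun w => `|V i w + x i|) @^-1` `]-oo, e i]%classic); last first.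
    by apply/seteqP; split=> w /=; rewrite in_itv.
  rewrite -[X in measurable X]setTI.
  have m1 : measurable_fun [set: T] (fun w => `|V i w + x i|).
    by apply: measurableT_comp => //; apply: measurable_funD.
  exact: m1.
pose c (j k : J) := \sum_i ((j i)%:R - (k i)%:R) * tau i * x i.
pose q i (j k : nat) := expR (- ((sg i * tau i * (j%:R - k%:R)) ^+ 2 / 2)).
have term (j k : J) : P.-integrable [set: T] (fun w => (cos (a j w - a k w))%:E) /\
    \int[P]_w cos (a j w - a k w) <= \prod_i q i (j i) (k i).
  have [s L sE] := law (fun i => ((j i)%:R - (k i)%:R) * tau i).
  have E w : a j w - a k w = \sum_i ((j i)%:R - (k i)%:R) * tau i * V i w - 0 + c j k.
    rewrite subr0 /a /c -sumrB -big_split /=; apply: eq_bigr => i _; ring.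
  have [i1 e1] := normal_law_cos L (c j k).
  split; first by apply: eq_integrable i1 => // w _; rewrite E.
  under eq_Rintegral do rewrite E.
  rewrite e1 -expR_sum.
  have -> : \sum_i - ((sg i * tau i * ((j i)%:R - (k i)%:R)) ^+ 2 / 2) = - (s ^+ 2 / 2).
    rewrite sE mulr_suml -sumrN; apply: eq_bigr => i _.
    by congr (- (_ ^+ 2 / 2)); ring.
  by rewrite ler_piMl ?expR_ge0 ?cos_le1.
have card : #|J|%:R = N%:R ^+ n.+1 :> R by rewrite card_ffun !card_ord natrX.
pose K w := \sum_(j : J) \sum_(k : J) cos (a j w - a k w).
have KE w : K w = (\sum_(j : J) cos (a j w)) ^+ 2 + (\sum_(j : J) sin (a j w)) ^+ 2.
  rewrite !expr2 !big_distrlr /= -big_split /=; apply: eq_bigr => j _.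
  by rewrite -big_split /=; apply: eq_bigr => k _; rewrite cosB.
have K0 w : 0 <= K w by rewrite KE addr_ge0 ?sqr_ge0.
pose c0 : R := cos (1 / 2).
have c00 : 0 < c0 := cos_half_gt0.
have KA w : A w -> (N%:R ^+ n.+1 * c0) ^+ 2 <= K w.
  move=> Aw; rewrite KE ler_wpDr ?sqr_ge0//.
  have : N%:R ^+ n.+1 * c0 <= \sum_(j : J) cos (a j w).
    rewrite -card mulr_natl -sumr_const; apply: ler_sum => j _.
    apply: cos_half_le; rewrite (le_trans (ler_norm_sum _ _ _))//.
    have -> : 1 / 2 = \sum_(i < n.+1) (2 * n.+1%:R)^-1 :> R.
      by rewrite sumr_const card_ord -mulr_natl; field.
    apply: ler_sum => i _; rewrite !normrM (ger0_norm (ltW (tau0 i))) normr_nat.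
    apply: (@le_trans _ _ (N%:R * tau i * e i)).
      rewrite ler_pM ?mulr_ge0 ?(ltW (tau0 i)) ?Aw// ler_wpM2r ?(ltW (tau0 i))//.
      by rewrite ler_nat ltnW.
    rewrite le_eqVlt; apply/orP; left; apply/eqP; rewrite /tau; field.
    by rewrite !gt_eqF ?e0.
  have : 0 <= N%:R ^+ n.+1 * c0 by rewrite mulr_ge0 ?exprn_ge0// ltW.
  by move=> h1 h2; rewrite lerXn2r// nnegrE// (le_trans h1).
have intK : P.-integrable [set: T] (fun w => (K w)%:E).
  rewrite /K; under eq_fun do rewrite -sumEFin.
  apply: integrable_sum => // j _; under eq_fun do rewrite -sumEFin.
  by apply: integrable_sum => // k _; have [] := term j k.
have EK : \int[P]_w K w <= N%:R ^+ n.+1 * \prod_i (16 * n.+1%:R * N%:R * (e i / sg i)).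
  have -> : \int[P]_w K w = \sum_(j : J) \sum_(k : J) \int[P]_w cos (a j w - a k w).
    apply: EFin_inj; rewrite /Rintegral fineK; last exact: integrable_fin_num.
    rewrite /K; under eq_integral do rewrite -sumEFin.
    rewrite integral_sum//; last first.
      move=> j; under eq_fun do rewrite -sumEFin.
      by apply: integrable_sum => // k _; have [] := term j k.
    rewrite -sumEFin; apply: eq_bigr => j _.
    under eq_integral do rewrite -sumEFin.
    rewrite integral_sum//; last by move=> k; have [] := term j k.
    rewrite -sumEFin; apply: eq_bigr => k _.
    by rewrite fineK//; apply: integrable_fin_num => //; have [] := term j k.
  rewrite -card mulr_natl -sumr_const; apply: ler_sum => j _.
  apply: (@le_trans _ _ (\sum_(k : J) \prod_i q i (j i) (k i))).
    by apply: ler_sum => k _; have [] := term j k.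
  rewrite -(bigA_distr_bigA (fun i (k : 'I_N) => q i (j i) k)).
  apply: ler_prod => i _; rewrite sumr_ge0 /= => [|k _]; last exact: expR_ge0.
  have -> : 16 * n.+1%:R * N%:R * (e i / sg i) = 8 / (sg i * tau i).
    by rewrite /tau; field; rewrite !gt_eqF ?sg0 ?e0.
  apply: discrete_gaussian_sum_le; rewrite mulr_gt0//=.
  rewrite /tau ler_pdivrMr ?mulr_gt0// mul1r.
  by have := NB i; rewrite ler_pdivrMr ?mulr_gt0// => /le_trans; apply; nra.
have B0 : 0 < (N%:R ^+ n.+1 * c0) ^+ 2 by rewrite exprn_gt0// mulr_gt0// exprn_gt0.
(* Markov's inequality for [K]; its powers of [N] cancel against those in [EK]. *)
have PA : (P A <= ((N%:R ^+ n.+1 * c0) ^- 2 * \int[P]_w K w)%:E)%E.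
  rewrite EFinM {1}/Rintegral fineK; last exact: integrable_fin_num.
  rewrite -integralZl// -[P A]mul1e -integral_cst// [leLHS]integral_mkcond.
  apply: ge0_le_integral => //.
  - by move=> w _; rewrite patchE; case: ifP => //= _; rewrite lee_fin.
  - by apply/(measurable_restrictT _ _).1.
  - by apply: emeasurable_funM => //; exact: measurable_int intK.
  move=> w _; rewrite patchE; case: ifPn => [/set_mem Aw|_] /=.
    by rewrite -EFinM lee_fin mulrC ler_pdivlMr// mul1r KA.
  by rewrite -EFinM lee_fin mulr_ge0// invr_ge0 ltW.
apply: le_trans PA _; rewrite lee_fin.
apply: le_trans (ler_wpM2l _ EK) _; first by rewrite invr_ge0 ltW.
rewrite big_split /= prodr_const card_ord.
have -> : (16 * n.+1%:R * N%:R) ^+ n.+1 = (16 * n.+1%:R) ^+ n.+1 * N%:R ^+ n.+1 :> R.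
  by rewrite exprMn.
rewrite le_eqVlt; apply/orP; left; apply/eqP; rewrite -/c0.
set X := N%:R ^+ n.+1; set Y := (_ ^+ n.+1); set Z := \prod_i _.
have X0 : X != 0 by rewrite expf_neq0// gt_eqF.
by field; rewrite X0 gt_eqF.
Qed.

End GaussianSmallBall.

(** * Laws of the normalized values and increments *)

Section LocalLaw.
Context {R : realType} d (T : measurableType d) (P : probability T R).

Lemma conjcM (u v : R[i]) : conjc (u * v) = conjc u * conjc v.
Proof. exact: rmorphM. Qed.

Lemma conjcD (u v : R[i]) : conjc (u + v) = conjc u + conjc v.
Proof. exact: rmorphD. Qed.

Lemma conjcN (u : R[i]) : conjc (- u) = - conjc u.
Proof. exact: rmorphN. Qed.

Lemma normal_law_tail_le (Y : T -> R) (s v r : R) : has_normal_law P Y 0 s ->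
  s ^+ 2 <= v -> 0 < v -> 0 < r ->
  (P [set w | (r < `|Y w|)%R] <= (2 * expR (- (r ^+ 2 / (4 * v))))%:E)%E.
Proof.
move=> L sv v0 r0; have [s0|s0] := eqVneq s 0; last first.
  apply: le_trans (normal_law_tail L erefl s0 r0) _.
  have s2 : 0 < s ^+ 2 by rewrite exprn_even_gt0.
  rewrite lee_fin ler_wpM2l// ler_expR lerN2 ler_wpM2l ?sqr_ge0//.
  have h1 : 0 < 4 * s ^+ 2 by lra.
  have h2 : 0 < 4 * v by lra.
  by rewrite lef_pV2 ?posrE//; lra.
have [mY PY] := L.
have mA : measurable [set x : R | r < `|x|].
  rewrite (_ : [set _ | _] = (fun x : R => `|x|) @^-1` `]r, +oo[%classic).
    rewrite -[X in measurable X]setTI.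
    by apply: (@measurableT_comp _ _ _ _ _ _ (fun x : R => `|x|) _ id).
  by apply/seteqP; split=> x /=; rewrite in_itv/= andbT.
have -> : [set w | r < `|Y w|] = Y @^-1` [set x : R | r < `|x|] by [].
rewrite PY// s0 eqxx /dirac indicE memNset/=; last first.
  by rewrite normr0 => /(lt_trans r0); rewrite ltxx.
by rewrite lee_fin mulr_ge0 ?expR_ge0.
Qed.

Lemma measurable_le_fun (f : T -> R) (e : R) : measurable_fun [set: T] f ->
  measurable [set w | f w <= e].
Proof.
move=> mf; rewrite (_ : [set w | _] = f @^-1` `]-oo, e]%classic).
  by rewrite -[X in measurable X]setTI; exact: mf.
by apply/seteqP; split=> w /=; rewrite in_itv.
Qed.

Lemma measurable_normc (W : T -> R[i]) :
  measurable_fun [set: T] (fun w => complex.Re (W w)) ->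
  measurable_fun [set: T] (fun w => complex.Im (W w)) ->
  measurable_fun [set: T] (fun w => normc (W w)).
Proof.
move=> mR mI.
rewrite (_ : (fun w => _) = (fun w => Num.sqrt (complex.Re (W w) ^+ 2 + complex.Im (W w) ^+ 2))).
  apply: measurableT_comp; first exact: (continuous_measurable_fun (@sqrt_continuous R)).
  by apply: measurable_funD; apply: measurable_funX.
by apply/funext => w; case: (W w).
Qed.

Lemma measurable_gt_normc (W : T -> R[i]) (r : R) :
  measurable_fun [set: T] (fun w => complex.Re (W w)) ->
  measurable_fun [set: T] (fun w => complex.Im (W w)) ->
  measurable [set w | r < normc (W w)].
Proof.
move=> mR mI.
rewrite (_ : [set w | _] = (fun w => normc (W w)) @^-1` `]r, +oo[%classic).
  by rewrite -[X in measurable X]setTI; apply: measurable_normc.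
by apply/seteqP; split=> x /=; rewrite in_itv/= andbT.
Qed.

Lemma complex_normal_tail (W : T -> R[i]) (s s' v r : R) :
  has_normal_law P (fun w => complex.Re (W w)) 0 s ->
  has_normal_law P (fun w => complex.Im (W w)) 0 s' ->
  2 * s ^+ 2 <= v -> 2 * s' ^+ 2 <= v -> 0 < v -> 0 < r ->
  (P [set w | (r < normc (W w))%R] <= (4 * expR (- (r ^+ 2 / (8 * v))))%:E)%E.
Proof.
move=> L L' sv sv' v0 r0.
have r2 : 0 < r / 2 by rewrite divr_gt0.
have v2 : 0 < v / 2 by rewrite divr_gt0.
have [mR _] := L; have [mI _] := L'.
have mA (Y : T -> R) : measurable_fun [set: T] Y -> measurable [set w | r / 2 < `|Y w|].
  move=> mY; rewrite (_ : [set w | _] = (fun w => `|Y w|) @^-1` `]r / 2, +oo[%classic).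
    rewrite -[X in measurable X]setTI.
    have : measurable_fun [set: T] (fun w => `|Y w|) by exact: measurableT_comp.
    exact.
  by apply/seteqP; split=> x /=; rewrite in_itv/= andbT.
apply: (@le_trans _ _ (P ([set w | (r / 2 < `|complex.Re (W w)|)%R] `|`
    [set w | (r / 2 < `|complex.Im (W w)|)%R]))).
  apply: le_measure; rewrite ?inE.
  - exact: measurable_gt_normc.
  - by apply: measurableU; exact: mA.
  move=> w /= rW; have := normc_le_ReIm (W w).
  have [h1|h1] := ltrP (r / 2) `|complex.Re (W w)|; first by left.
  by move=> h2; right; lra.
apply: le_trans (measureU2 _ _ _) _; [exact: mA|exact: mA|].
have E : 4 * expR (- (r ^+ 2 / (8 * v))) =
    2 * expR (- ((r / 2) ^+ 2 / (4 * (v / 2)))) + 2 * expR (- ((r / 2) ^+ 2 / (4 * (v / 2)))).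
  rewrite (_ : (r / 2) ^+ 2 / (4 * (v / 2)) = r ^+ 2 / (8 * v)); last by field; rewrite gt_eqF.
  ring.
rewrite E EFinD leeD//; apply: normal_law_tail_le; try exact: L; try exact: L'; lra.
Qed.

Variable F0 : T -> R[i] -> R[i].
Hypothesis F0_gauss : gaussian_entire_function P F0.

(** The value at 0 of the translate of [F0] to [z], and, next, its increment from 0 to [h]. The
    normalization makes their laws independent of [z]. *)
Definition fock_value z w := (weight z)%:C * F0 w z.
Definition fock_increment z h w :=
  (weight z)%:C * (cexp (- (h * conjc z)) * F0 w (z + h) - F0 w z).

(** The translate at [z] has again the covariance kernel [cexp (u * conjc v)]; its covariance
    between 0 and any point is 1, so value and increment are uncorrelated and no cross term in [a]
    and [b] remains. *)
Lemma fock_pair_law (z h a b : R[i]) : exists2 s : R,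
  has_normal_law P (fun w => complex.Re (a * fock_value z w + b * fock_increment z h w)) 0 s &
  2 * s ^+ 2 = normc a ^+ 2 + normc b ^+ 2 * (expR (normc h ^+ 2) - 1).
Proof.
pose al := (weight z)%:C * (a - b).
pose be := (weight z)%:C * (b * cexp (- (h * conjc z))).
have [s L sE] := gaussian_pair_law F0_gauss z (z + h) al be.
exists s.
  rewrite (_ : (fun w => _) = (fun w => complex.Re (al * F0 w z + be * F0 w (z + h))))//.
  apply/funext => w; congr complex.Re; rewrite /al /be /fock_value /fock_increment; ring.
rewrite sE {sE L}; set W := weight z in al be *.
have W2 : W ^+ 2 * expR (normc z ^+ 2) = 1.
  by rewrite /W /weight -expRM_natl -expRD -[RHS]expR0; congr expR; field.
clearbody W.
have nal : normc al ^+ 2 * expR (normc z ^+ 2) = normc (a - b) ^+ 2.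
  by rewrite /al normcM normc_real exprMn real_normK ?num_real// mulrAC W2 mul1r.
have nzh : normc (z + h) ^+ 2 = normc z ^+ 2 + 2 * complex.Re (h * conjc z) + normc h ^+ 2.
  by rewrite !sqr_normc2 ReD ImD; clear; case: z h => x y [x' y'] /=; ring.
have nbe : normc be ^+ 2 * expR (normc (z + h) ^+ 2) = normc b ^+ 2 * expR (normc h ^+ 2).
  rewrite /be !normcM normc_real !exprMn real_normK ?num_real// normc_cexp -expRM_natl.
  rewrite nzh !expRD.
  have -> : complex.Re (- (h * conjc z)) = - complex.Re (h * conjc z) by case: (h * conjc z).
  transitivity (W ^+ 2 * expR (normc z ^+ 2) * (expR (2 * - complex.Re (h * conjc z)) * expR (2 * complex.Re (h * conjc z))) * (normc b ^+ 2 * expR (normc h ^+ 2))); first by ring.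
  by rewrite W2 -expRD mulrN addNr expR0 !mul1r.
have cr : al * conjc be * cexp (z * conjc (z + h)) = (a - b) * conjc b.
  rewrite /al /be !conjcM conjc_cexp.
  rewrite (_ : z * conjc (z + h) = (normc z ^+ 2)%:C + z * conjc h); last first.
    rewrite conjcD mulrDr; congr (_ + _); apply: complexP; rewrite sqr_normc2; case: (z) => x y /=; ring.
  rewrite (_ : conjc (- (h * conjc z)) = - (z * conjc h)); last first.
    by rewrite conjcN conjcM conjcK mulrC.
  rewrite cexpD cexp_real.
  transitivity ((W ^+ 2 * expR (normc z ^+ 2))%:C * (cexp (- (z * conjc h)) * cexp (z * conjc h)) * ((a - b) * conjc b)).
    by rewrite conjc_real rmorphM rmorphXn /=; ring.
  by rewrite W2 -cexpD addNr cexp0 !mul1r.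
rewrite nal nbe cr !sqr_normc2.
by case: (a) (b) => x y [x' y'] /=; ring.
Qed.

Lemma measurable_fock_value z :
  measurable_fun [set: T] (fun w => complex.Re (fock_value z w)) /\
  measurable_fun [set: T] (fun w => complex.Im (fock_value z w)).
Proof.
have [s [m1 _] _] := fock_pair_law z 0 1 0; have [s' [m2 _] _] := fock_pair_law z 0 (- 'i) 0.
split; [move: m1|move: m2]; congr measurable_fun; apply/funext => w.
  by rewrite mul0r addr0 mul1r.
by rewrite mul0r addr0 ReM /=; ring.
Qed.

Lemma measurable_fock_increment z h :
  measurable_fun [set: T] (fun w => complex.Re (fock_increment z h w)) /\
  measurable_fun [set: T] (fun w => complex.Im (fock_increment z h w)).
Proof.
have [s [m1 _] _] := fock_pair_law z h 0 1; have [s' [m2 _] _] := fock_pair_law z h 0 (- 'i).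
split; [move: m1|move: m2]; congr measurable_fun; apply/funext => w.
  by rewrite mul0r add0r mul1r.
by rewrite mul0r add0r ReM /=; ring.
Qed.

Lemma normc_Ni : normc (- 'i) = 1 :> R.
Proof. by rewrite /= oppr0 expr0n sqrrN expr1n add0r sqrtr1. Qed.

Lemma fock_value_tail z (r : R) : 0 < r ->
  (P [set w | (r < normc (fock_value z w))%R] <= (4 * expR (- (r ^+ 2 / 8)))%:E)%E.
Proof.
move=> r0; have [s L sE] := fock_pair_law z 0 1 0.
have [s' L' sE'] := fock_pair_law z 0 (- 'i) 0.
rewrite -[8]mulr1; apply: (@complex_normal_tail _ s s' 1 r _ _ _ _ ltr01 r0).
- by congr (has_normal_law P _ 0 s): L; apply/funext => w; rewrite mul0r addr0 mul1r.
- congr (has_normal_law P _ 0 s'): L'; apply/funext => w.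
  by rewrite mul0r addr0 ReM /=; ring.
- by rewrite sE normc1 normc0 expr0n mul0r addr0 expr1n.
- by rewrite sE' normc_Ni normc0 expr0n mul0r addr0 expr1n.
Qed.

Lemma fock_increment_tail z h (v r : R) : 0 < r -> 0 < v ->
  expR (normc h ^+ 2) - 1 <= v ->
  (P [set w | (r < normc (fock_increment z h w))%R] <= (4 * expR (- (r ^+ 2 / (8 * v))))%:E)%E.
Proof.
move=> r0 v0 hv; have [s L sE] := fock_pair_law z h 0 1.
have [s' L' sE'] := fock_pair_law z h 0 (- 'i).
apply: (@complex_normal_tail _ s s' v r _ _ _ _ v0 r0).
- by congr (has_normal_law P _ 0 s): L; apply/funext => w; rewrite mul0r add0r mul1r.
- congr (has_normal_law P _ 0 s'): L'; apply/funext => w.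
  by rewrite mul0r add0r ReM /=; ring.
- by rewrite sE normc1 normc0 expr0n add0r expr1n mul1r.
- by rewrite sE' normc_Ni normc0 expr0n add0r expr1n mul1r.
Qed.

Lemma measurable_small_ball z h x y (e e' : R) :
  measurable [set w | normc (fock_value z w + x) <= e /\
                      normc (fock_increment z h w + y) <= e'].
Proof.
have [m1 m2] := measurable_fock_value z; have [m3 m4] := measurable_fock_increment z h.
apply: (measurableI [set w | normc (fock_value z w + x) <= e]
  [set w | normc (fock_increment z h w + y) <= e']); apply: measurable_le_fun;
  apply: measurable_normc; under eq_fun do rewrite ?ReD ?ImD; exact: measurable_funD.
Qed.

(** The constant of [gaussian_small_ball] for four real variables; the last factor 4 arises because
    each real component carries half of the complex variance. *)
Definition small_ball_constant : R := (16 * 4%:R) ^+ 4 / cos (1 / 2) ^+ 2 * 4.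

Lemma small_ball_constant_gt0 : 0 < small_ball_constant.
Proof. by rewrite mulr_gt0// divr_gt0 ?exprn_gt0 ?mulr_gt0 ?cos_half_gt0. Qed.

(** The discs are enclosed in squares, which reduces the event to four real components with
    deviations [sqrt (1 / 2)] and [sqrt (v / 2)], each twice; finally [v >= normc h ^ 2]. The shifts
    [x] and [y] will carry the deterministic part [F1]. *)
Lemma fock_small_ball z h x y (e e' : R) : h != 0 -> 0 < e -> 0 < e' ->
  (P [set w | (normc (fock_value z w + x) <= e)%R /\
              (normc (fock_increment z h w + y) <= e')%R] <=
   (small_ball_constant * (e ^+ 2 * e' ^+ 2 / normc h ^+ 2))%:E)%E.
Proof.
pose C0 : R := (16 * 4%:R) ^+ 4 / cos (1 / 2) ^+ 2.
have C00 : 0 < C0 by rewrite divr_gt0 ?exprn_gt0 ?mulr_gt0 ?cos_half_gt0.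
rewrite /small_ball_constant -/C0 => h0 e0 e'0.
pose V (i : 'I_4) (w : T) := nth 0 [:: complex.Re (fock_value z w); complex.Im (fock_value z w);
   complex.Re (fock_increment z h w); complex.Im (fock_increment z h w)] i.
have nh : 0 < normc h ^+ 2.
  by rewrite exprn_gt0// lt_def normc_ge0 andbT; apply: contra h0 => /eqP/eq0_normc ->.
pose v := expR (normc h ^+ 2) - 1.
have vh : normc h ^+ 2 <= v by rewrite /v; have := expR_ge1Dx (normc h ^+ 2); lra.
have v0 : 0 < v by lra.
pose sg (i : 'I_4) : R := nth 0 [:: Num.sqrt (1 / 2); Num.sqrt (1 / 2);
   Num.sqrt (v / 2); Num.sqrt (v / 2)] i.
pose xx (i : 'I_4) : R := nth 0 [:: complex.Re x; complex.Im x; complex.Re y; complex.Im y] i.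
pose ee (i : 'I_4) : R := nth 0 [:: e; e; e'; e'] i.
have all4 (Q : 'I_4 -> Prop) : Q (inord 0) -> Q (inord 1) -> Q (inord 2) -> Q (inord 3) -> forall i, Q i.
  move=> q0 q1 q2 q3 [[|[|[|[|//]]]] p]; [move: q0|move: q1|move: q2|move: q3];
  by congr Q; apply: val_inj; rewrite /= inordK.
have sum4 (f : 'I_4 -> R) : \sum_i f i = f (inord 0) + f (inord 1) + f (inord 2) + f (inord 3).
  rewrite !big_ord_recr big_ord0 /= add0r; congr (f _ + f _ + f _ + f _);
  by apply: val_inj; rewrite /= inordK.
have prod4 (f : 'I_4 -> R) : \prod_i f i = f (inord 0) * f (inord 1) * f (inord 2) * f (inord 3).
  rewrite !big_ord_recr big_ord0 /= mul1r; congr (f _ * f _ * f _ * f _);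
  by apply: val_inj; rewrite /= inordK.
have [m1 m2] := measurable_fock_value z; have [m3 m4] := measurable_fock_increment z h.
have mV i : measurable_fun [set: T] (V i).
  by move: i; apply: all4; rewrite /V inordK.
have := @gaussian_small_ball _ _ _ P 3 V sg xx ee.
move=> /(_ _ _ mV _)/wrap[].
- by apply: all4; rewrite /sg inordK//= sqrtr_gt0 divr_gt0.
- by apply: all4; rewrite /ee inordK.
(* Conjugate coefficients, because the real part of [(p - i q) * (x + i y)] is [p * x + q * y]. *)
- move=> u; have [s L sE] := fock_pair_law z h (u (inord 0) -i* u (inord 1)) (u (inord 2) -i* u (inord 3)).
  exists s.
    congr (has_normal_law P _ 0 s): L; apply/funext => w.
    by rewrite sum4 /V !inordK//= ReD !ReM /=; ring.
  have sq (t : R) : 0 < t -> (Num.sqrt t) ^+ 2 = t by move=> t0; rewrite sqr_sqrtr// ltW.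
  rewrite sum4 /sg !inordK//= !exprMn !sq ?divr_gt0//.
  have h2 : (2 : R) != 0 by rewrite pnatr_eq0.
  by apply: (mulfI h2); rewrite sE -/v !sqr_normc2 /=; field.
move=> H; apply: le_trans (le_trans H _).
  apply: le_measure; rewrite ?inE.
  - exact: measurable_small_ball.
  - rewrite (_ : [set w | _] = \bigcap_(i in [set: 'I_4]) [set w | `|V i w + xx i| <= ee i]); last first.
      by apply/seteqP; split=> w /= H' i; [move=> _; exact: H'|exact: H'].
    apply: fin_bigcap_measurable => // i _.
    by apply: measurable_le_fun; apply: measurableT_comp => //; apply: measurable_funD.
  move=> w /= [h1 h2]; apply: all4; rewrite /V /xx /ee inordK//= -?ReD -?ImD.
  - exact: le_trans (Re_le_normc _) h1.
  - exact: le_trans (Im_le_normc _) h1.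
  - exact: le_trans (Re_le_normc _) h2.
  - exact: le_trans (Im_le_normc _) h2.
rewrite lee_fin prod4 /ee /sg !inordK//= -/C0 -[leRHS]mulrA ler_wpM2l ?(ltW C00)//.
have sq (t : R) : 0 < t -> (Num.sqrt t)^-1 * (Num.sqrt t)^-1 = t^-1.
  by move=> t0; rewrite -invfM -expr2 sqr_sqrtr// ltW.
rewrite (_ : _ * _ * _ * _ = e ^+ 2 * e' ^+ 2 * (((Num.sqrt (1 / 2))^-1 * (Num.sqrt (1 / 2))^-1) *
  ((Num.sqrt (v / 2))^-1 * (Num.sqrt (v / 2))^-1))); last by ring.
rewrite !sq ?divr_gt0//.
rewrite (_ : _ * _ = 4 * (e ^+ 2 * e' ^+ 2 * v^-1)); last by field; rewrite gt_eqF.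
have Q0 : 0 <= e ^+ 2 * e' ^+ 2 := mulr_ge0 (sqr_ge0 e) (sqr_ge0 e').
by rewrite ler_wpM2l// ler_wpM2l// lef_pV2 ?posrE.
Qed.

End LocalLaw.

(** * Selected points and zeros *)

Section LocalNewton.
Context {R : realType}.
Implicit Types (f T : R[i] -> R[i]) (z w b h : R[i]).

(* With [p], [q] the real and imaginary parts of [conj a * b], each of the four
   numbers [+- 4 d p], [+- 4 d q] is at least [X], while [p^2 + q^2 = |a|^2 |b|^2];
   hence [16 d^2 |a|^2 |b|^2 <= 2 X^2]. *)
Lemma four_directions (a1 a2 b1 b2 d : R) :
  let S := a1 ^+ 2 + a2 ^+ 2 in
  0 < S -> d ^+ 2 * (b1 ^+ 2 + b2 ^+ 2) <= S ->
  39 / 10 * S <= (a1 + 2 * d * b1) ^+ 2 + (a2 + 2 * d * b2) ^+ 2 ->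
  39 / 10 * S <= (a1 - 2 * d * b1) ^+ 2 + (a2 - 2 * d * b2) ^+ 2 ->
  39 / 10 * S <= (a1 - 2 * d * b2) ^+ 2 + (a2 + 2 * d * b1) ^+ 2 ->
  39 / 10 * S <= (a1 + 2 * d * b2) ^+ 2 + (a2 - 2 * d * b1) ^+ 2 -> False.
Proof.
move=> S; set t := d ^+ 2 * _ => S0 tS s1 s2 s3 s4.
pose X := 29 / 10 * S - 4 * t.
pose p := 4 * d * (a1 * b1 + a2 * b2); pose q := 4 * d * (a1 * b2 - a2 * b1).
have x1 : X <= p by rewrite /X /p /t; move: s1; rewrite /S; lra.
have x2 : X <= - p by rewrite /X /p /t; move: s2; rewrite /S; lra.
have x3 : X <= - q by rewrite /X /q /t; move: s3; rewrite /S; lra.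
have x4 : X <= q by rewrite /X /q /t; move: s4; rewrite /S; lra.
have pq : p ^+ 2 + q ^+ 2 = 16 * (t * S) by rewrite /p /q /t /S; ring.
have XE : X = 29 / 10 * S - 4 * t by [].
move: {s1 s2 s3 s4} S p q t X S0 tS x1 x2 x3 x4 pq XE => S p q t X.
move=> S0 tS x1 x2 x3 x4 pq XE.
have y1 : 0 <= (p - X) * (- p - X) by rewrite mulr_ge0// subr_ge0.
have y2 : 0 <= (q - X) * (- q - X) by rewrite mulr_ge0// subr_ge0.
have y : 16 * (t * S) <= 2 * X ^+ 2 by lra.
have X0 : X <= 0 by lra.
have y3 : 0 <= (- X) * (11 / 10 * S + X) by rewrite mulr_ge0//; lra.
have y4 : 0 <= S * (4 * t - 29 / 10 * S) by rewrite mulr_ge0//; lra.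
have y5 : 0 <= S * (11 / 10 * S + X) by rewrite mulr_ge0//; lra.
have y6 : 0 < S * S by rewrite mulr_gt0.
lra.
Qed.

(** Banach's fixed point theorem on a disc. The iterates from 0 move by at most [2 * r / 2 ^ n], and
    their limit is found one coordinate at a time by [nested_intervals]. *)
Lemma complex_contraction T (r : R) : 0 <= r ->
  (forall z, normc z <= r -> normc (T z) <= r) ->
  (forall z w, normc z <= r -> normc w <= r -> normc (T z - T w) <= normc (z - w) / 2) ->
  exists2 z, normc z <= r & T z = z.
Proof.
move=> r0 Tr Tc.
pose s n := iter n T 0.
have sr n : normc (s n) <= r.
  by elim: n => [|n IH]; [rewrite (_ : s 0%N = 0) ?normc0|exact: Tr].
have ss n : normc (s n.+1 - s n) <= 2 * r / 2 ^+ n.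
  elim: n => [|n IH].
    by rewrite expr0 divr1 (le_trans (le_normcB _ _))//; have := sr 1%N; have := sr 0%N; lra.
  have /le_trans := Tc _ _ (sr n.+1) (sr n); apply.
  by rewrite exprS invfM mulrCA mulrC ler_wpM2l// invr_ge0.
have lim (p : R[i] -> R) : (forall z w, p (z - w) = p z - p w) ->
    (forall z, `|p z| <= normc z) -> exists l, forall n, `|p (s n) - l| <= 4 * r / 2 ^+ n.
  move=> pB pn.
  have E n : 4 * r / 2 ^+ n = 2 * (4 * r / 2 ^+ n.+1).
    by rewrite exprS; field; rewrite expf_neq0.
  (* The intervals are centred at the iterates with radius [4 * r / 2 ^ n], the sum of all remaining
     moves. *)
  have [|n|l Hl] := @nested_intervals R (fun n => p (s n) - 4 * r / 2 ^+ n) (8 * r).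
  - by rewrite mulr_ge0.
  - have := le_trans (pn _) (ss n); rewrite pB ler_norml => /andP[h1 h2].
    have E' : 2 * r / 2 ^+ n = 4 * r / 2 ^+ n.+1 by rewrite exprS; field; rewrite expf_neq0.
    have E3 : 8 * r / 2 ^+ n.+1 = 2 * (4 * r / 2 ^+ n.+1) by ring.
    by move: h1 h2; rewrite E' E3 (E n); move: (_ / 2 ^+ n.+1) => t h1 h2; apply/andP; split; lra.
  - exists l => n; have /andP[h1 h2] := Hl n.
    have E3 : 8 * r / 2 ^+ n = 2 * (4 * r / 2 ^+ n) by ring.
    by move: h1 h2; rewrite E3; move: (4 * r / 2 ^+ n) => t h1 h2; rewrite ler_norml; apply/andP; split; lra.
have [x Hx] := lim _ (@ReB R) (@Re_le_normc R).
have [y Hy] := lim _ (@ImB R) (@Im_le_normc R).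
pose z := x +i* y.
have sz n : normc (s n - z) <= 8 * r / 2 ^+ n.
  rewrite (le_trans (normc_le_ReIm _))// ReB ImB /=.
  have -> : 8 * r / 2 ^+ n = 4 * r / 2 ^+ n + 4 * r / 2 ^+ n by ring.
  by rewrite lerD.
have small (e : R) : 0 < e -> exists n, 8 * r / 2 ^+ n <= e.
  move=> e0; exists (Num.truncn (8 * r / e)).+1.
  rewrite ler_pdivrMr ?exprn_gt0// [leRHS]mulrC -ler_pdivrMr//.
  apply: ltW; apply: lt_trans (truncnS_gt _) _.
  by rewrite -natrX ltr_nat ltn_expl.
have zr : normc z <= r.
  apply/ler_addgt0Pr => e /small[n Hn].
  rewrite -[z](subrK (s n)) addrC (le_trans (le_normcD _ _))// lerD//.
  by rewrite normc_distC (le_trans (sz n)).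
exists z => //; apply/eqP; rewrite -subr_eq0; apply/eqP/eq0_normc/eqP.
rewrite eq_le normc_ge0 andbT; apply/ler_addgt0Pr => e e0; rewrite add0r.
have e2 : 0 < e / 2 by rewrite divr_gt0.
have [n Hn] := small _ e2.
rewrite -[T z](subrK (s n.+1)) -addrA (le_trans (le_normcD _ _))//.
have h1 : normc (T z - s n.+1) <= e / 2.
  apply: le_trans (Tc _ _ zr (sr n)) _; rewrite normc_distC.
  by have := sz n; have := normc_ge0 (s n - z); lra.
have h2 : normc (s n.+1 - z) <= e / 2.
  apply: le_trans (sz n.+1) _; apply: le_trans Hn.
  by rewrite ler_wpM2l ?mulr_ge0// lef_pV2 ?posrE ?exprn_gt0// ler_eXn2l// ltr1n.
lra.
Qed.

Variables (f : R[i] -> R[i]) (b : R[i]) (E dl : R).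
Hypotheses (E0 : 0 < E) (dl0 : 0 < dl) (dl1 : dl <= 1 / 48).
Hypothesis fb : forall (rho : R) z w, rho <= 1 / 4 -> normc z <= rho -> normc w <= rho ->
  normc (f z - f w - b * (z - w)) <= E * rho * normc (z - w).

Let fb_ub (rho : R) z w : rho <= 1 / 4 -> normc z <= rho -> normc w <= rho ->
  normc (f z - f w) <= (normc b + E * rho) * normc (z - w).
Proof.
move=> r4 zr wr; rewrite -[f z - f w](subrK (b * (z - w))) addrC.
by rewrite (le_trans (le_normcD _ _))// normcM mulrDl lerD// fb.
Qed.

Let fb_lb (rho : R) z w : rho <= 1 / 4 -> normc z <= rho -> normc w <= rho ->
  (normc b - E * rho) * normc (z - w) <= normc (f z - f w).
Proof.
move=> r4 zr wr; have := fb r4 zr wr.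
have := le_normc_dist (b * (z - w)) (f z - f w).
by rewrite normcM (normc_distC (b * _)) mulrBl => h1 h2; lra.
Qed.

(** As [12 * dl <= 1 / 4], on this disc [f] differs from the map of slope [b] by a function of
    Lipschitz constant [12 * E * dl < normc b], hence is injective there. *)
Lemma zero_unique z w : 12 * E * dl < normc b -> normc z <= 12 * dl ->
  normc w <= 12 * dl -> f z = 0 -> f w = 0 -> z = w.
Proof.
move: E0 dl0 dl1 => E1 d0 d1.
move=> bE zr wr fz fw; apply/eqP; rewrite -subr_eq0; apply/eqP/eq0_normc/eqP.
have r4 : 12 * dl <= 1 / 4 by lra.
have p : 0 < normc b - E * (12 * dl).
  by rewrite subr_gt0 (_ : E * (12 * dl) = 12 * E * dl)//; ring.
have := fb_lb r4 zr wr; rewrite fz fw subrr normc0 pmulr_rle0//.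
by move=> h; rewrite eq_le h normc_ge0.
Qed.

(** [2004 = 2 * 1000 + 4]: if [normc b < 1000 * E * dl], then [f] changes by at most
    [2 * dl * normc b + 4 * E * dl ^ 2] over a distance [2 * dl], and a selected point has
    [normc (f 0)] no larger than this change. Thus nondegeneracy forces a steep slope. *)
Hypothesis nondegenerate : ~ (normc (f 0) <= 2004 * E * dl ^+ 2 /\
  normc (f dl%:C - f 0) <= 2004 * E * dl ^+ 2).

Let normc_dl : normc dl%:C = dl.
Proof. by rewrite normc_real gtr0_norm. Qed.

Let fdl : normc (f dl%:C - f 0) <= (normc b + E * dl) * dl.
Proof.
move: E0 dl0 dl1 => E1 d0 d1.
have := @fb_ub dl dl%:C 0; rewrite normc0 subr0 normc_dl; apply => //; lra.
Qed.

(** In units of [normc b * dl], up to the remainder: [normc (f 0)] is at most [0.709], just above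
    [sqrt 2 / 2], and the increment at most 1, so the left side is at most [0.709 + 0.75]. The point
    [h] is at distance at least [3 / 2 * dl] from the zero, which puts the right side near [1.5];
    the weight costs at most [1 / 200]. *)
Lemma zero_selected z0 : f z0 = 0 -> normoo z0 <= dl / 2 ->
  1000 * E * dl <= normc b /\
  forall h, normoo h = 2 * dl ->
    normc (f 0) + Num.max (normc (f 0)) (3 / 4 * normc (f dl%:C - f 0)) <=
    expR (- (normc h ^+ 2 / 2)) * normc (f h).
Proof.
move: E0 dl0 dl1 => E1 d0 d1.
move=> fz0; rewrite /normoo ge_max => /andP[zx zy].
have nz0 : normc z0 <= 709 / 1000 * dl.
  apply: normc_le_sqr; first by lra.
  rewrite sqr_normc2 -[complex.Re z0 ^+ 2]real_normK ?num_real// -[complex.Im z0 ^+ 2]real_normK ?num_real//.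
  by have := normr_ge0 (complex.Re z0); have := normr_ge0 (complex.Im z0); nra.
have z01 : normc z0 <= dl by lra.
have f0 : normc (f 0) <= (normc b + E * dl) * (709 / 1000 * dl).
  have := @fb_ub dl 0 z0; rewrite fz0 subr0 sub0r normcN normc0.
  have d4 : dl <= 1 / 4 by lra.
  move=> /(_ d4 (ltW dl0) z01)/le_trans; apply; rewrite ler_wpM2l//.
  by have := normc_ge0 b; have := mulr_ge0 (ltW E0) (ltW dl0); lra.
have b0 := normc_ge0 b.
have bE : 1000 * E * dl <= normc b.
  rewrite leNgt; apply/negP => bE; apply: nondegenerate.
  have bd : normc b * dl <= 1000 * E * dl * dl by rewrite ler_wpM2r// ltW.
  split.
    apply: le_trans f0 _; nra.
  by apply: le_trans fdl _; nra.
split=> // h h2.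
have hn : normc h <= 3 * dl.
  apply: normc_le_sqr; first by lra.
  move: h2; rewrite /normoo sqr_normc2 -[complex.Re h ^+ 2]real_normK ?num_real//.
  rewrite -[complex.Im h ^+ 2]real_normK ?num_real// => h2.
  have hx : `|complex.Re h| <= 2 * dl by rewrite -h2 le_max lexx.
  have hy : `|complex.Im h| <= 2 * dl by rewrite -h2 le_max lexx orbT.
  by have := normr_ge0 (complex.Re h); have := normr_ge0 (complex.Im h); nra.
have hz : 3 / 2 * dl <= normc (h - z0).
  apply: le_trans (normoo_le_normc _).
  rewrite /normoo le_max ReB ImB; move: h2; rewrite /normoo => h2.
  have [hx|hy] : `|complex.Re h| = 2 * dl \/ `|complex.Im h| = 2 * dl.
  - by rewrite -h2; case: (lerP `|complex.Re h| `|complex.Im h|) => _; [right|left].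
  - by have := lerB_dist (complex.Re h) (complex.Re z0); rewrite hx => ?; apply/orP; left; lra.
  - by have := lerB_dist (complex.Im h) (complex.Im z0); rewrite hy => ?; apply/orP; right; lra.
have r4 : 3 * dl <= 1 / 4 by lra.
have z03 : normc z0 <= 3 * dl by lra.
have := fb_lb r4 hn z03; rewrite fz0 subr0 => fh.
have e1 : 199 / 200 <= expR (- (normc h ^+ 2 / 2)).
  apply: le_trans (expR_ge1Dx _).
  have : normc h ^+ 2 <= (3 * dl) ^+ 2 by rewrite lerXn2r// nnegrE ?normc_ge0//; lra.
  have : dl ^+ 2 <= (1 / 48) ^+ 2 by rewrite lerXn2r// nnegrE; lra.
  by rewrite exprMn; lra.
have bd : 1000 * (E * dl * dl) <= normc b * dl by nra.
have Edd : 0 < E * dl * dl by rewrite !mulr_gt0.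
have fh' : (normc b - E * (3 * dl)) * (3 / 2 * dl) <= normc (f h).
  apply: le_trans fh; rewrite ler_wpM2l//; nra.
have Fh : 199 / 200 * ((normc b - E * (3 * dl)) * (3 / 2 * dl)) <= expR (- (normc h ^+ 2 / 2)) * normc (f h).
  by rewrite ler_pM//; nra.
apply: le_trans Fh.
rewrite -lerBrDl ge_max; have fd := fdl; apply/andP; split; nra.
Qed.

(** The comparison in the four axis directions bounds [normc (f 0)] by [normc b * dl]. The
    simplified Newton map [z - f z / b] then sends 0 within [dl] of 0 and contracts by 500, so it
    preserves the disc of radius [3 / 2 * dl], and its fixed point is a zero. *)
Lemma selected_zero :
  (forall h, grid dl h -> normoo h = 2 * dl ->
     normc (f 0) + normc (f 0) <= normc (f h)) ->
  1000 * E * dl <= normc b /\ exists2 z, normc z <= 3 / 2 * dl & f z = 0.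
Proof.
move: E0 dl0 dl1 => E1 d0 d1.
move=> sel.
have b0 := normc_ge0 b.
have f00 := normc_ge0 (f 0).
have oo (x y : R) : normoo (x +i* y) = Num.max `|x| `|y| by [].
have gr (x y : R) (i j : int) : x = dl * i%:~R -> y = dl * j%:~R -> grid dl (x +i* y).
  by move=> -> ->; exists i, j.
have gp : 2 * dl = dl * 2%:Z%:~R by rewrite mulrC.
have gn : - (2 * dl) = dl * (- 2%:Z)%:~R by rewrite intrN mulrN mulrC.
have g0 : 0 = dl * 0%:Z%:~R by rewrite mulr0.
have n2 h : normc h = 2 * dl -> normc (f h - f 0 - b * h) <= 4 * E * dl ^+ 2.
  move=> hn; have := @fb (2 * dl) h 0; rewrite subr0 hn normc0.
  have r4 : 2 * dl <= 1 / 4 by lra.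
  move=> /(_ r4 (lexx _))/(_ _)/le_trans; apply; [lra|].
  by rewrite expr2; lra.
have bE : 1000 * E * dl <= normc b.
  rewrite leNgt; apply/negP => bE; apply: nondegenerate.
  have bd : normc b * dl <= 1000 * E * dl * dl by rewrite ler_wpM2r// ltW.
  split; last by apply: le_trans fdl _; nra.
  have hn : normc (2 * dl)%:C = 2 * dl by rewrite normc_real ger0_norm//; lra.
  have ho : normoo (2 * dl)%:C = 2 * dl.
    by rewrite oo normr0 ger0_norm; [apply/max_idPl; lra|lra].
  have := sel _ (gr _ _ _ _ gp g0) ho; have := n2 _ hn.
  have := le_normc_dist (f (2 * dl)%:C - f 0) (b * (2 * dl)%:C).
  have := le_normc_dist (f (2 * dl)%:C) (f 0).
  rewrite normcM hn; nra.
split=> //.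
have bpos : 0 < normc b by have := mulr_gt0 E0 dl0; nra.
(* Otherwise the remainder is negligible against [normc a], and replacing [f h] by [a + b * h]
   lowers the factor 2 only to [199 / 100]; its square exceeds the [39 / 10] that [four_directions]
   refutes. *)
have a_small : normc (f 0) <= normc b * dl.
  rewrite leNgt; apply/negP => ab.
  set a := f 0 in ab sel f00 n2 *.
  have four h : grid dl h -> normc h = 2 * dl -> normoo h = 2 * dl -> 199 / 100 * normc a <= normc (a + b * h).
    move=> hg hn ho; have := sel _ hg ho; have := n2 _ hn.
    have := le_normc_dist (f h) (f h - a - b * h).
    rewrite (_ : f h - (f h - a - b * h) = a + b * h); last by ring.
    have : 1000 * (E * dl ^+ 2) <= normc b * dl by rewrite expr2; nra.
    lra.
  have sq h : grid dl h -> normc h = 2 * dl -> normoo h = 2 * dl ->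
      39 / 10 * normc a ^+ 2 <= normc (a + b * h) ^+ 2.
    move=> hg hn ho; have h4 := four _ hg hn ho.
    apply: (@le_trans _ _ ((199 / 100 * normc a) ^+ 2)).
      by rewrite exprMn ler_wpM2r ?sqr_ge0//; lra.
    rewrite lerXn2r// nnegrE ?normc_ge0//.
    by apply: mulr_ge0; [lra|exact: normc_ge0].
  have nd : `|2 * dl| = 2 * dl by rewrite ger0_norm//; lra.
  have mx1 : Num.max (2 * dl) 0 = 2 * dl by apply/max_idPl; lra.
  have mx2 : Num.max 0 (2 * dl) = 2 * dl by apply/max_idPr; lra.
  have N1 (x : R) : normc (x +i* 0) = `|x| := normc_real x.
  have N2 (x : R) : normc (0 +i* x) = `|x| by rewrite /= expr0n add0r sqrtr_sqr.
  have s1 := sq ((2 * dl) +i* 0) (gr _ _ _ _ gp g0) _ _; rewrite N1 oo normr0 nd mx1 in s1.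
  have s2 := sq ((- (2 * dl)) +i* 0) (gr _ _ _ _ gn g0) _ _; rewrite N1 oo normrN normr0 nd mx1 in s2.
  have s3 := sq (0 +i* (2 * dl)) (gr _ _ _ _ g0 gp) _ _; rewrite N2 oo normr0 nd mx2 in s3.
  have s4 := sq (0 +i* (- (2 * dl))) (gr _ _ _ _ g0 gn) _ _; rewrite N2 oo normrN normr0 nd mx2 in s4.
  apply: (@four_directions (complex.Re a) (complex.Im a) (complex.Re b) (complex.Im b) dl).
  - by rewrite -sqr_normc2 exprn_gt0//; have := mulr_ge0 b0 (ltW dl0); lra.
  - rewrite -!sqr_normc2 -exprMn lerXn2r ?nnegrE ?normc_ge0//.
      by rewrite mulr_ge0 ?normc_ge0// ltW.
    by rewrite mulrC ltW.
  - rewrite -sqr_normc2; apply: le_trans (s1 erefl erefl) _.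
    by rewrite sqr_normc2 ReD ImD ReM ImM /=; rewrite le_eqVlt; apply/orP; left; apply/eqP; ring.
  - rewrite -sqr_normc2; apply: le_trans (s2 erefl erefl) _.
    by rewrite sqr_normc2 ReD ImD ReM ImM /=; rewrite le_eqVlt; apply/orP; left; apply/eqP; ring.
  - rewrite -sqr_normc2; apply: le_trans (s3 erefl erefl) _.
    by rewrite sqr_normc2 ReD ImD ReM ImM /=; rewrite le_eqVlt; apply/orP; left; apply/eqP; ring.
  - rewrite -sqr_normc2; apply: le_trans (s4 erefl erefl) _.
    by rewrite sqr_normc2 ReD ImD ReM ImM /=; rewrite le_eqVlt; apply/orP; left; apply/eqP; ring.
have bn0 : b != 0 by apply/eqP => b0'; move: bpos; rewrite b0' normc0 ltxx.
have r4 : 3 / 2 * dl <= 1 / 4 by lra.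
have ctr z w : normc z <= 3 / 2 * dl -> normc w <= 3 / 2 * dl ->
    normc ((z - f z / b) - (w - f w / b)) <= normc (z - w) / 500.
  move=> zr wr; have -> : (z - f z / b) - (w - f w / b) = - ((f z - f w - b * (z - w)) / b) by field.
  rewrite normcN normcM normcV ler_pdivrMr// (le_trans (fb r4 zr wr))//.
  have h : E * (3 / 2 * dl) <= normc b / 500 by move: bE; lra.
  by have := ler_wpM2r (normc_ge0 (z - w)) h; lra.
have [|z zr|z w zr wr|z zr Tz] := @complex_contraction (fun z => z - f z / b) (3 / 2 * dl).
- lra.
- have z0 : normc (0 : R[i]) <= 3 / 2 * dl by rewrite normc0; lra.
  have := ctr _ _ zr z0; rewrite sub0r subr0 opprK => h.
  have h' : normc (f 0 / b) <= dl by rewrite normcM normcV ler_pdivrMr// mulrC.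
  have -> : z - f z / b = (z - f z / b + f 0 / b) - f 0 / b by ring.
  rewrite (le_trans (le_normcB _ _))//; lra.
- by apply: le_trans (ctr _ _ zr wr) _; have := normc_ge0 (z - w); lra.
exists z => //; move/eqP: Tz; rewrite subr_eq addrC -subr_eq subrr eq_sym.
by rewrite mulf_eq0 invr_eq0 (negbTE bn0) orbF => /eqP.
Qed.

End LocalNewton.

(** * The algorithm off the exceptional event *)

Section AmnDeterministic.
Context {R : realType}.
Implicit Types (F : R[i] -> R[i]) (l z h : R[i]) (L dl M : R).

Definition fock_shift F l z := (weight l)%:C * (cexp (- (z * conjc l)) * F (l + z)).

(** Translation preserves the weighted modulus, so a bound on the latter near [l] becomes a bound on
    an ordinary entire function near 0, where Cauchy's estimates apply. *)
Lemma normc_fock_shift F l z : normc (fock_shift F l z) =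
  expR (normc z ^+ 2 / 2) * (weight (l + z) * normc (F (l + z))).
Proof.
rewrite /fock_shift !normcM normc_real normc_cexp ger0_norm ?expR_ge0//.
rewrite !mulrA; congr (_ * _); rewrite /weight -!expRD; congr expR.
by rewrite !sqr_normc2; case: l z => x y [x' y'] /=; field.
Qed.

Lemma fock_shift0 F l : fock_shift F l 0 = (weight l)%:C * F l.
Proof. by rewrite /fock_shift mul0r oppr0 cexp0 mul1r addr0. Qed.

Lemma normc_fock_shift0 F l : normc (fock_shift F l 0) = weight l * normc (F l).
Proof. by rewrite fock_shift0 normcM normc_real ger0_norm ?expR_ge0. Qed.

Lemma cdiff_fock_shift F l : (forall z, exists m, cdiff F z m) ->
  forall z, exists m, cdiff (fock_shift F l) z m.
Proof.
move=> dF z; have [m dm] := dF (l + z).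
have D1 := cdiffM (cdiff_cst (- conjc l) z) (cdiff_id z).
have D2 := cdiff_comp D1 (cdiff_cexp _).
have D3 := cdiff_comp (cdiffD (cdiff_cst l z) (cdiff_id z)) dm.
have := cdiffM (cdiff_cst (weight l)%:C z) (cdiffM D2 D3).
set m' := (X in cdiff _ _ X) => D; exists m'; apply: cdiff_ext D => y.
by rewrite /fock_shift /= mulNr (mulrC (conjc l)).
Qed.

Lemma normoo_le z (x : R) : (normoo z <= x) = (`|complex.Re z| <= x) && (`|complex.Im z| <= x).
Proof. by rewrite /normoo ge_max. Qed.

Lemma normooD z h : normoo (z + h) <= normoo z + normoo h.
Proof.
rewrite normoo_le ReD ImD; apply/andP; split; rewrite (le_trans (ler_normD _ _))//;
  by rewrite lerD// /normoo le_max lexx ?orbT.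
Qed.

Lemma normooN z : normoo (- z) = normoo z.
Proof. by case: z => x y; rewrite /normoo /= !normrN. Qed.

Lemma normoo_distC z h : normoo (z - h) = normoo (h - z).
Proof. by rewrite -normooN opprB. Qed.

Lemma normc_le_normoo z (x : R) : normoo z <= x -> normc z <= 3 / 2 * x.
Proof.
rewrite normoo_le => /andP[zx zy].
have x0 : 0 <= x := le_trans (normr_ge0 _) zx.
apply: normc_le_sqr; first by lra.
rewrite sqr_normc2 -[complex.Re z ^+ 2]real_normK ?num_real// -[complex.Im z ^+ 2]real_normK ?num_real//.
have : `|complex.Re z| ^+ 2 <= x ^+ 2 by rewrite lerXn2r// nnegrE.
have : `|complex.Im z| ^+ 2 <= x ^+ 2 by rewrite lerXn2r// nnegrE.
rewrite exprMn; have := sqr_ge0 x; lra.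
Qed.

Lemma OmegaP L z : Omega L z <-> normoo z <= L.
Proof. by rewrite normoo_le; split => [[-> ->]|/andP[]]. Qed.

(** Rounding to the nearest multiple does not leave the interval because its end [dl * n] is itself
    a multiple; this is where [L / delta] being a natural number matters for zeros close to the
    boundary. *)
Lemma nearest_multiple dl (n : nat) (x : R) : 0 < dl -> `|x| <= dl * n%:R ->
  exists k : int, `|x - dl * k%:~R| <= dl / 2 /\ `|dl * k%:~R| <= dl * n%:R.
Proof.
move=> dl0; rewrite ler_norml => /andP[x1 x2].
pose k := Num.floor (x / dl + 1 / 2); exists k.
have k1 : k%:~R <= x / dl + 1 / 2 by exact: floor_le_tmp.
have k2 : x / dl + 1 / 2 < k%:~R + 1 by rewrite -intrD1; exact: floorD1_gt.
have xE : x = dl * (x / dl) by field; rewrite gt_eqF.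
have q1 : x / dl <= n%:R by rewrite ler_pdivrMr// mulrC.
have q2 : - n%:R <= x / dl by rewrite ler_pdivlMr// mulNr mulrC.
split.
  rewrite {1}xE -mulrBr normrM gtr0_norm// ler_wpM2l ?(ltW dl0)// ler_norml.
  by apply/andP; split; lra.
rewrite normrM gtr0_norm// ler_wpM2l ?(ltW dl0)// ler_norml.
have kn : (k <= n%:Z)%R.
  by rewrite -ltzD1 -(ltr_int R) intrD; have -> : n%:Z%:~R = n%:R :> R by []; lra.
have nk : (- n%:Z <= k)%R.
  rewrite -ltzD1 -(ltr_int R) intrD intrN; have -> : n%:Z%:~R = n%:R :> R by []; lra.
apply/andP; split.
  by have := nk; rewrite -(ler_int R) intrN.
by have := kn; rewrite -(ler_int R).
Qed.

(** Each zero has a selected grid point within [dl / 2], each selected point a zero within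
    [3 / 2 * dl], and zeros are farther apart than the total displacement that sieving can cause. *)
Lemma amn_deterministic : exists2 K : R, 0 < K &
  forall L dl M F (Z : set R[i]),
  1 <= L -> 0 < dl -> dl <= 1 / 48 -> (exists n : nat, L / dl = n%:R) -> 0 < M ->
  (forall z, exists m, cdiff F z m) ->
  (forall z, Omega (L + 1) z -> weight z * normc (F z) <= M) ->
  (forall l, (grid dl `&` Omega L) l ->
     ~ (weight l * normc (F l) <= K * M * dl ^+ 2 /\
        weight l * normc (cexp (- (dl%:C * conjc l)) * F (l + dl%:C) - F l)
          <= K * M * dl ^+ 2)) ->
  amn_output L dl F Z ->
  exists Phi : R[i] -> R[i],
      [/\ set_fun (zero_set F `&` Omega L) Z Phi,
          set_inj (zero_set F `&` Omega L) Phi,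
          forall zeta, (zero_set F `&` Omega L) zeta ->
            normoo (Phi zeta - zeta) <= 2 * dl
        & forall lambda, (Z `&` Omega (L - 2 * dl)) lambda ->
            exists2 zeta, (zero_set F `&` Omega L) zeta &
              lambda = Phi zeta].
Proof.
have [K K0 remainder] := @second_order_remainder R.
have K20 : 0 < 2 * K by rewrite mulr_gt0.
exists (2004 * (2 * K)); first by apply: mulr_gt0 K20; rewrite ltr0n.
move=> L dl M F Z L1 dl0 dl1 [n Ln] M0 dF H1 H2 [Zsel Zsep Zmax].
pose E := 2 * K * M; have E0 : 0 < E by apply: mulr_gt0.
have Ec (c : R) : c * (2 * K) * M = c * E by rewrite /E !mulrA.
have {H2}nd0 : forall l, (grid dl `&` Omega L) l ->
     ~ (weight l * normc (F l) <= 2004 * E * dl ^+ 2 /\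
        weight l * normc (cexp (- (dl%:C * conjc l)) * F (l + dl%:C) - F l)
          <= 2004 * E * dl ^+ 2).
  by move=> l /H2; rewrite Ec.
pose f l := fock_shift F l.
have fzero l z : f l z = 0 <-> F (l + z) = 0.
  rewrite /f /fock_shift; split=> [/eqP|->]; last by rewrite !mulr0.
  rewrite !mulf_eq0 (negbTE (cexp_neq0 _)) -[_ == 0 :> R[i]]/((weight l)%:C == 0%:C).
  by rewrite (inj_eq (@complexI R)) gt_eqF ?expR_gt0//= => /eqP.
have f0E l : normc (f l 0) = weight l * normc (F l) := normc_fock_shift0 F l.
have fdE l : normc (f l dl%:C - f l 0) =
    weight l * normc (cexp (- (dl%:C * conjc l)) * F (l + dl%:C) - F l).
  rewrite /f fock_shift0 /fock_shift -mulrBr normcM normc_real.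
  by rewrite ger0_norm ?expR_ge0.
(* The unit disc around a point of [Omega L] stays in [Omega (L + 1)], and the growth of the
   translate there is at most [expR (1 / 2) <= 2]: hence the 2 in [E]. *)
have fM l z : Omega L l -> normc z <= 1 -> normc (f l z) <= 2 * M.
  move=> /OmegaP lL z1; rewrite normc_fock_shift; apply: ler_pM.
  - exact: expR_ge0.
  - by rewrite mulr_ge0 ?expR_ge0 ?normc_ge0.
  - have e2 : expR (1 / 2) <= 2 :> R.
      have := expR_ge1Dx (- (1 / 2) : R); have := expRxMexpNx_1 (1 / 2 : R).
      by have := expR_gt0 (1 / 2 : R); nra.
    apply: le_trans e2; rewrite ler_expR ler_wpM2r// expr_le1 ?normc_ge0//.
  - apply: H1; apply/OmegaP; apply: le_trans (normooD _ _) _; apply: lerD => //.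
    exact: le_trans (normoo_le_normc _) z1.
have fb l : Omega L l -> exists b, forall (rho : R) z w,
    rho <= 1 / 4 -> normc z <= rho -> normc w <= rho ->
    normc (f l z - f l w - b * (z - w)) <= E * rho * normc (z - w).
  move=> lL; have [b Hb] := remainder _ _ (cdiff_fock_shift l dF) (fun z => @fM l z lL).
  exists b => rho z w r4 zr wr; apply: le_trans (Hb _ _ _ r4 zr wr) _.
  by rewrite le_eqVlt; apply/orP; left; apply/eqP; rewrite /E; ring.
have nd l : (grid dl `&` Omega L) l -> ~ (normc (f l 0) <= 2004 * E * dl ^+ 2 /\
    normc (f l dl%:C - f l 0) <= 2004 * E * dl ^+ 2).
  by move=> lG; rewrite f0E fdE; exact: nd0.
have nearest z : Omega L z -> exists2 l, (grid dl `&` Omega L) l & normoo (z - l) <= dl / 2.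
  have LE : L = dl * n%:R by rewrite -Ln mulrC divfK// gt_eqF.
  case: z => x y [/= xL yL].
  have [k [k1 k2]] : exists k : int, `|x - dl * k%:~R| <= dl / 2 /\ `|dl * k%:~R| <= dl * n%:R.
    by apply: nearest_multiple => //; rewrite -LE.
  have [j [j1 j2]] : exists k : int, `|y - dl * k%:~R| <= dl / 2 /\ `|dl * k%:~R| <= dl * n%:R.
    by apply: nearest_multiple => //; rewrite -LE.
  exists ((dl * k%:~R) +i* (dl * j%:~R)).
    by split; [exists k, j|split; rewrite /= LE].
  by rewrite normoo_le /= k1 j1.
have marginE l : margin dl F l =
    Num.max (normc (f l 0)) (3 / 4 * normc (f l dl%:C - f l 0)).
  by rewrite /margin maxr_pMr ?expR_ge0// f0E fdE mulrCA.
have weightE l m : weight m * normc (F m) =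
    expR (- (normc (m - l) ^+ 2 / 2)) * normc (f l (m - l)).
  rewrite /f normc_fock_shift (addrC l) subrK mulrA -expRD addNr expR0 mul1r.
  by [].
have zero_sel l z0 : (grid dl `&` Omega L) l -> F (l + z0) = 0 -> normoo z0 <= dl / 2 ->
    amn_selected L dl F l /\ (forall z w, normc z <= 12 * dl -> normc w <= 12 * dl ->
      F (l + z) = 0 -> F (l + w) = 0 -> z = w).
  move=> lG /fzero fz z0d; have [b Hb] := fb l lG.2.
  have [bE sel] := zero_selected E0 dl0 dl1 Hb (nd l lG) fz z0d.
  split; last first.
    move=> z w zr wr /fzero fz' /fzero fw'.
    apply: (zero_unique E0 dl0 dl1 Hb _ zr wr fz' fw').
    by apply: lt_le_trans bE; have := mulr_gt0 E0 dl0; lra.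
  split=> // m _ lm; rewrite marginE -f0E (weightE l m); apply: sel.
  by rewrite normoo_distC.
have sel_zero l : amn_selected L dl F l ->
    exists2 zeta, F zeta = 0 & normoo (zeta - l) <= 2 * dl.
  move=> [lG sel]; have [b Hb] := fb l lG.2.
  have [|_ [z zr fz]] := selected_zero E0 dl0 dl1 Hb (nd l lG).
    move=> h [k [j hE]] hd.
    have gm : grid dl (l + h).
      have [[k' [j' ->]] _] := lG; exists (k' + k), (j' + j); rewrite hE.
      by apply: complexP; rewrite /= intrD mulrDr.
    have lh : normoo (l - (l + h)) = 2 * dl by rewrite opprD addNKr normooN.
    have := sel _ gm lh; rewrite marginE -f0E (weightE l (l + h)) [l + h]addrC addrK => s1.
    have s2 : expR (- (normc h ^+ 2 / 2)) * normc (f l h) <= normc (f l h).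
      rewrite ler_piMl ?normc_ge0// -expR0 ler_expR oppr_le0 divr_ge0//.
      by rewrite exprn_ge0// normc_ge0.
    apply: le_trans (le_trans s1 s2); rewrite lerD2l le_max lexx.
    by [].
  exists (l + z); first exact/fzero.
  rewrite addrC addKr (le_trans (normoo_le_normc _))//; lra.
(* [15 / 2 = 1 / 2 + 5 + 2]: from a zero to its grid point, across the sieve, and on to the zero of
   the retained point. Recentring at a grid point adds [1 / 2], and [8 * (3 / 2) = 12] is the
   Euclidean radius of uniqueness. *)
have zero_sep zeta zeta' : Omega L zeta -> F zeta = 0 -> F zeta' = 0 ->
    normoo (zeta - zeta') <= 15 / 2 * dl -> zeta = zeta'.
  move=> zL fz fz' zz; have [l lG lz] := nearest _ zL.
  have e1 : l + (zeta - l) = zeta by ring.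
  have e2 : l + (zeta' - l) = zeta' by ring.
  have [|_ uniq] := zero_sel l (zeta - l) lG _ lz; first by rewrite e1.
  rewrite -e1 -e2; congr (l + _); apply: uniq; rewrite ?e1 ?e2//.
    by apply: (le_trans (normc_le_normoo lz)); lra.
  have : normoo (zeta' - l) <= 8 * dl.
    have -> : zeta' - l = (zeta' - zeta) + (zeta - l) by ring.
    by rewrite (le_trans (normooD _ _))// normoo_distC; lra.
  by move=> /normc_le_normoo/le_trans; apply; lra.
have exists_sel zeta : Omega L zeta -> F zeta = 0 ->
    exists2 l, Z l & normoo (l - zeta) <= 2 * dl.
  move=> zL fz; have [l lG lz] := nearest _ zL.
  have [|lS _] := zero_sel l (zeta - l) lG _ lz; first by rewrite addrC subrK.
  have [Zl|nZl] := pselect (Z l).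
    by exists l => //; rewrite normoo_distC; lra.
  have sub : Z `<` Z `|` [set l].
    by split=> [x Zx|H]; [left|apply: nZl; apply: H; right].
  have subS : Z `|` [set l] `<=` amn_selected L dl F by move=> x [/Zsel|->].
  (* By maximality [l] cannot be added to [Z], so a retained point lies closer than [5 * dl]; its
     zero must then be [zeta] itself. *)
  have : exists2 l', Z l' & normoo (l - l') < 5 * dl.
    apply: contrapT => C; apply: (Zmax _ sub subS) => p q.
    have far x : Z x -> 5 * dl <= normoo (l - x).
      by move=> Zx; rewrite leNgt; apply/negP => lx; apply: C; exists x.
    move=> [Zp|->] [Zq|->] pq; first exact: Zsep.
    - by rewrite normoo_distC; exact: far.
    - exact: far.
    - by [].
  move=> [l' Zl' ll']; exists l' => //.
  have [zeta' fz' zl'] := sel_zero _ (Zsel _ Zl').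
  have -> : zeta = zeta'.
    apply: zero_sep => //.
    have -> : zeta - zeta' = (zeta - l) + ((l - l') + (l' - zeta')) by ring.
    rewrite (le_trans (normooD _ _))//; have := normooD (l - l') (l' - zeta').
    by rewrite (normoo_distC l' zeta'); lra.
  by rewrite normoo_distC.
pose Phi zeta := xget 0 [set l | Z l /\ normoo (l - zeta) <= 2 * dl].
have PhiP zeta : Omega L zeta -> F zeta = 0 ->
    Z (Phi zeta) /\ normoo (Phi zeta - zeta) <= 2 * dl.
  move=> zL fz; have [l Zl lz] := exists_sel _ zL fz.
  by rewrite /Phi; case: xgetP => [y _ //|/(_ l)]; case.
exists Phi; split.
- by move=> zeta [fz zL]; have [] := PhiP _ zL fz.
- move=> zeta zeta' /set_mem[fz zL] /set_mem[fz' zL'] e.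
  have [_ p1] := PhiP _ zL fz; have [_ p2] := PhiP _ zL' fz'.
  apply: zero_sep => //; rewrite e in p1.
  have -> : zeta - zeta' = - (Phi zeta' - zeta) + (Phi zeta' - zeta') by ring.
  by rewrite (le_trans (normooD _ _))// normooN; lra.
- by move=> zeta [fz zL]; have [] := PhiP _ zL fz.
(* The margin [2 * dl] keeps the zero near [l] inside [Omega L]. Both [l] and [Phi zeta] are within
   [2 * dl] of it, hence too close for distinct points of [Z]. *)
- move=> l [Zl /OmegaP lL]; have [zeta fz zl] := sel_zero _ (Zsel _ Zl).
  have zL : Omega L zeta.
    apply/OmegaP; have -> : zeta = l + (zeta - l) by ring.
    by rewrite (le_trans (normooD _ _))//; lra.
  exists zeta => //; have [ZP p1] := PhiP _ zL fz.
  apply: contrapT => lP; have := Zsep _ _ Zl ZP lP.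
  have -> : l - Phi zeta = - (zeta - l) - (Phi zeta - zeta) by ring.
  have := normooD (- (zeta - l)) (- (Phi zeta - zeta)); rewrite !normooN; lra.
Qed.

End AmnDeterministic.

(** * Size of the Gaussian entire function on a square *)

Section UnionBound.
Context {R : realType} d (T : measurableType d) (P : probability T R).

Lemma measure_finite_union_le (I : finType) (A : I -> set T) (c : R) :
  (forall i, measurable (A i)) -> (forall i, (P (A i) <= c%:E)%E) ->
  measurable (\bigcup_i A i) /\ (P (\bigcup_i A i) <= (#|I|%:R * c)%:E)%E.
Proof.
move=> mA PA; rewrite cardT (_ : [set: I] = [set` enum I]) ?bigcup_seq; last first.
  by apply/seteqP; split=> i //= _; rewrite mem_enum.
elim: (enum I) => [|i s [ms Ps]]; first by rewrite big_nil measure0 mul0r.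
rewrite big_cons /=; split; first exact: measurableU.
apply: le_trans (measureU2 _ (mA i) ms) _.
by rewrite -natr1 mulrDl mul1r (addrC _ c) EFinD; apply: leeD; [exact: PA|exact: Ps].
Qed.

End UnionBound.

(** * Dyadic chaining of the weighted modulus *)

Section Chaining.
Context {R : realType}.
Implicit Types (F : R[i] -> R[i]) (z h : R[i]) (t : R).

(** For indices up to [2 * n * 2 ^ k] these are the points of mesh [2 ^ -k] in the square
    [Omega n]. *)
Definition dyadic (n k i j : nat) : R[i] :=
  (i%:R / 2 ^+ k - n%:R) +i* (j%:R / 2 ^+ k - n%:R).

(** The displacement from the parent at level [k], whose indices are the halves of [i] and [j]; it
    is recorded by their parities. *)
Definition dyadic_step (k i j : nat) : R[i] :=
  ((odd i)%:R / 2 ^+ k.+1) +i* ((odd j)%:R / 2 ^+ k.+1).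

Lemma dyadicS n k i j :
  dyadic n k.+1 i j = dyadic n k i./2 j./2 + dyadic_step k i j.
Proof.
have half (m : nat) : m%:R / 2 ^+ k.+1 = m./2%:R / 2 ^+ k + (odd m)%:R / 2 ^+ k.+1 :> R.
  rewrite -{1}(odd_double_half m) natrD -muln2 natrM exprS.
  by field; rewrite expf_neq0.
by apply: complexP; rewrite ?ReD ?ImD /= half; ring.
Qed.

Lemma sqr_normc_dyadic_step k i j : normc (dyadic_step k i j) ^+ 2 <= 2^-1 / 4 ^+ k.
Proof.
rewrite sqr_normc2 /= !expr_div_n -exprM mulnC exprM.
have -> : 2 ^+ 2 = 4 :> R by ring.
have p : 0 < (4 : R) ^+ k by rewrite exprn_gt0.
have b (m : bool) : (m%:R : R) ^+ 2 / 4 ^+ k.+1 <= 4^-1 / 4 ^+ k.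
  rewrite (exprS 4 k) invfM mulrA ler_wpM2r ?invr_ge0 ?(ltW p)//.
  by case: m; rewrite ?expr1n ?expr0n ?mul0r ?mul1r ?invr_ge0.
have := b (odd i); have := b (odd j).
have -> : 2^-1 / 4 ^+ k = 4^-1 / 4 ^+ k + 4^-1 / 4 ^+ k :> R by field; rewrite gt_eqF.
lra.
Qed.

(** The left side is the variance of the Gaussian increment over the step; [expR s - 1 <= 2 * s] for
    [s <= 1 / 2]. *)
Lemma expR_dyadic_step k i j : expR (normc (dyadic_step k i j) ^+ 2) - 1 <= (4 ^+ k)^-1.
Proof.
have H := sqr_normc_dyadic_step k i j; set s := normc _ ^+ 2 in H *.
have p1 : 0 < ((4 : R) ^+ k)^-1 <= 1.
  by rewrite invr_gt0 exprn_gt0//= invf_le1 ?exprn_gt0// exprn_ege1// ler1n.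
have s0 : 0 <= s := sqr_ge0 _.
have := expR_ge1Dx (- s); have := expRxMexpNx_1 s; have := expR_gt0 s.
move: p1 H s0; set v := _^-1; set e := expR s; move=> /andP[v0 v1] H s0 e0 ee e1.
have : (1 - s) * e <= 1 by rewrite -ee mulrC ler_wpM2l ?(ltW e0)//; lra.
nra.
Qed.

(** At [h] the modulus of the translate exceeds the weighted modulus at [z + h] by the factor
    [expR (normc h ^ 2 / 2) >= 1], so weights at different points never have to be compared. *)
Lemma weight_shift_le F z h : weight (z + h) * normc (F (z + h)) <=
  weight z * normc (F z) + normc (fock_shift F z h - fock_shift F z 0).
Proof.
apply: (@le_trans _ _ (normc (fock_shift F z h))).
  rewrite normc_fock_shift ler_peMl ?mulr_ge0 ?expR_ge0 ?normc_ge0//.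
  by rewrite -expR0 ler_expR divr_ge0// sqr_ge0.
have := le_normc_dist (fock_shift F z h) (fock_shift F z 0).
by rewrite normc_fock_shift0; lra.
Qed.

(* The allowed increments [t (k+1) 2^-k] sum to [4 t], whence the limit [5 t]. *)
Lemma dyadic_chaining F (n : nat) t :
  (forall i j, (i <= 2 * n)%N -> (j <= 2 * n)%N ->
     weight (dyadic n 0 i j) * normc (F (dyadic n 0 i j)) <= t) ->
  (forall k i j, (i <= 2 * n * 2 ^ k.+1)%N -> (j <= 2 * n * 2 ^ k.+1)%N ->
     normc (fock_shift F (dyadic n k i./2 j./2) (dyadic_step k i j)
            - fock_shift F (dyadic n k i./2 j./2) 0) <= t * (k.+1%:R / 2 ^+ k)) ->
  forall k i j, (i <= 2 * n * 2 ^ k)%N -> (j <= 2 * n * 2 ^ k)%N ->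
    weight (dyadic n k i j) * normc (F (dyadic n k i j)) <=
      t * (5 - (2 * k%:R + 4) / 2 ^+ k).
Proof.
move=> H0 HS; elim=> [|k IH] i j ik jk.
  rewrite expn0 muln1 in ik jk; apply: le_trans (H0 _ _ ik jk) _.
  by rewrite expr0 divr1 mulr0 add0r; lra.
have half m : (m <= 2 * n * 2 ^ k.+1)%N -> (m./2 <= 2 * n * 2 ^ k)%N.
  by rewrite expnS mulnCA mul2n leq_half_double => /leq_trans; apply.
rewrite dyadicS; apply: le_trans (weight_shift_le _ _ _) _.
have := IH _ _ (half _ ik) (half _ jk); have := HS _ _ _ ik jk.
set x := normc _; set y := _ * normc _ => h1 h2.
suff -> : t * (5 - (2 * k.+1%:R + 4) / 2 ^+ k.+1) =
  t * (5 - (2 * k%:R + 4) / 2 ^+ k) + t * (k.+1%:R / 2 ^+ k) by lra.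
by rewrite -!natr1 exprS; field; rewrite expf_neq0.
Qed.

Lemma dyadic_approx (n : nat) z (e : R) : 0 < e -> Omega n%:R z ->
  exists k i j, [/\ (i <= 2 * n * 2 ^ k)%N, (j <= 2 * n * 2 ^ k)%N &
    normc (dyadic n k i j - z) <= e].
Proof.
move=> e0; case: z => x y [/= xn yn].
have [k ke] : exists k, 2 / 2 ^+ k <= e.
  exists (Num.truncn (2 / e)).+1; set k := _.+1.
  have /andP[_ k1] := truncn_itv (divr_ge0 (ler0n R 2) (ltW e0)); rewrite -/k in k1.
  rewrite ler_pdivrMr ?exprn_gt0// -ler_pdivrMl// mulrC; apply: (le_trans (ltW k1)).
  by rewrite -natrX ler_nat ltnW// ltn_expl.
have p : 0 < (2 : R) ^+ k by rewrite exprn_gt0.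
have near (u : R) : `|u| <= n%:R ->
    exists2 i, (i <= 2 * n * 2 ^ k)%N & `|i%:R / 2 ^+ k - n%:R - u| <= 1 / 2 ^+ k.
  rewrite ler_norml => /andP[u1 u2].
  pose v := (u + n%:R) * 2 ^+ k; have v0 : 0 <= v by rewrite mulr_ge0 ?(ltW p)//; lra.
  exists (Num.truncn v); have /andP[t1 t2] := truncn_itv v0.
    rewrite -(ler_nat R); apply: (le_trans t1).
    by rewrite /v !natrM natrX ler_wpM2r ?(ltW p)//; lra.
  rewrite -natr1 in t2; set w := (Num.truncn v)%:R in t1 t2 *.
  have -> : w / 2 ^+ k - n%:R - u = (w - v) / 2 ^+ k by rewrite /v; field; rewrite gt_eqF.
  rewrite normrM [X in _ * X]gtr0_norm ?invr_gt0// ler_wpM2r ?invr_ge0 ?(ltW p)//.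
  by rewrite ler_norml; apply/andP; split; lra.
have [i ik id] := near _ xn; have [j jk jd] := near _ yn.
exists k, i, j; split=> //; have := normc_le_ReIm (dyadic n k i j - (x +i* y)).
rewrite ReB ImB /=; move: ke id jd; lra.
Qed.

(** Dyadic points are dense. Continuity of the weighted modulus at [z] is taken from that of
    [fock_shift F z] at 0, up to the factor [expR (normc h ^ 2 / 2)]. *)
Lemma weight_le_dense F (n : nat) z (B : R) : (forall w, exists m, cdiff F w m) ->
  Omega n%:R z ->
  (forall k i j, (i <= 2 * n * 2 ^ k)%N -> (j <= 2 * n * 2 ^ k)%N ->
     weight (dyadic n k i j) * normc (F (dyadic n k i j)) <= B) ->
  weight z * normc (F z) <= B.
Proof.
move=> dF zn H; rewrite leNgt; apply/negP => BW.
set W := weight z * normc (F z) in BW.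
have W0 : 0 <= W by rewrite mulr_ge0 ?expR_ge0 ?normc_ge0.
have D0 : 0 < (W - B) / 2 by rewrite divr_gt0//; lra.
have [l dl] := cdiff_fock_shift z dF 0; have [r r0 Hr] := cdiff_continuous dl D0.
(* An excess of [W] over [B] shrinks to half by continuity; the last entry keeps the loss from the
   exponential factor below the other half. *)
pose e := Num.min r (Num.min 1 ((W - B) / (2 * (W + 1)))).
have e0 : 0 < e by rewrite !lt_min r0 ltr01/= divr_gt0//; lra.
have [k [i [j [ik jk he]]]] := dyadic_approx e0 zn.
have := H _ _ _ ik jk; set w := dyadic n k i j in he *; pose h := w - z.
have -> : w = z + h by rewrite /h addrC subrK.
have [hr h1 hW] : [/\ normc h <= r, normc h <= 1 & normc h * (W + 1) <= (W - B) / 2].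
  split; rewrite ?(le_trans he)// ?/e ?ge_min ?lexx ?orbT//.
  have : normc h <= (W - B) / (2 * (W + 1)).
    by apply: (le_trans he); rewrite /e !ge_min lexx !orbT.
  rewrite ler_pdivlMr; last by lra.
  by lra.
have := Hr _ hr; rewrite add0r => g.
have := le_normc_dist (fock_shift F z 0) (fock_shift F z h).
rewrite (normc_distC (fock_shift F z 0)) normc_fock_shift0 -/W => g'.
have G : normc (fock_shift F z h) >= (W + B) / 2 by lra.
rewrite normc_fock_shift in G.
have E := expR_ge1Dx (- (normc h ^+ 2 / 2)).
have EE : expR (- (normc h ^+ 2 / 2)) * expR (normc h ^+ 2 / 2) = 1.
  by rewrite -expRD addNr expR0.
have N0 := normc_ge0 h.
have h2 : normc h ^+ 2 <= normc h by rewrite expr2 ler_piMl.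
move: G E EE; set p := expR _; set q := expR _; set V := _ * normc (F _) => G E EE VB.
have V0 : 0 <= V by rewrite mulr_ge0 ?expR_ge0 ?normc_ge0.
have p0 : 0 < p := expR_gt0 _.
have B0 : 0 <= B by lra.
have W1 : 0 < W by lra.
have : V >= q * ((W + B) / 2).
  have -> : V = q * (p * V) by rewrite mulrA EE mul1r.
  by rewrite ler_wpM2l// expR_ge0.
have : q * ((W + B) / 2) >= (1 - normc h / 2) * ((W + B) / 2).
  by apply: ler_wpM2r; lra.
nra.
Qed.

End Chaining.

Section GaussianSup.
Context {R : realType} d (T : measurableType d) (P : probability T R).
Variable F0 : T -> R[i] -> R[i].
Hypothesis F0_gauss : gaussian_entire_function P F0.

Lemma fock_valueE z w : fock_value F0 z w = fock_shift (F0 w) z 0.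
Proof. by rewrite fock_shift0. Qed.

Lemma fock_incrementE z h w :
  fock_increment F0 z h w = fock_shift (F0 w) z h - fock_shift (F0 w) z 0.
Proof. by rewrite fock_shift0 /fock_increment mulrBr. Qed.

(** Level 0 controls values on the integer points, level [k'.+1] the increments from level [k']; a
    single family lets one union bound treat both. *)
Definition chaining_exception (n : nat) (t : R) (k i j : nat) : set T :=
  if k is k'.+1 then
    [set w | t * (k'.+1%:R / 2 ^+ k') <
       normc (fock_increment F0 (dyadic n k' i./2 j./2) (dyadic_step k' i j) w)]
  else [set w | t < normc (fock_value F0 (dyadic n 0 i j) w)].

Lemma measurable_chaining_exception n t k i j : measurable (chaining_exception n t k i j).
Proof.
case: k => [|k] /=; apply: measurable_gt_normc.
- by have [] := measurable_fock_value F0_gauss (dyadic n 0 i j).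
- by have [] := measurable_fock_value F0_gauss (dyadic n 0 i j).
- by have [] := measurable_fock_increment F0_gauss (dyadic n k i./2 j./2) (dyadic_step k i j).
- by have [] := measurable_fock_increment F0_gauss (dyadic n k i./2 j./2) (dyadic_step k i j).
Qed.

(** The threshold at step [k] is [k.+1] deviations of size [t], so the tail is [q] to the power
    [k.+1 ^ 2], with [q = expR (- (t ^ 2 / 8))]. Keeping only the power [k.+1] and using
    [q <= 1 / 8] gives a decay [8 ^ -k] that beats the number of points, of order [4 ^ k]. *)
Lemma chaining_exception_le n t k i j : 0 < t -> expR (- (t ^+ 2 / 8)) <= 1 / 8 ->
  (P (chaining_exception n t k i j) <= (32 * expR (- (t ^+ 2 / 8)) / 8 ^+ k)%:E)%E.
Proof.
move=> t0; have := expR_gt0 (- (t ^+ 2 / 8)); set q := expR _ => q0 q8.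
case: k => [|k] /=.
  apply: le_trans (fock_value_tail F0_gauss _ t0) _.
  by rewrite lee_fin -/q expr0 divr1; lra.
have p2 : 0 < (2 : R) ^+ k by rewrite exprn_gt0.
have p4 : 0 < (4 : R) ^+ k by rewrite exprn_gt0.
apply: le_trans (fock_increment_tail F0_gauss _ _ _ (expR_dyadic_step k i j)) _.
- by rewrite mulr_gt0// divr_gt0.
- by rewrite invr_gt0.
have -> : (t * (k.+1%:R / 2 ^+ k)) ^+ 2 / (8 * (4 ^+ k)^-1) = k.+1%:R ^+ 2 * (t ^+ 2 / 8).
  rewrite (_ : 4 ^+ k = (2 ^+ k) ^+ 2); last by rewrite -exprM mulnC exprM; congr (_ ^+ k); ring.
  by field; rewrite gt_eqF.
rewrite lee_fin; apply: (@le_trans _ _ (4 * q ^+ k.+1)).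
  rewrite ler_wpM2l// -expRM_natl ler_expR mulrN lerN2 ler_wpM2r//.
    by rewrite divr_ge0// sqr_ge0.
  by rewrite expr2 ler_peMl// ler1n.
have -> : 32 * q / 8 ^+ k.+1 = 4 * (q * (1 / 8) ^+ k).
  by rewrite expr_div_n expr1n exprS; field; rewrite expf_neq0.
rewrite exprS ler_wpM2l// ler_wpM2l ?(ltW q0)//.
by rewrite lerXn2r// nnegrE ?divr_ge0// ltW.
Qed.

(* The exceptional events at level [k] number about [4^k] and have probability at
   most [4 q^k], where [q = e^(-t^2/8)], since the increments over steps of size
   [2^-k] have variance [O (4^-k)]. *)
Lemma gaussian_sup_tail (n : nat) (t : R) : (0 < n)%N -> 0 < t ->
  expR (- (t ^+ 2 / 8)) <= 1 / 8 ->
  exists B : set T, [/\ measurable B,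
    (P B <= (576 * n%:R ^+ 2 * expR (- (t ^+ 2 / 8)))%:E)%E &
    forall w, ~ B w -> (forall z, exists m, cdiff (F0 w) z m) ->
      forall z, Omega n%:R z -> weight z * normc (F0 w z) <= 5 * t].
Proof.
move=> n0 t0 q8; set q := expR _ in q8 *.
have q0 : 0 < q := expR_gt0 _.
pose N k := (2 * n * 2 ^ k).+1.
pose E k := \bigcup_(p : 'I_(N k) * 'I_(N k)) chaining_exception n t k p.1 p.2.
have HE k : measurable (E k) /\ (P (E k) <= (576 * n%:R ^+ 2 * q / (2 ^ k.+1)%:R)%:E)%E.
  have [mE PE] := measure_finite_union_le (P := P)
    (fun p : 'I_(N k) * 'I_(N k) => measurable_chaining_exception n t k p.1 p.2)
    (fun p => chaining_exception_le n k p.1 p.2 t0 q8).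
  split=> //; apply: le_trans PE _; rewrite lee_fin card_prod card_ord -/q.
  have N3 : (N k)%:R <= 3 * n%:R * 2 ^+ k :> R.
    rewrite -natrX -!natrM ler_nat /N.
    by rewrite (mulSn 2 n) (mulnDl n) -add1n leq_add2r muln_gt0 n0 expn_gt0.
  have p2 : 0 < (2 : R) ^+ k by rewrite exprn_gt0.
  have p8 : 0 < (8 : R) ^+ k by rewrite exprn_gt0.
  (* [576 = 9 * 32 * 2]: the square of [3 * n * 2 ^ k] bounds the number of points, and the last 2
     normalizes the level bounds to [2 ^ -(k.+1)], which sum to 1. *)
  have -> : 576 * n%:R ^+ 2 * q / (2 ^ k.+1)%:R =
      (3 * n%:R * 2 ^+ k) ^+ 2 * (32 * q / 8 ^+ k).
    rewrite natrX (exprS 2 k) (_ : 8 ^+ k = (2 ^+ k) ^+ 3); last first.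
      by rewrite -exprM mulnC exprM; congr (_ ^+ k); ring.
    by field; rewrite gt_eqF.
  apply: ler_wpM2r; first by rewrite divr_ge0 ?(ltW p8)// mulr_ge0// ltW.
  by rewrite natrM -expr2 lerXn2r// nnegrE ?mulr_ge0// ltW.
exists (\bigcup_k E k); split.
- by apply: bigcup_measurable => k _; have [] := HE k.
- have mE k : measurable (E k) by have [] := HE k.
  apply: le_trans (measure_sigma_subadditive P mE _ _) _ => //.
    by apply: bigcup_measurable.
  apply: le_trans (lee_nneseries _ (v := fun k => (576 * n%:R ^+ 2 * q / (2 ^ k.+1)%:R)%:E) _) _.
  + by move=> k _ _; exact: measure_ge0.
  + by move=> k _; have [] := HE k.
  + apply: epsilon_trick0; apply: mulr_ge0; last exact: ltW.
    by apply: mulr_ge0; [rewrite ler0n|exact: sqr_ge0].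
move=> w nB dF z zn.
have good k i j : (i <= 2 * n * 2 ^ k)%N -> (j <= 2 * n * 2 ^ k)%N ->
    ~ chaining_exception n t k i j w.
  rewrite -ltnS -(ltnS j) => ik jk bad; apply: nB; exists k => //.
  by exists (Ordinal ik, Ordinal jk).
apply: (weight_le_dense dF zn) => k i j ik jk.
apply: (@le_trans _ _ (t * (5 - (2 * k%:R + 4) / 2 ^+ k))).
  apply: dyadic_chaining ik jk => [a b an bn|k' a b ak bk].
    have := @good 0%N a b; rewrite expn0 muln1 => /(_ an bn)/= /negP.
    by rewrite -leNgt fock_valueE normc_fock_shift0.
  have := good k'.+1 a b ak bk => /= /negP.
  by rewrite -leNgt fock_incrementE.
rewrite mulrC ler_wpM2r ?(ltW t0)// gerBl.
by rewrite divr_ge0 ?exprn_ge0// addr_ge0// mulr_ge0.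
Qed.

End GaussianSup.

(** * Probability of the exceptional event *)

Section Assembly.
Context {R : realType}.

Lemma with_probability_at_leastC d (T : measurableType d) (P : probability T R)
  (p : R) (bad E : set T) : measurable bad -> (P bad <= p%:E)%E -> ~` bad `<=` E ->
  with_probability_at_least P (1 - p) E.
Proof.
move=> mb Pb bE; exists (~` bad); split=> //; first exact: measurableC.
by rewrite probability_setC// EFinB leeB.
Qed.

Lemma pow4D_le (a b : R) : 0 <= a -> 0 <= b -> (a + b) ^+ 4 <= 8 * (a ^+ 4 + b ^+ 4).
Proof.
move=> a0 b0; have h : (a + b) ^+ 2 <= 2 * (a ^+ 2 + b ^+ 2).
  by have := sqr_ge0 (a - b); rewrite sqrrB sqrrD; lra.
have -> : (a + b) ^+ 4 = ((a + b) ^+ 2) ^+ 2 by ring.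
apply: (@le_trans _ _ ((2 * (a ^+ 2 + b ^+ 2)) ^+ 2)).
  by rewrite lerXn2r// nnegrE ?mulr_ge0 ?addr_ge0 ?sqr_ge0.
by have := sqr_ge0 (a ^+ 2 - b ^+ 2); rewrite exprMn sqrrB sqrrD -!exprM; lra.
Qed.

(** With [y = a ^ 2 / 16] this is [y ^ 2 <= expR y ^ 2]. It converts the fourth power of [A / sigma]
    into the exponential factor of the theorem. *)
Lemma pow4_le_expR (a : R) : 0 <= a -> a ^+ 4 <= 256 * expR (a ^+ 2 / 8).
Proof.
move=> a0; have y0 : 0 <= a ^+ 2 / 8 / 2 by rewrite !divr_ge0// sqr_ge0.
have -> : a ^+ 4 = 256 * (a ^+ 2 / 8 / 2) ^+ 2 by field.
have -> : expR (a ^+ 2 / 8) = expR (a ^+ 2 / 8 / 2) ^+ 2.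
  by rewrite -expRM_natl; congr expR; field.
rewrite ler_wpM2l ?ler0n// lerXn2r ?nnegrE ?expR_ge0//.
by have := expR_ge1Dx (a ^+ 2 / 8 / 2); lra.
Qed.

Lemma grid_Omega_index (L dl : R) (n : nat) l : 0 < dl -> L = dl * n%:R ->
  (grid dl `&` Omega L) l ->
  exists p : 'I_(2 * n).+1 * 'I_(2 * n).+1,
    l = (dl * (p.1%:R - n%:R)) +i* (dl * (p.2%:R - n%:R)).
Proof.
move=> dl0 LE [[k [j ->]] [/= kL jL]].
have idx (m : int) : `|dl * m%:~R| <= L ->
    exists p : 'I_(2 * n).+1, m%:~R = p%:R - n%:R :> R.
  rewrite LE normrM (gtr0_norm dl0) ler_pM2l// -intr_norm -[n%:R]/(n%:Z%:~R) ler_int.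
  rewrite ler_norml => /andP[m1 m2].
  have mn0 : 0 <= m + n%:Z by rewrite -lerBlDr sub0r.
  have mE : (absz (m + n%:Z))%:Z = m + n%:Z by rewrite gez0_abs.
  have lt : (absz (m + n%:Z)%R < (2 * n).+1)%N.
    by rewrite ltnS -lez_nat mE mul2n -addnn PoszD lerD2r.
  exists (Ordinal lt); rewrite /= -[(absz _)%:R]/((absz (m + n%:Z))%:Z%:~R) mE.
  by rewrite intrD addrK.
have [p1 ->] := idx _ kL; have [p2 ->] := idx _ jL.
by exists (p1, p2).
Qed.

Lemma weight_expR (z : R[i]) : weight z * expR (normc z ^+ 2 / 2) = 1.
Proof. by rewrite /weight -expRD addNr expR0. Qed.

(** After division by [sigma], the contribution of [F1] is a deterministic shift, to which the
    small-ball bound is insensitive. The union is over [(2 * n).+1 ^ 2] grid points, and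
    [(2 * n).+1 * dl <= 3 * L] gives the 9. *)
Lemma amn_nondegenerate d (T : measurableType d) (P : probability T R) F0
  (F1 : R[i] -> R[i]) (L dl sigma M : R) (n : nat) :
  gaussian_entire_function P F0 ->
  0 < dl -> dl <= L -> L = dl * n%:R -> 0 < sigma -> 0 < M ->
  let F := fun w z => F1 z + sigma%:C * F0 w z in
  exists B : set T, [/\ measurable B,
    (P B <= (9 * small_ball_constant * (L ^+ 2 * M ^+ 4 * dl ^+ 4))%:E)%E &
    forall w, ~ B w -> forall l, (grid dl `&` Omega L) l ->
      ~ (weight l * normc (F w l) <= sigma * (M * dl ^+ 2) /\
         weight l * normc (cexp (- (dl%:C * conjc l)) * F w (l + dl%:C) - F w l)
           <= sigma * (M * dl ^+ 2))].
Proof.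
move=> G dl0 dL LE s0 M0 F; pose e := M * dl ^+ 2.
have e0 : 0 < e by rewrite mulr_gt0// exprn_gt0.
pose l (p : 'I_(2 * n).+1 * 'I_(2 * n).+1) : R[i] :=
  (dl * (p.1%:R - n%:R)) +i* (dl * (p.2%:R - n%:R)).
have sC0 : sigma%:C != 0 :> R[i] by rewrite -[0]/(0%:C) (inj_eq (@complexI R)) gt_eqF.
pose x l := (weight l)%:C * F1 l / sigma%:C.
pose y l := (weight l)%:C * (cexp (- (dl%:C * conjc l)) * F1 (l + dl%:C) - F1 l) / sigma%:C.
have dC0 : dl%:C != 0 :> R[i] by rewrite -[0]/(0%:C) (inj_eq (@complexI R)) gt_eqF.
have [mB PB] := measure_finite_union_le (P := P)
  (fun p => measurable_small_ball G (l p) dl%:C (x (l p)) (y (l p)) e e)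
  (fun p => fock_small_ball G (l p) (x (l p)) (y (l p)) dC0 e0 e0).
set B := \bigcup_p _ in mB PB; exists B; split=> //.
  apply: le_trans PB _; rewrite lee_fin card_prod card_ord natrM -expr2.
  rewrite normc_real gtr0_norm//.
  have S0 := @small_ball_constant_gt0 R.
  have N3 : (2 * n).+1%:R * dl <= 3 * L.
    by rewrite -natr1 natrM mulrDl LE; rewrite LE in dL; lra.
  rewrite [leLHS](_ : _ = small_ball_constant * M ^+ 4 * dl ^+ 4 * ((2 * n).+1%:R * dl) ^+ 2).
    rewrite [leRHS](_ : _ = small_ball_constant * M ^+ 4 * dl ^+ 4 * (3 * L) ^+ 2); last by ring.
    apply: ler_wpM2l.
      apply: mulr_ge0; last exact: exprn_ge0 (ltW dl0).
      by apply: mulr_ge0; [exact: ltW|exact: exprn_ge0 (ltW M0)].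
    rewrite lerXn2r// nnegrE; apply: mulr_ge0 => //; first exact: ltW.
    exact: le_trans (ltW dl0) dL.
  by rewrite /e; field; rewrite gt_eqF.
move=> w nB z zG [h1 h2]; apply: nB.
have [p zE] := grid_Omega_index dl0 LE zG; exists p => //=.
rewrite {}zE -/(l p) in h1 h2.
have sN (u v : R[i]) : (weight (l p))%:C * (u + sigma%:C * v) =
    sigma%:C * ((weight (l p))%:C * v + (weight (l p))%:C * u / sigma%:C) by field.
have cancel (u : R[i]) : normc (sigma%:C * u) <= sigma * (M * dl ^+ 2) -> normc u <= e.
  by rewrite normcM normc_real gtr0_norm// ler_pM2l.
have wN (u : R[i]) : weight (l p) * normc u = normc ((weight (l p))%:C * u).
  by rewrite normcM normc_real ger0_norm ?expR_ge0.
split; apply: cancel.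
  by rewrite /fock_value /x -sN -wN.
rewrite /fock_increment /y -sN -wN; congr (_ * normc _ <= _): h2.
by rewrite /F; ring.
Qed.

End Assembly.

Theorem theorem2p2 (R : realType) :
  exists C : R, 0 < C /\
  forall (L sigma delta A : R),
    1 <= L -> 0 < sigma -> 0 < delta ->
    (exists n : nat, L / delta = n%:R) ->
    0 <= A ->
  forall F1 : R[i] -> R[i],
    entire F1 ->
    (forall z, normc (F1 z) <= A * expR (normc z ^+ 2 / 2)) ->
  forall (d : measure_display) (T : measurableType d) (P : probability T R)
    (F0 : T -> R[i] -> R[i]),
    gaussian_entire_function P F0 ->
  let F := fun w z => F1 z + sigma%:C * F0 w z in
  forall Z : T -> set R[i],
    (forall w, amn_output L delta (F w) (Z w)) ->
  with_probability_at_least P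
    (1 - C * L ^+ 2 * expR (A ^+ 2 / (8 * sigma ^+ 2))
         * Num.max 1 (ln (1 / delta) ^+ 2) * delta ^+ 4)
    [set w | exists Phi : R[i] -> R[i],
      [/\ set_fun (zero_set (F w) `&` Omega L) (Z w) Phi,
          set_inj (zero_set (F w) `&` Omega L) Phi,
          forall zeta, (zero_set (F w) `&` Omega L) zeta ->
            normoo (Phi zeta - zeta) <= 2 * delta
        & forall lambda, (Z w `&` Omega (L - 2 * delta)) lambda ->
            exists2 zeta, (zero_set (F w) `&` Omega L) zeta &
              lambda = Phi zeta]].
Proof.
have [K K0 amn] := @amn_deterministic R.
pose S := @small_ball_constant R; have S0 : 0 < S := small_ball_constant_gt0.
(* From [pow4D_le], with [a ^ 4 <= 256 * expR (a ^ 2 / 8)] and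
   [(5 * t) ^ 4 = 625 * 1024 * l ^ 2]. *)
pose c4 : R := 8 * (256 + 625 * 1024).
have c40 : 0 < c4 by rewrite /c4; lra.
have amp (a l t : R) : 0 <= a -> 0 <= t -> t ^+ 2 = 32 * l ->
    (a + 5 * t) ^+ 4 <= c4 * (expR (a ^+ 2 / 8) * Num.max 1 (l ^+ 2)).
  move=> a0 t0 tE; apply: le_trans (pow4D_le a0 (mulr_ge0 (ler0n R 5) t0)) _.
  have -> : (5 * t) ^+ 4 = 625 * 1024 * l ^+ 2.
    by transitivity (625 * (t ^+ 2) ^+ 2); [ring|rewrite tE; ring].
  rewrite /c4 -!(mulrA 8) ler_wpM2l ?ler0n// [leRHS]mulrDl; apply: lerD.
    apply: le_trans (pow4_le_expR a0) _; rewrite ler_wpM2l ?ler0n//.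
    by rewrite ler_peMr ?expR_ge0// le_max lexx.
  rewrite ler_wpM2l ?mulr_ge0 ?ler0n ?andbT//.
  apply: (@le_trans _ _ (Num.max 1 (l ^+ 2))); first by rewrite le_max lexx orbT.
  rewrite ler_peMl//; first by rewrite le_max ler01.
  by rewrite -expR0 ler_expR divr_ge0// sqr_ge0.
(* Three contributions: spacings above [1 / 48], the exceptional set of the supremum bound (where
   [n <= 3 * L]), and degenerate grid points. *)
pose C : R := 48 ^+ 4 + (576 * 9 + 9 * S * (K ^+ 4 * c4)).
have b1 : 0 < 576 * 9 :> R by lra.
have b2 : 0 < 9 * S * (K ^+ 4 * c4) by apply: mulr_gt0; apply: mulr_gt0 => //; rewrite ?exprn_gt0 ?ltr0n.
have b3 : 0 < (48 : R) ^+ 4 by rewrite exprn_gt0 ?ltr0n.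
have C0 : 0 < C by rewrite !addr_gt0.
exists C; split=> // L sg dl A L1 sg0 dl0 [m Lm] A0 F1 eF1 F1A d T P F0 G F Z HZ.
have LE : L = dl * m%:R by rewrite -Lm mulrC divfK// gt_eqF.
set good := [set w | _]; set ge := expR _; set mx := Num.max 1 _.
have ge1 : 1 <= ge.
  by rewrite /ge -expR0 ler_expR divr_ge0 ?mulr_ge0 ?sqr_ge0// ltW.
have mx1 : 1 <= mx by rewrite /mx le_max lexx.
have L21 : 1 <= L ^+ 2 by rewrite exprn_ege1.
have gm1 : 1 <= ge * mx by rewrite mulr_ege1.
have Lgm : L ^+ 2 <= L ^+ 2 * (ge * mx) by rewrite ler_peMr// sqr_ge0.
have [dl1|dl1] := lerP dl (1 / 48); last first.
  (* For delta > 1/48 the asserted lower bound is nonpositive. *)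
  exists set0; split=> //; rewrite measure0 lee_fin subr_le0.
  have : 1 <= (48 * dl) ^+ 4 by rewrite exprn_ege1//; lra.
  rewrite exprMn => h; apply: (le_trans h).
  rewrite ler_wpM2r ?exprn_ge0 ?(ltW dl0)// -(mulrA _ ge) -(mulrA C).
  apply: (@le_trans _ _ C); first by rewrite lerDl; exact: ltW (addr_gt0 b1 b2).
  by rewrite ler_peMr ?(ltW C0) ?(le_trans L21 Lgm).
pose l := ln (1 / dl).
have lE : l = - ln dl by rewrite /l div1r lnV// posrE.
have l0 : 0 < l by rewrite lE oppr_gt0 ln_lt0//; apply/andP; split=> //; lra.
pose t := Num.sqrt (32 * l).
have l320 : 0 < 32 * l by rewrite mulr_gt0// ltr0n.
have tE : t ^+ 2 = 32 * l by rewrite sqr_sqrtr// ltW.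
have t0 : 0 < t by rewrite sqrtr_gt0.
have qE : expR (- (t ^+ 2 / 8)) = dl ^+ 4.
  have -> : - (t ^+ 2 / 8) = 4%:R * ln dl by rewrite tE lE; field.
  by rewrite expRM_natl lnK// posrE.
have q8 : expR (- (t ^+ 2 / 8)) <= 1 / 8.
  rewrite qE; apply: (@le_trans _ _ dl); last by lra.
  by rewrite -[leRHS]expr1 ler_wiXn2l// ?(ltW dl0)//; lra.
(* An integer with [L + 1 <= n <= 3 * L]: the square must contain [Omega (L + 1)], and its area must
   remain of order [L ^ 2]. *)
pose n := (Num.truncn L).+2.
have L0 : 0 <= L by lra.
have /andP[nL1 nL2] := truncn_itv L0.
have nE : n%:R = (Num.truncn L)%:R + 2 :> R by rewrite /n -[_.+2]addn2 natrD.
rewrite -natr1 in nL2.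
have [B1 [mB1 PB1 goodB1]] := gaussian_sup_tail G (isT : (0 < n)%N) t0 q8.
have [B0 [mB0 PB0 subB0]] := G.1.
pose M := A + sg * (5 * t).
have M0 : 0 < M by rewrite ltr_wpDl// mulr_gt0// mulr_gt0// ltr0n.
(* Taken relative to [sg], this amplitude makes the small-ball threshold equal to the
   [K * M * dl ^ 2] of the deterministic statement. *)
have KM0 : 0 < K * (M / sg) by rewrite mulr_gt0// divr_gt0.
have dL : dl <= L by lra.
have [B2 [mB2 PB2 goodB2]] := amn_nondegenerate F1 G dl0 dL LE sg0 KM0.
apply: (@with_probability_at_leastC _ _ _ _ _ (B0 `|` (B1 `|` B2))).
- by apply: measurableU => //; exact: measurableU.
- apply: le_trans (measureU2 _ mB0 (measurableU _ _ mB1 mB2)) _.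
  have {}PB0 : (P B0 <= 0%:E)%E by move: PB0 => /= ->.
  apply: le_trans (leeD PB0 (le_trans (measureU2 _ mB1 mB2) (leeD PB1 PB2))) _.
  rewrite -!EFinD add0r lee_fin qE.
  have d4 : 0 < dl ^+ 4 by rewrite exprn_gt0.
  have n2 : n%:R ^+ 2 <= 9 * L ^+ 2 :> R.
    rewrite (_ : 9 * L ^+ 2 = (3 * L) ^+ 2); last by ring.
    by rewrite lerXn2r ?nnegrE ?ler0n ?mulr_ge0//; lra.
  have M4 : (M / sg) ^+ 4 <= c4 * (ge * mx).
    have -> : M / sg = A / sg + 5 * t by rewrite /M; field; rewrite gt_eqF.
    have := amp (A / sg) l t (divr_ge0 A0 (ltW sg0)) (ltW t0) tE.
    rewrite /ge /mx (_ : (A / sg) ^+ 2 / 8 = A ^+ 2 / (8 * sg ^+ 2))//.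
    by field; rewrite gt_eqF.
  rewrite -(mulrA _ ge) -(mulrA C) [leRHS]mulrC -/S.
  have -> : 576 * n%:R ^+ 2 * dl ^+ 4 + 9 * S * (L ^+ 2 * (K * (M / sg)) ^+ 4 * dl ^+ 4) =
     dl ^+ 4 * (576 * n%:R ^+ 2 + 9 * S * K ^+ 4 * L ^+ 2 * (M / sg) ^+ 4).
    by rewrite exprMn; ring.
  rewrite ler_wpM2l ?(ltW d4)//.
  have h1 : 576 * n%:R ^+ 2 <= 576 * 9 * (L ^+ 2 * (ge * mx)).
    rewrite -mulrA ler_wpM2l ?ler0n//; apply: (le_trans n2).
    by rewrite ler_wpM2l ?ler0n.
  have h2 : 9 * S * K ^+ 4 * L ^+ 2 * (M / sg) ^+ 4 <=
      9 * S * (K ^+ 4 * c4) * (L ^+ 2 * (ge * mx)).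
    rewrite [leRHS](_ : _ = 9 * S * K ^+ 4 * L ^+ 2 * (c4 * (ge * mx))); last by ring.
    apply: ler_wpM2l M4; apply: mulr_ge0; last exact: sqr_ge0.
    apply: mulr_ge0; last exact: exprn_ge0 (ltW K0).
    by apply: mulr_ge0; [rewrite ler0n|exact: ltW].
  apply: (le_trans (lerD h1 h2)); rewrite -mulrDl; apply: ler_wpM2r.
    by apply: mulr_ge0; [exact: sqr_ge0|exact: le_trans gm1].
  by rewrite lerDr; exact: ltW b3.
move=> w /not_orP[nB0 /not_orP[nB1 nB2]]; rewrite /good /=.
(* Samples outside the null set [B0] are entire; only there are the deterministic estimates
   invoked. *)
have eF0 z : exists m, cdiff (F0 w) z m.
  apply: derivable_cdiff; apply: contrapT => H; apply: nB0; apply: subB0 => /=.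
  by move=> /(_ z).
have eF z : exists m, cdiff (F w) z m.
  have [m1 D1] := derivable_cdiff (eF1 z); have [m2 D2] := eF0 z.
  by eexists; apply: cdiffD D1 (cdiffM (cdiff_cst sg%:C z) D2).
have bF z : Omega (L + 1) z -> weight z * normc (F w z) <= M.
  move=> [zx zy].
  have Ln : L + 1 <= n%:R by rewrite nE (_ : 2 = 1 + 1)// addrA lerD2r ltW.
  have zn : Omega n%:R z by split; [exact: le_trans zx Ln|exact: le_trans zy Ln].
  have h0 := goodB1 w nB1 eF0 z zn.
  have w0 : 0 <= weight z := expR_ge0 _.
  apply: (@le_trans _ _ (weight z * (normc (F1 z) + sg * normc (F0 w z)))).
    rewrite ler_wpM2l//; apply: le_trans (le_normcD _ _) _.
    by rewrite normcM normc_real gtr0_norm.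
  rewrite mulrDr mulrCA; apply: lerD; last by rewrite ler_wpM2l// ltW.
  apply: le_trans (ler_wpM2l w0 (F1A z)) _.
  by rewrite mulrCA weight_expR mulr1.
apply: (amn L dl M (F w) (Z w)) => //; first by exists m.
move=> z zG; have := goodB2 w nB2 z zG.
by rewrite (_ : sg * (K * (M / sg) * dl ^+ 2) = K * M * dl ^+ 2)//; field; rewrite gt_eqF.
Qed.
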